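(* Let $m,n\ge 1$ be integers, let ${\bm\alpha}=(\alpha_1,\dots,\alpha_m)\in(\mathbb R_{>0})^m$ and ${\bm\beta}=(\beta_1,\dots,\beta_n)\in(\mathbb R_{>0})^n$ with $\sum_i\alpha_i=1=\sum_j\beta_j$ and $\beta_1\ge\beta_2\ge\cdots\ge\beta_n$. Let $\psi$ be a decreasing and continuous function with $\lim_{t\to\infty}\psi(t)=0$, and suppose there is a constant $\lambda>1$ such that $\psi(t)/\psi(2t)\ge\lambda$ for all $t\ge 1$. Let $f$ be a dimension function with $f\prec mn$ and $(mn-a)\preceq f\preceq (mn-a+1)$ for some integer $1\le a\le n-1$. Then for every $\mathbf b\in\mathbb R^m\setminus\mathbb Z^m$, \[\mathcal H^f\big(D_{{\bm\alpha},{\bm\beta}}^{\mathbf b}(\psi)^c\big)=\begin{cases}0 & \text{if } \sum_{\mathbf u\in\mathbb Z^m\setminus\{0\}}\gamma_{\mathbf u}({\bm\beta},f)|\mathbf u|^n<\infty,\\ \mathcal H^f([0,1]^{mn}) & \text{if } \sum_{\mathbf u\in\mathbb Z^m\setminus\{0\}}\gamma_{\mathbf u}({\bm\beta},f)|\mathbf u|^n=\infty,\end{cases}\] where \[\gamma_{\mathbf u}({\bm\beta},f):=\min_{1\le j\le n}\bigg\{f\bigg(\frac{t(\mathbf u)^{-\beta_j}}{|\mathbf u|}\bigg)\bigg(\frac{t(\mathbf u)^{-\beta_j}}{|\mathbf u|}\bigg)^{(1-m)n}\prod_{\ell=j}^n t(\mathbf u)^{\beta_j-\beta_\ell}\bigg\}\]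 and $t(\mathbf u):=\inf\{t>0: |u_i|<\psi(t)^{-\alpha_i}\text{ for } 1\le i\le m\}$.
   Context: $|\mathbf x|=\max_i|x_i|$ is the sup norm and $\|x\|_{\mathbb Z}$ the distance from $x\in\mathbb R$ to the nearest integer. For $\mathbf x\in\mathbb R^m$, $\|\mathbf x\|_{\mathbb Z,{\bm\alpha}}=\max_i\|x_i\|_{\mathbb Z}^{1/\alpha_i}$; for $\mathbf y\in\mathbb R^n$, $|\mathbf y|_{{\bm\beta}}=\max_j|y_j|^{1/\beta_j}$. A matrix $A\in M_{m,n}(\mathbb R)$ is called $(\psi_{{\bm\alpha},{\bm\beta}},\mathbf b)$-Dirichlet if for all sufficiently large $t$ there is $\mathbf q\in\mathbb Z^n\setminus\{0\}$ with $\|A\mathbf q+\mathbf b\|_{\mathbb Z,{\bm\alpha}}<\psi(t)$ and $|\mathbf q|_{{\bm\beta}}<t$. $D^{\mathbf b}_{{\bm\alpha},{\bm\beta}}(\psi)$ is the set of such matrices in $[0,1]^{mn}$ (identifying $M_{m,n}(\mathbb R)$ with $\mathbb R^{mn}$), and $D^{\mathbf b}_{{\bm\alpha},{\bm\beta}}(\psi)^c=[0,1]^{mn}\setminus D^{\mathbf b}_{{\bm\alpha},{\bm\beta}}(\psi)$. A dimension function is a continuous non-decreasing $f:\mathbb R_{\ge0}\to\mathbb R_{\ge0}$ with $f(0)=0$. For $s\ge0$, $f\preceq s$ means $f(y)/y^s\le f(x)/x^s$ for all $0<x<y$; $s\preceq f$ means $f(y)/y^s\ge f(x)/x^s$ for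 all $0<x<y$; $f\prec s$ means $f\preceq s$ and $\lim_{r\to0^+}f(r)/r^s=\infty$. $\mathcal H^f$ is the Hausdorff $f$-measure on $\mathbb R^{mn}$: $\mathcal H^f(E)=\lim_{\eta\to0}\inf\{\sum_i f(|B_i|): E\subset\bigcup_i B_i,\ B_i \text{ balls of diameter } |B_i|\le\eta\}$. *)

(* Defs.v *)
From HB Require Import structures.
From mathcomp Require Export all_boot all_order all_algebra.
From mathcomp Require Export all_classical all_reals all_analysis.

Set Implicit Arguments.
Unset Strict Implicit.
Unset Printing Implicit Defensive.

Import Order.TTheory GRing.Theory Num.Theory.
Import numFieldNormedType.Exports.

Local Open Scope classical_set_scope.
Local Open Scope ring_scope.

Section WeightedNorms.
Context {R : realType}.

Definition dist_int (x : R) : R := inf [set `|x - k%:~R| | k in [set: int]].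

(* The quantities below are nonnegative, so the default value 0 of the big
   maxima does not affect them in positive dimension. *)
Definition weighted_dist_int (m : nat) (alpha : 'I_m -> R) (x : 'cV[R]_m) : R :=
  \big[Order.max/0]_(i < m) (dist_int (x i 0) `^ (alpha i)^-1).

Definition weighted_norm (n : nat) (beta : 'I_n -> R) (y : 'cV[R]_n) : R :=
  \big[Order.max/0]_(j < n) (`|y j 0| `^ (beta j)^-1).

Definition real_vec (k : nat) (u : 'cV[int]_k) : 'cV[R]_k := map_mx intr u.

End WeightedNorms.

Section Dirichlet.
Context {R : realType} {m n : nat}.

Definition unit_cube : set 'M[R]_(m, n) :=
  [set A | forall i j, 0 <= A i j <= 1].

Definition is_Dirichlet (alpha : 'I_m -> R) (beta : 'I_n -> R) (psi : R -> R)
    (b : 'cV[R]_m) (A : 'M[R]_(m, n)) : Prop :=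
  \forall t \near +oo, exists q : 'cV[int]_n,
    [/\ q != 0,
        weighted_dist_int alpha (A *m real_vec q + b) < psi t
      & weighted_norm beta (real_vec q) < t].

Definition Dirichlet_set (alpha : 'I_m -> R) (beta : 'I_n -> R) (psi : R -> R)
    (b : 'cV[R]_m) : set 'M[R]_(m, n) :=
  unit_cube `&` [set A | is_Dirichlet alpha beta psi b A].

Definition Dirichlet_set_compl (alpha : 'I_m -> R) (beta : 'I_n -> R)
    (psi : R -> R) (b : 'cV[R]_m) : set 'M[R]_(m, n) :=
  unit_cube `\` Dirichlet_set alpha beta psi b.

End Dirichlet.

Section DimensionFunctions.
Context {R : realType}.

(* Functions on [0, +oo[ are represented by total functions on R whose values
   at negative arguments are irrelevant. *)
Definition dimension_function (f : R -> R) : Prop :=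
  [/\ {within `[0, +oo[, continuous f},
      (forall x y, 0 <= x -> x <= y -> f x <= f y),
      (forall x, 0 <= x -> 0 <= f x)
    & f 0 = 0].

Definition dimfun_le (f : R -> R) (s : R) : Prop :=
  forall x y, 0 < x -> x < y -> f y / y `^ s <= f x / x `^ s.

Definition dimfun_ge (s : R) (f : R -> R) : Prop :=
  forall x y, 0 < x -> x < y -> f x / x `^ s <= f y / y `^ s.

Definition dimfun_lt (f : R -> R) (s : R) : Prop :=
  dimfun_le f s /\ (f r / r `^ s @[r --> 0^'+] --> +oo).

End DimensionFunctions.

Section Hausdorff.
Context {R : realType} {m n : nat}.

(* The balls of 'M[R]_(m, n) are the open balls of the sup norm; for m, n > 0
   the ball of radius r has diameter 2 * r. *)
Definition hausdorff_content (f : R -> R) (E : set 'M[R]_(m, n)) (eta : R)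
    : \bar R :=
  ereal_inf [set s | exists (c : nat -> 'M[R]_(m, n)) (r : nat -> R),
    [/\ forall i, 0 < r i /\ 2 * r i <= eta,
        E `<=` \bigcup_i ball (c i) (r i)
      & s = (\sum_(0 <= i <oo) (f (2 * r i))%:E)%E]].

Definition hausdorff_measure (f : R -> R) (E : set 'M[R]_(m, n)) : \bar R :=
  lim (hausdorff_content f E eta @[eta --> 0^'+]).

End Hausdorff.

Section Gamma.
Context {R : realType} {m n : nat}.

Definition t_of (alpha : 'I_m -> R) (psi : R -> R) (u : 'cV[int]_m) : R :=
  inf [set t : R | 0 < t /\
    forall i, `|(u i 0)%:~R| < psi t `^ (- alpha i)].

(* Real powers are used throughout, since (1 - m) * n may be negative.  The
   minimum is taken in \bar R, where +oo is neutral; it is a genuine minimum of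
   real numbers for n > 0. *)
Definition gamma (alpha : 'I_m -> R) (beta : 'I_n -> R) (psi f : R -> R)
    (u : 'cV[int]_m) : \bar R :=
  let t := t_of alpha psi u in
  let rho j := t `^ (- beta j) / `|real_vec u : 'cV[R]_m| in
  \big[Order.min/+oo%E]_(j < n)
    (f (rho j) * rho j `^ ((1 - m%:R) * n%:R)
     * \prod_(l < n | (j <= l)%N) t `^ (beta j - beta l))%:E.

Definition gamma_series (alpha : 'I_m -> R) (beta : 'I_n -> R)
    (psi f : R -> R) : \bar R :=
  (\esum_(u in [set u : 'cV[int]_m | u != 0%R])
     (gamma alpha beta psi f u * (`|real_vec u : 'cV[R]_m| ^+ n)%:E))%E.

End Gamma.

(* Main.v *)
Require Import Defs.
From mathcomp Require Import ring lra zify.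
Import Order.TTheory GRing.Theory Num.Theory.
Import numFieldNormedType.Exports.
Local Open Scope classical_set_scope.
Local Open Scope ring_scope.

Set Implicit Arguments.
Unset Strict Implicit.
Unset Printing Implicit Defensive.

(** Write [rho_l = t(u)^(-beta_l) / |u|].  The hypotheses on [f] make the minimum
    over [j] in the definition of [gamma_u] equal to the minimum over all radii
    [r] of [f r * r^(-(m-1)n) * prod_l max 1 (rho_l / r)], which up to [|u|^n] is
    the cost of covering, by balls of radius [r], the neighbourhood [S_u] of the
    planes [A^T u \in Z^n] whose widths are the [rho_l].

    Convergence.  A transference principle shows that a matrix [A] outside the
    Dirichlet set lies in infinitely many [S_u], and the covers above apply.

    Divergence.  Conversely, if [A^T u] is within [c * t(u)^(-beta)] of [Z^n] while
    [b . u] stays away from [Z], then no [q] solves the system at a time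
    comparable with [t(u)].  A Cantor set of such matrices of infinite measure is
    built from [g]-adic cubes, with [g] in [{2, 3}] such that no [g^N b] is
    integral.  Inside a cube of level [N] only the vectors [u = g^N v] are used, so
    the same pattern serves all cubes of that level.  The pattern distributes mass
    over planks of vectors [v] with [b . u] away from [Z] and with totient ratio of
    [gcd v] bounded below: a second moment estimate on a grid of prime modulus
    shows that, once the sum of the weights exceeds [1], the fattened planks
    fill a positive proportion of the cube, and each point of the fattened plank
    sends its mass to a thin plank in the coarsest admissible cube around it. *)

(** * Dimension functions and the cost of covering a plank *)

(** Both cases use the same number: as a minimum over all radii, [gamma_u] is the price of the best
    cover and also a lower bound at every scale, which is what a mass distribution needs. The
    obstacle to divergence is uncontrolled overlap of planks, and it occurs twice. For the size of
    the union, the danger lies in parallel vectors: a common divisor of the two multiples brings a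
    gcd term into the overlap count. Keeping only translates coprime to [gcd v] removes it and costs
    a factor of totient type, hence the selection of vectors. For the mass, a point lying in several
    fattened planks uses one kernel only, at its coarsest level; that level is constant on the cell,
    so a small cell receives its coarse contributions from a single kernel. Vectors [g^N v] give
    planks that repeat in all cubes of level [N], so masses multiply. The price is that [b . u]
    becomes [g^N b . v]: integrality of [g^N b] would be fatal, and [b] cannot become integral both
    under powers of 2 and under powers of 3. The constants lost at each stage are absorbed by
    [f(r) / r^(mn)] tending to infinity, which also allows an arbitrary lower bound for the
    content. *)

Section DimensionBounds.
Context {R : realType}.
Implicit Types (f : R -> R) (x y r c : R).

(** The two comparisons of [f] with a power, cleared of denominators and with natural exponents:
    [mn], [mn - a] and [mn - a + 1] are all natural numbers. *)
Definition dim_upper f (s : nat) :=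
  forall x y, 0 < x -> x <= y -> f y * x ^+ s <= f x * y ^+ s.

Definition dim_lower (s : nat) f :=
  forall x y, 0 < x -> x <= y -> f x * y ^+ s <= f y * x ^+ s.

Lemma ler_eq x y : x = y -> x <= y.
Proof. by move=> ->. Qed.

Lemma dimfun_le_upper f (s : nat) : dimfun_le f s%:R -> dim_upper f s.
Proof.
move=> h x y x0; rewrite le_eqVlt => /predU1P[->//|xy].
have y0 := lt_trans x0 xy.
have := h x y x0 xy; rewrite !powR_mulrn ?(ltW x0) ?(ltW y0)//.
by rewrite ler_pdivrMr ?exprn_gt0// mulrAC ler_pdivlMr ?exprn_gt0.
Qed.

Lemma dimfun_ge_lower f (s : nat) : dimfun_ge s%:R f -> dim_lower s f.
Proof.
move=> h x y x0; rewrite le_eqVlt => /predU1P[->//|xy].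
have y0 := lt_trans x0 xy.
have := h x y x0 xy; rewrite !powR_mulrn ?(ltW x0) ?(ltW y0)//.
by rewrite ler_pdivrMr ?exprn_gt0// mulrAC ler_pdivlMr ?exprn_gt0.
Qed.

Lemma dim_upper_scale f s x c : dim_upper f s -> 0 < x -> 1 <= c ->
  f (c * x) <= c ^+ s * f x.
Proof.
move=> h x0 c1; have := h x (c * x) x0; rewrite ler_peMl ?(ltW x0)// => /(_ isT).
by rewrite exprMn mulrA ler_pM2r ?exprn_gt0// (mulrC (f x)).
Qed.

Lemma prodr_gt_ord (n : nat) (j : 'I_n) (q : R) :
  \prod_(l < n) (if (j < l)%N then q else 1) = q ^+ (n - j.+1).
Proof.
rewrite -big_mkcond/= -prodr_const_nat.
by rewrite (big_geq_mkord j.+1 n predT (fun=> q)) /=; apply: eq_bigl.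
Qed.

Lemma prodr_ge_ord (n : nat) (j : 'I_n) (q : R) :
  \prod_(l < n) (if (j <= l)%N then q else 1) = q ^+ (n - j).
Proof.
rewrite -big_mkcond/= -prodr_const_nat.
by rewrite (big_geq_mkord j n predT (fun=> q)) /=; apply: eq_bigl.
Qed.

(** With [e = (m-1)n], the factor [r ^- e] counts the balls along the planes, and each factor of the
    product those across one width. *)
Definition Phi f (e n : nat) (rho : 'I_n -> R) r :=
  f r * r ^- e * \prod_(l < n) Num.max 1 (rho l / r).

(** Raising the radius from [rho j] by a factor [q] saves at most [q] in each of the [n - j.+1]
    widths beyond [j], while [f r * r ^- e] grows by at least [q ^+ (n - j.+1)]. Lowering it by [q]
    costs a full factor [q] in each of the [n - j] widths from [j] on, while [f r * r ^- e] drops by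
    at most [q ^+ (n - j)]. *)
Lemma Phi_min f (e n : nat) (rho : 'I_n -> R) (j : 'I_n) r :
  (forall x, 0 <= x -> 0 <= f x) ->
  dim_lower (e + (n - j.+1)) f -> dim_upper f (e + (n - j)) ->
  (forall l, 0 < rho l) ->
  (forall l k : 'I_n, (l <= k)%N -> rho l <= rho k) ->
  0 < r -> Phi f e rho (rho j) <= Phi f e rho r.
Proof.
move=> f0 fl fu rho0 rhoM r0; rewrite /Phi.
set x := rho j; have x0 : 0 < x := rho0 j.
have [xr|rx] := leP x r.
- set q := r / x; have rE : r = q * x by rewrite /q mulfVK ?gt_eqF.
  have q0 : 0 < q by rewrite divr_gt0.
  have q1 : 1 <= q by rewrite /q ler_pdivlMr ?mul1r.
  clearbody q.
  have P : \prod_(l < n) Num.max 1 (rho l / x) <=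
      q ^+ (n - j.+1) * \prod_(l < n) Num.max 1 (rho l / r).
    rewrite -prodr_gt_ord -big_split/=; apply: ler_prod => l _.
    rewrite le_max ler01/=; case: ifPn => [jl|].
      have xl : 0 <= rho l / x by rewrite divr_ge0// ltW.
      have E : q * (rho l / r) = rho l / x.
        by rewrite rE; field; rewrite !gt_eqF.
      rewrite ge_max; apply/andP; split.
        by rewrite (le_trans q1)// ler_peMr ?(ltW q0)// le_max lexx.
      by rewrite -E ler_pM2l// le_max lexx orbT.
    rewrite -leqNgt => lj; rewrite mul1r ge_max le_max lexx/=.
    rewrite le_max; apply/orP; left.
    by rewrite ler_pdivrMr// mul1r rhoM.
  have F : f x * q ^+ (e + (n - j.+1)) <= f r.
    have := fl x r x0 xr; rewrite {1}rE exprMn mulrA.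
    by rewrite ler_pM2r ?exprn_gt0.
  set A := \prod_(_ < n) _ in P *; set B := \prod_(_ < n) _ in P *.
  have B0 : 0 <= B by apply: prodr_ge0 => l _; rewrite le_max ler01.
  apply: (@le_trans _ _ (f x * x ^- e * (q ^+ (n - j.+1) * B))).
    by rewrite ler_wpM2l// mulr_ge0 ?f0 ?invr_ge0 ?exprn_ge0// ltW.
  rewrite mulrA ler_wpM2r//.
  apply: (@le_trans _ _ (f x * q ^+ (e + (n - j.+1)) * r ^- e)).
    rewrite rE exprMn exprD; apply: ler_eq; field.
    by rewrite !expf_neq0 ?gt_eqF.
  by rewrite ler_wpM2r// invr_ge0 exprn_ge0// ltW.
- set q := x / r; have rE : x = q * r by rewrite /q mulfVK ?gt_eqF.
  have q0 : 0 < q by rewrite divr_gt0.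
  have q1 : 1 <= q by rewrite /q ler_pdivlMr// mul1r ltW.
  clearbody q.
  have P : q ^+ (n - j) * \prod_(l < n) Num.max 1 (rho l / x) <=
      \prod_(l < n) Num.max 1 (rho l / r).
    rewrite -prodr_ge_ord -big_split/=; apply: ler_prod => l _.
    have m0 : 0 <= Num.max 1 (rho l / x) by rewrite le_max ler01.
    case: ifPn => [jl|]; rewrite ?mul1r ?m0 ?mulr_ge0 ?(ltW q0)//=.
      rewrite max_r; last by rewrite ler_pdivlMr// mul1r rhoM.
      rewrite le_max; apply/orP; right.
      by rewrite rE; apply: ler_eq; field; rewrite !gt_eqF.
    move=> _; rewrite ge_max le_max lexx/= le_max; apply/orP; right.
    by rewrite ler_pM2l// lef_pV2 ?posrE// ltW.
  have F : f x <= q ^+ (e + (n - j)) * f r.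
    by rewrite rE; exact: dim_upper_scale.
  set A := \prod_(_ < n) _ in P *; set B := \prod_(_ < n) _ in P *.
  have A0 : 0 <= A by apply: prodr_ge0 => l _; rewrite le_max ler01.
  apply: (@le_trans _ _ (f r * r ^- e * (q ^+ (n - j) * A))); last first.
    by rewrite ler_wpM2l// mulr_ge0 ?f0 ?invr_ge0 ?exprn_ge0// ltW.
  rewrite mulrA ler_wpM2r//.
  apply: (@le_trans _ _ (q ^+ (e + (n - j)) * f r * x ^- e)).
    by rewrite ler_wpM2r// invr_ge0 exprn_ge0// ltW.
  rewrite rE exprMn exprD; apply: ler_eq; field.
  by rewrite !expf_neq0 ?gt_eqF.
Qed.

Lemma Phi_mono f (e n : nat) (rho rho' : 'I_n -> R) r :
  0 <= f r -> 0 < r -> (forall l, rho l <= rho' l) ->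
  Phi f e rho r <= Phi f e rho' r.
Proof.
move=> f0 r0 h; rewrite /Phi ler_wpM2l//.
  by rewrite mulr_ge0 ?invr_ge0 ?exprn_ge0// ltW.
apply: ler_prod => l _; rewrite le_max ler01/= ge_max !le_max lexx/=.
by rewrite ler_pM2r ?invr_gt0// h orbT.
Qed.

Lemma Phi_scale f (e n : nat) (rho : 'I_n -> R) c r :
  0 <= f r -> 0 < r -> 0 < c <= 1 ->
  c ^+ n * Phi f e rho r <= Phi f e (fun l => c * rho l) r.
Proof.
move=> f0 r0 /andP[c0 c1]; rewrite /Phi mulrCA ler_wpM2l//.
  by rewrite mulr_ge0 ?invr_ge0 ?exprn_ge0// ltW.
have -> : c ^+ n = \prod_(l < n) c by rewrite prodr_const card_ord.
rewrite -big_split/=; apply: ler_prod => l _.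
have m0 : 0 <= Num.max 1 (rho l / r) by rewrite le_max ler01.
rewrite mulr_ge0 ?(ltW c0)//=.
rewrite maxr_pMr ?(ltW c0)// mulr1 mulrA.
by rewrite ge_max; apply/andP; split; rewrite le_max ?c1 ?lexx ?orbT.
Qed.

Lemma Phi_ge0 f (e n : nat) (rho : 'I_n -> R) r :
  0 <= f r -> 0 < r -> 0 <= Phi f e rho r.
Proof.
move=> f0 r0; rewrite /Phi mulr_ge0//.
  by rewrite mulr_ge0 ?invr_ge0 ?exprn_ge0// ltW.
by apply: prodr_ge0 => l _; rewrite le_max ler01.
Qed.

End DimensionBounds.

(** * Transference *)

Section Transference.
Context {R : realType}.

Definition dotv (N : nat) (x y : 'cV[R]_N) : R := \sum_i x i 0 * y i 0.

Lemma dotvC N (x y : 'cV[R]_N) : dotv x y = dotv y x.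
Proof. by apply: eq_bigr => i _; rewrite mulrC. Qed.

Lemma dotvDl N (x y z : 'cV[R]_N) : dotv (x + y) z = dotv x z + dotv y z.
Proof. by rewrite -big_split; apply: eq_bigr => i _; rewrite mxE mulrDl. Qed.

Lemma dotvZl N a (x z : 'cV[R]_N) : dotv (a *: x) z = a * dotv x z.
Proof. by rewrite mulr_sumr; apply: eq_bigr => i _; rewrite mxE mulrA. Qed.

Lemma dotvDr N (x y z : 'cV[R]_N) : dotv z (x + y) = dotv z x + dotv z y.
Proof. by rewrite !(dotvC z) dotvDl. Qed.

Lemma dotvZr N a (x z : 'cV[R]_N) : dotv z (a *: x) = a * dotv z x.
Proof. by rewrite !(dotvC z) dotvZl. Qed.

Lemma dotv_ge0 N (x : 'cV[R]_N) : 0 <= dotv x x.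
Proof. by apply: sumr_ge0 => i _; rewrite -expr2 sqr_ge0. Qed.

Lemma dotv_coord_le N (x : 'cV[R]_N) i : (x i 0) ^+ 2 <= dotv x x.
Proof.
rewrite /dotv (bigD1 i)//= -expr2 lerDl.
by apply: sumr_ge0 => j _; rewrite -expr2 sqr_ge0.
Qed.

Lemma nearest_int (x : R) : exists k : int, `|x - k%:~R| <= 1 / 2.
Proof.
exists (Num.floor (x + 1 / 2)).
have := floor_itv (x + 1 / 2).
rewrite intrD => /andP[h1 h2]; rewrite ler_norml; lra.
Qed.

Lemma mulmx_colE N d (C : 'M[R]_(N, d)) (x : 'cV[R]_d) :
  C *m x = \sum_j x j 0 *: col j C.
Proof.
apply/matrixP => i k; rewrite !mxE summxE; apply: eq_bigr => j _.
by rewrite !mxE ord1 mulrC.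
Qed.

Lemma trmx_mulE N d (C : 'M[R]_(N, d)) (w : 'cV[R]_N) i :
  (C^T *m w) i 0 = dotv (col i C) w.
Proof. by rewrite mxE; apply: eq_bigr => j _; rewrite !mxE. Qed.

(** The columns of [C] span a lattice whose nonzero vectors have squared length at least [s]; the
    [w] with [C^T *m w] integral form its dual, up to the orthogonal complement of the span. So this
    bounds the covering radius of the dual by a constant over the shortest length. *)
Definition dual_covering (N d : nat) (K : R) :=
  forall (C : 'M[R]_(N, d)) (s : R), 0 < s ->
    (forall z : 'cV[int]_d, z != 0 ->
       s <= dotv (C *m real_vec z) (C *m real_vec z)) ->
  forall tau : 'cV[R]_d, exists (w : 'cV[R]_N) (k : 'cV[int]_d),
    C^T *m w = tau + real_vec k /\ s * dotv w w <= K.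

Lemma real_vec_mul (k l : nat) (U : 'M[int]_(k, l)) (z : 'cV[int]_l) :
  real_vec (U *m z) = map_mx intr U *m real_vec z :> 'cV[R]_k.
Proof. by rewrite /real_vec map_mxM. Qed.

(* If the first basis vector is almost shortest, then orthogonal projection
   away from it shrinks no other lattice vector by more than a factor two. *)
Lemma dual_covering_reduced (N d : nat) (K : R) : dual_covering N d K ->
  forall (C : 'M[R]_(N, d.+1)) (s : R), 0 < s ->
    (forall z : 'cV[int]_d.+1, z != 0 ->
       s <= dotv (C *m real_vec z) (C *m real_vec z)) ->
    (forall z : 'cV[int]_d.+1, z != 0 ->
       dotv (col 0 C) (col 0 C) <= 2 * dotv (C *m real_vec z) (C *m real_vec z)) ->
  forall tau : 'cV[R]_d.+1, exists (w : 'cV[R]_N) (k : 'cV[int]_d.+1),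
    C^T *m w = tau + real_vec k /\ s * dotv w w <= 1 / 4 + 4 * K.
Proof.
move=> IH C s s0 hC hmin tau.
pose c1 := col 0 C; pose q1 := dotv c1 c1.
have c1E : c1 = C *m real_vec (delta_mx 0 0).
  rewrite mulmx_colE (bigD1 0)//= big1 ?addr0; last first.
    by move=> j j0; rewrite !mxE (negbTE j0) /= scale0r.
  by rewrite !mxE/= scale1r.
have sq1 : s <= q1.
  rewrite /q1 c1E; apply: hC; apply/eqP => /matrixP/(_ 0 0).
  by rewrite !mxE.
have q10 : 0 < q1 by exact: lt_le_trans sq1.
pose c (j : 'I_d) := col (lift 0 j) C.
pose mu j := dotv (c j) c1 / q1.
pose c' j := c j - mu j *: c1.
pose C' := \matrix_(i < N, j < d) c' j i 0.
have colC' j : col j C' = c' j.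
  by apply/matrixP => i k; rewrite ord1 mxE mxE.
have c'1 j : dotv (c' j) c1 = 0.
  by rewrite /c' -scaleN1r dotvDl !dotvZl -/q1 /mu mulfVK ?gt_eqF// mulN1r subrr.
have hC' (z : 'cV[int]_d) : z != 0 ->
    s / 4 <= dotv (C' *m real_vec z) (C' *m real_vec z).
  move=> zn.
  pose v := \sum_j (z j 0)%:~R *: c j : 'cV[R]_N.
  pose m1 := \sum_j (z j 0)%:~R * mu j : R.
  have CzE : C' *m real_vec z = v - m1 *: c1.
    rewrite mulmx_colE /v /m1 scaler_suml -sumrB; apply: eq_bigr => j _.
    by rewrite mxE colC' /c' scalerBr scalerA.
  (* Rounding [m1] lifts the projected vector to a lattice vector with component at most half of
     [c1] along [c1]. Near minimality of [c1] gives [q1 <= 2 * (W + q1 / 4)], so [W >= q1 / 4]. *)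
  have [k hk] := nearest_int m1.
  pose zz := \col_i (if unlift 0 i is Some j then z j 0 else - k).
  have zzN : zz != 0.
    apply: contra_neq zn => h; apply/matrixP => i j; rewrite ord1 !mxE.
    by move/matrixP/(_ (lift 0 i) 0): h; rewrite !mxE liftK.
  have QE : C *m real_vec zz = (v - m1 *: c1) + (m1 - k%:~R) *: c1.
    rewrite mulmx_colE big_ord_recl /= !mxE unlift_none rmorphN/= scaleNr.
    rewrite scalerBl addrA subrK [LHS]addrC /v -/c1; congr (_ + _).
    by apply: eq_bigr => j _; rewrite !mxE liftK.
  have v1 : dotv (v - m1 *: c1) c1 = 0.
    rewrite -CzE mulmx_colE /dotv.
    under eq_bigr do rewrite summxE mulr_suml.
    rewrite exchange_big/= big1// => j _.
    transitivity (real_vec z j 0 * dotv (c' j) c1); last by rewrite c'1 mulr0.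
    rewrite mulr_sumr.
    by apply: eq_bigr => i _; rewrite colC' !mxE; ring.
  rewrite CzE; have := hmin _ zzN; rewrite QE.
  move: (v - m1 *: c1) v1 => V v1.
  rewrite !(dotvDl, dotvDr, dotvZl, dotvZr) (dotvC c1 V) v1 -/c1 -/q1.
  move: hk; rewrite ler_norml => /andP[h1 h2].
  set e := m1 - _ in h1 h2 *; set W := dotv V V => h3.
  have : e * (e * q1) <= 1 / 4 * q1.
    by rewrite mulrA ler_pM2r// -expr2; nra.
  lra.
pose k0 := projT1 (cid (nearest_int (tau 0 0))).
have hk0 : `|tau 0 0 - k0%:~R| <= 1 / 2 := projT2 (cid (nearest_int (tau 0 0))).
pose x0 := tau 0 0 - k0%:~R.
have s4 : 0 < s / 4 by rewrite divr_gt0.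
have [w' [k' [w'E w'N]]] := IH C' (s / 4) s4 hC' (\col_j (tau (lift 0 j) 0 - mu j * x0)).
(* The component of [w'] along [c1] is exchanged for one whose inner product with [c1] is [x0]. As
   [|x0| <= 1/2] it adds at most [1/4]; the rest costs [4 * K] because the induction ran with
   [s / 4]. *)
pose w2 := w' - (dotv w' c1 / q1) *: c1.
have w21 : dotv w2 c1 = 0.
  by rewrite /w2 -scaleN1r dotvDl !dotvZl -/q1 mulfVK ?gt_eqF// mulN1r subrr.
pose w := w2 + (x0 / q1) *: c1.
have w1 : dotv c1 w = x0.
  by rewrite /w dotvDr dotvZr dotvC w21 add0r -/q1 mulfVK ?gt_eqF.
exists w, (\col_i (if unlift 0 i is Some j then k' j 0 else - k0)); split.
  apply/matrixP => i j; rewrite ord1 trmx_mulE !mxE.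
  case: (unliftP 0 i) => [l|] ->; last by rewrite -/c1 w1 rmorphN.
  have -> : col (lift 0 l) C = c' l + mu l *: c1 by rewrite /c' subrK.
  rewrite dotvDl dotvZl w1.
  have -> : dotv (c' l) w = dotv (c' l) w'.
    rewrite /w /w2 -scaleN1r !(dotvDr, dotvZr) c'1; ring.
  by rewrite -colC' -trmx_mulE w'E !mxE; ring.
have -> : dotv w w = dotv w2 w2 + x0 ^+ 2 / q1.
  rewrite /w; move: w2 w21 {w w1} => V v1.
  rewrite !(dotvDl, dotvDr, dotvZl, dotvZr) (dotvC c1 V) v1 -/q1.
  by field; rewrite gt_eqF.
have h1 : dotv w2 w2 <= dotv w' w'.
  have -> : dotv w2 w2 = dotv w' w' - dotv w' c1 ^+ 2 / q1.
    rewrite /w2 -scaleN1r !(dotvDl, dotvDr, dotvZl, dotvZr) (dotvC c1 w') -/q1.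
    by field; rewrite gt_eqF.
  by rewrite gerBl divr_ge0 ?sqr_ge0// ltW.
have h2 : s * (x0 ^+ 2 / q1) <= 1 / 4.
  rewrite mulrA ler_pdivrMr//; move: hk0; rewrite ler_norml => /andP[a1 a2].
  have x4 : x0 ^+ 2 <= 1 / 4 by rewrite /x0; nra.
  have x5 : 0 <= x0 ^+ 2 by exact: sqr_ge0.
  nra.
have h3 : s * dotv w2 w2 <= 4 * K.
  have : s * dotv w2 w2 <= s * dotv w' w' by rewrite ler_pM2l.
  by move: w'N; lra.
by rewrite mulrDr addrC lerD.
Qed.

(** A vector of squared length below twice the infimum always exists, without an argument that the
    infimum is attained; this is the factor 2 allowed in [dual_covering_reduced]. *)
Lemma dual_covering_step (N d : nat) (K : R) :
  dual_covering N d K -> dual_covering N d.+1 (1 / 4 + 4 * K).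
Proof.
move=> IH C s s0 hC tau.
pose Q (z : 'cV[int]_d.+1) := dotv (C *m real_vec z) (C *m real_vec z).
pose S := [set Q z | z in [set z | z != 0]].
have infS : has_inf S.
  split; last by exists s => _ [z z0 <-]; exact: hC.
  exists (Q (const_mx 1)), (const_mx 1) => //=.
  by apply/eqP => /matrixP/(_ 0 0); rewrite !mxE.
have sS : s <= inf S.
  by apply: lb_le_inf; [case: infS|move=> _ [z z0 <-]; exact: hC].
have [_ [z0 z0N <-] z0le] : exists2 q, S q & q < 2 * inf S.
  have e0 : 0 < inf S by exact: lt_le_trans sS.
  have [q Sq qlt] := inf_adherent e0 infS.
  by exists q => //; rewrite mulrDl mul1r.
(* For a single column the normal form writes [z0] as the integer [d1] times the first column of a
   unimodular [L]. That column begins a basis, and it is no longer than [z0] since [d1] is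
   nonzero. *)
have [L uL [U uU [D sD zE]]] := int_Smith_normal_form z0.
pose d1 := D`_0 * U 0 0.
have zL : z0 = d1 *: (L *m delta_mx 0 0).
  rewrite {1}zE; apply/matrixP => i j; rewrite !mxE big_ord1 !mxE ord1.
  rewrite (bigD1 0)//= big1 ?addr0; last first.
    move=> k k0; rewrite !mxE /=; case: k k0 => [[|k] hk]//= _.
    by rewrite mulr0.
  rewrite [X in _ = _ * X](bigD1 0)//= big1 ?addr0; last first.
    by move=> k k0; rewrite !mxE (negbTE k0) mulr0.
  by rewrite !mxE/= (ord1 j) /d1 /= ?eqxx ?mulr1n; ring.
have LN (z : 'cV[int]_d.+1) : z != 0 -> L *m z != 0.
  by apply: contra_neq => h; rewrite -(mulKmx uL z) h mulmx0.
pose C2 := C *m map_mx intr L.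
have C2E z : C2 *m real_vec z = C *m real_vec (L *m z).
  by rewrite real_vec_mul mulmxA.
have qinf z : z != 0 -> inf S <= Q z.
  by move=> zn; apply: ge_inf; [case: infS|exists z].
have col0 : col 0 C2 = C *m real_vec (L *m delta_mx 0 0).
  rewrite -C2E mulmx_colE (bigD1 0)//= big1 ?addr0; last first.
    by move=> j j0; rewrite !mxE (negbTE j0) /= scale0r.
  by rewrite [real_vec _ 0 0]mxE mxE scale1r.
have q1le : Q (L *m delta_mx 0 0) <= 2 * inf S.
  apply: le_trans (ltW z0le).
  have -> : Q z0 = (d1%:~R) ^+ 2 * Q (L *m delta_mx 0 0).
    rewrite /Q zL /real_vec map_mxZ -!scalemxAr dotvZl dotvZr.
    by rewrite mulrA -expr2.
  rewrite ler_peMl ?dotv_ge0// -rmorphXn/= ler1z.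
  have d1N : d1 != 0.
    by apply: contraNneq z0N => h; rewrite zL h scale0r.
  by rewrite -gtz0_ge1 exprn_even_gt0.
have [z|z|w [k [wE wN]]] := dual_covering_reduced IH (C := C2) s0 _ _
  ((map_mx intr L)^T *m tau).
- by move=> zn; rewrite C2E; apply: hC; exact: LN.
- move=> zn; rewrite C2E col0 (le_trans q1le)// ler_pM2l//.
  by apply: qinf; exact: LN.
exists w, ((invmx L)^T *m k); split => //.
have LL : (map_mx intr (invmx L))^T *m (map_mx intr L)^T = 1%:M :> 'M[R]_d.+1.
  by rewrite -trmx_mul -map_mxM mulmxV// map_mx1 trmx1.
rewrite real_vec_mul -map_trmx -[tau]mul1mx -LL -mulmxA -mulmxDr -wE.
by rewrite /C2 trmx_mul !mulmxA LL mul1mx.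
Qed.

Lemma dual_covering_exists (N d : nat) :
  exists2 K, 0 < K & dual_covering N d K.
Proof.
elim: d => [|d [K K0 IH]].
  exists 1 => // C s s0 _ tau; exists 0, 0; split; first by apply/matrixP => -[].
  by rewrite /dotv big1 ?mulr0// => i _; rewrite mxE mul0r.
by exists (1 / 4 + 4 * K); [lra|exact: dual_covering_step].
Qed.

End Transference.

(** * Solvability and the time t(u) *)

Section PowerLemmas.
Context {R : realType}.
Implicit Types x y a : R.

Lemma powR_inv_lt x y a : 0 <= x -> 0 <= y -> 0 < a ->
  (x `^ a^-1 < y) = (x < y `^ a).
Proof.
move=> x0 y0 a0; apply/idP/idP => h.
  have -> : x = (x `^ a^-1) `^ a by rewrite -powRrM mulVf ?gt_eqF// powRr1.
  by apply: gt0_ltr_powR => //; rewrite nnegrE ?powR_ge0.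
have -> : y = (y `^ a) `^ a^-1 by rewrite -powRrM mulfV ?gt_eqF// powRr1.
by apply: gt0_ltr_powR => //; rewrite ?invr_gt0// nnegrE ?powR_ge0.
Qed.

Lemma powR_le x y a : 0 <= x -> x <= y -> 0 <= a -> x `^ a <= y `^ a.
Proof.
move=> x0 xy a0; apply: ge0_ler_powR => //; rewrite nnegrE//.
exact: le_trans xy.
Qed.

Lemma powRN_le x y a : 0 < x -> x <= y -> 0 <= a -> y `^ (- a) <= x `^ (- a).
Proof.
move=> x0 xy a0; rewrite !powRN lef_pV2 ?posrE ?powR_gt0// ?powR_le ?(ltW x0)//.
exact: lt_le_trans xy.
Qed.

Lemma mxnorm_le (m n : nat) (x : 'M[R]_(m, n)) r : 0 <= r ->
  (forall i j, `|x i j| <= r) -> `|x| <= r.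
Proof.
move=> r0 h; rewrite /Num.norm/= mx_normrE; by apply: bigmax_le.
Qed.

Lemma mxnorm_lt (m n : nat) (x : 'M[R]_(m, n)) r : 0 < r ->
  (forall i j, `|x i j| < r) -> `|x| < r.
Proof.
move=> r0 h; rewrite /Num.norm/= mx_normrE; by apply: bigmax_lt.
Qed.

Lemma mxnorm_ge (m n : nat) (x : 'M[R]_(m, n)) i j : `|x i j| <= `|x|.
Proof.
rewrite [X in _ <= X]/Num.norm/= mx_normrE.
exact: (@le_bigmax _ _ _ 0 (fun ij : 'I_m * 'I_n => `|x ij.1 ij.2|) (i, j)).
Qed.

Lemma dist_int_lb (x : R) : has_lbound [set `|x - k%:~R| | k in [set: int]].
Proof. by exists 0 => _ [k _ <-]. Qed.

Lemma dist_int_le (x : R) (k : int) : dist_int x <= `|x - k%:~R|.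
Proof. by apply: ge_inf; [exact: dist_int_lb|exists k]. Qed.

Lemma dist_int_ltP (x e : R) : dist_int x < e -> exists k : int, `|x - k%:~R| < e.
Proof.
move=> h; have [|_ [k _ <-] ke] := inf_lt _ h; last by exists k.
by exists `|x - 0%:~R|, 0.
Qed.

Lemma dist_int_ge0 (x : R) : 0 <= dist_int x.
Proof.
apply: lb_le_inf; first by exists `|x - 0%:~R|, 0.
by move=> _ [k _ <-].
Qed.

Lemma dist_int_gt0 (x : R) : (forall k : int, x <> k%:~R) -> 0 < dist_int x.
Proof.
move=> h; have [k0 hk0] := nearest_int x.
have e0 : 0 < `|x - k0%:~R|.
  by rewrite normr_gt0 subr_eq0; apply/eqP; exact: h.
rewrite lt_neqAle dist_int_ge0 andbT; apply/eqP => d0.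
have [k hk] : exists k : int, `|x - k%:~R| < `|x - k0%:~R|.
  by apply: dist_int_ltP; rewrite -d0.
have : `|(k - k0)%:~R : R| < 1.
  have -> : (k - k0)%:~R = (x - k0%:~R) - (x - k%:~R) :> R.
    by rewrite rmorphB/=; ring.
  by apply: (le_lt_trans (ler_normB _ _)); lra.
rewrite -intr_norm ltrz1 => kk.
have kE : k = k0 by lia.
by move: hk; rewrite kE ltxx.
Qed.

End PowerLemmas.

Section DirichletSolutions.
Context {R : realType} {m n : nat}.
Variables (alpha : 'I_m -> R) (beta : 'I_n -> R) (psi : R -> R).
Hypotheses (halpha : forall i, 0 < alpha i) (hbeta : forall j, 0 < beta j).

Definition solvable_at (b : 'cV[R]_m) (A : 'M[R]_(m, n)) (t : R) :=
  exists q : 'cV[int]_n,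
    [/\ q != 0,
        weighted_dist_int alpha (A *m real_vec q + b) < psi t
      & weighted_norm beta (real_vec q) < t].

Lemma weighted_dist_intP (x : 'cV[R]_m) (e : R) : 0 < e ->
  weighted_dist_int alpha x < e <->
  forall i, exists k : int, `|x i 0 - k%:~R| < e `^ alpha i.
Proof.
move=> e0; split.
  move=> /bigmax_ltP[_ h] i; apply: dist_int_ltP.
  by rewrite -powR_inv_lt ?dist_int_ge0 ?ltW//; exact: h.
move=> h; apply/bigmax_ltP; split => // i _.
rewrite powR_inv_lt ?dist_int_ge0 ?ltW//.
by have [k] := h i; apply: le_lt_trans; exact: dist_int_le.
Qed.

Lemma weighted_normP (y : 'cV[R]_n) (e : R) : 0 < e ->
  weighted_norm beta y < e <-> forall j, `|y j 0| < e `^ beta j.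
Proof.
move=> e0; split.
  by move=> /bigmax_ltP[_ h] j; rewrite -powR_inv_lt ?normr_ge0 ?(ltW e0)//; exact: h.
move=> h; apply/bigmax_ltP; split => // i _.
by rewrite powR_inv_lt ?normr_ge0 ?(ltW e0)//; exact: h.
Qed.

End DirichletSolutions.

(** * Transference for inhomogeneous systems of linear forms *)

Section LinearFormTransference.
Context {R : realType}.

(** Apply the covering bound to the lattice of vectors [(D u, E (p - A^T u))]. A [w] of norm below 1
    with [M^T *m w] in the coset of [(b, 0)] is exactly a solution of the system, so unsolvability
    forces a short lattice vector. Here [q = 0] counts as a solution. *)
Lemma linear_form_transference (m n : nat) : exists2 C : R, 1 <= C &
  forall (A : 'M[R]_(m, n)) (b : 'cV[R]_m) (D : 'I_m -> R) (E : 'I_n -> R),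
  (forall i, 0 < D i) -> (forall j, 0 < E j) ->
  ~ (exists (q : 'cV[int]_n) (k : 'cV[int]_m),
      (forall i, `|(A *m real_vec q + b) i 0 - (k i 0)%:~R| < D i) /\
      (forall j, `|(q j 0)%:~R| < E j)) ->
  exists (u : 'cV[int]_m) (p : 'cV[int]_n),
    [/\ (u != 0) || (p != 0), forall i, D i * `|(u i 0)%:~R| <= C
      & forall j, E j * `|(A^T *m real_vec u) j 0 - (p j 0)%:~R| <= C].
Proof.
have [K K0 dc] := @dual_covering_exists R (m + n) (m + n).
exists (Num.max 1 (2 * K)); first by rewrite le_max lexx.
move=> A b D E D0 E0 nosol.
pose M : 'M[R]_(m + n) := block_mx (diag_mx (\row_i D i)) 0
  (- (diag_mx (\row_j E j) *m A^T)) (diag_mx (\row_j E j)).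
pose Q (z : 'cV[int]_(m + n)) := dotv (M *m real_vec z) (M *m real_vec z).
have ME (z : 'cV[int]_(m + n)) : M *m real_vec z =
   col_mx (\col_i (D i * (usubmx z i 0)%:~R))
     (\col_j (E j * ((dsubmx z j 0)%:~R - (A^T *m real_vec (usubmx z)) j 0))).
  rewrite -[real_vec z]vsubmxK mul_block_col mul0mx addr0.
  congr col_mx; first by rewrite mul_diag_mx; apply/matrixP => i j; rewrite ord1 !mxE.
  rewrite mulNmx -mulmxA !mul_diag_mx addrC; apply/matrixP => i j.
  rewrite ord1 !mxE mulrBr; congr (_ - _ * _).
  by apply: eq_bigr => k _; rewrite !mxE.
(* The threshold [2 * K] yields [dotv w w <= 1 / 2], so every coordinate of [w] is strictly below 1,
   as the strict inequalities of the system require. *)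
have [h|] := pselect (forall z : 'cV[int]_(m + n), z != 0 -> 2 * K <= Q z).
  exfalso; apply: nosol.
  have K20 : 0 < 2 * K by lra.
  have [w [k [wE wN]]] := dc M (2 * K) K20 h (col_mx b 0).
  have w1 i : `|w i 0| < 1.
    have := dotv_coord_le w i; have : dotv w w <= 1 / 2 by nra.
    move=> h1 h2; rewrite -(@ltr_pXn2r _ 2)// ?nnegrE// expr1n.
    by rewrite real_normK ?num_real//; lra.
  have MT : M^T *m w =
     col_mx (\col_i (D i * usubmx w i 0) - A *m (\col_j (E j * dsubmx w j 0)))
       (\col_j (E j * dsubmx w j 0)).
    rewrite -[w in LHS]vsubmxK /M tr_block_mx mul_block_col trmx0 mul0mx add0r.
    rewrite !tr_diag_mx linearN/= trmx_mul trmxK tr_diag_mx mulNmx -mulmxA.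
    have dE k0 (d : 'I_k0 -> R) (x : 'cV[R]_k0) :
        diag_mx (\row_i d i) *m x = \col_i (d i * x i 0).
      by rewrite mul_diag_mx; apply/matrixP => i j; rewrite ord1 !mxE.
    by rewrite !dE.
  have e2 : \col_j (E j * dsubmx w j 0) = real_vec (dsubmx k).
    rewrite -[LHS](col_mxKd (\col_i (D i * usubmx w i 0) -
       A *m (\col_j (E j * dsubmx w j 0)))) -MT wE.
    by rewrite linearD/= col_mxKd add0r /real_vec map_dsubmx.
  have e1 : \col_i (D i * usubmx w i 0) =
      A *m real_vec (dsubmx k) + b + real_vec (usubmx k).
    have : usubmx (M^T *m w) = b + real_vec (usubmx k).
      by rewrite wE linearD/= col_mxKu /real_vec map_usubmx.
    rewrite MT col_mxKu e2 => /eqP; rewrite subr_eq => /eqP ->.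
    by rewrite addrC addrA.
  exists (dsubmx k), (- usubmx k); split => [i|j].
    move/matrixP/(_ i 0): e1; rewrite !mxE rmorphN/= opprK => <-.
    by rewrite normrM gtr0_norm// gtr_pMr//.
  move/matrixP/(_ j 0): e2; rewrite !mxE => <-.
  by rewrite normrM gtr0_norm// gtr_pMr//.
move=> /existsNP[z /not_implyP[zN /negP]]; rewrite -ltNge => Qz.
have bnd x : x ^+ 2 <= Q z -> `|x| <= Num.max 1 (2 * K).
  move=> h; have : `|x| ^+ 2 <= Num.max 1 (2 * K) ^+ 2.
    rewrite real_normK ?num_real// (le_trans h)// (le_trans (ltW Qz))//.
    have m1 : 1 <= Num.max 1 (2 * K) by rewrite le_max lexx.
    have m2 : 2 * K <= Num.max 1 (2 * K) by rewrite le_max lexx orbT.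
    by rewrite (le_trans m2)// expr2 ler_peMl// (le_trans _ m1).
  by rewrite ler_pXn2r// nnegrE ?le_max ?ler01.
exists (usubmx z), (dsubmx z); split.
- apply: contraNT zN; rewrite negb_or !negbK => /andP[/eqP a1 /eqP a2].
  by rewrite -[z]vsubmxK a1 a2 col_mx0.
- move=> i; have := dotv_coord_le (M *m real_vec z) (lshift n i).
  rewrite {1}ME col_mxEu mxE => /bnd.
  by rewrite normrM gtr0_norm.
- move=> j; have := dotv_coord_le (M *m real_vec z) (rshift m j).
  rewrite {1}ME col_mxEd mxE => /bnd.
  by rewrite normrM gtr0_norm// distrC.
Qed.

End LinearFormTransference.

(** * Growth of psi and of the time t(u) *)

Section InverseScale.
Context {R : realType} {m : nat}.
Variables (alpha : 'I_m -> R) (psi : R -> R) (lambda : R).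
Hypotheses (halpha : forall i, 0 < alpha i)
  (psi_pos : forall t, 0 < t -> 0 < psi t)
  (psi_decr : forall s t, 0 < s -> s <= t -> psi t <= psi s)
  (psi_lim : psi t @[t --> +oo] --> 0)
  (hlambda : 1 < lambda)
  (psi_ratio : forall t, 1 <= t -> lambda <= psi t / psi (2 * t)).

Lemma psi_small (e : R) : 0 < e -> exists2 T, 1 <= T & forall t, T <= t -> psi t < e.
Proof.
move=> e0; move/cvgrPdist_lt: psi_lim => /(_ _ e0) [M [Mr h]]; exists (Num.max 1 (M + 1)); first by rewrite le_max lexx.
move=> t; rewrite ge_max => /andP[t1 tM].
have := h t; rewrite sub0r normrN => /(_ (lt_le_trans _ tM)).
rewrite ltrDl ltr01 => /(_ isT); rewrite gtr0_norm//.
by apply: psi_pos; exact: lt_le_trans t1.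
Qed.

Lemma psi_pow2 (k : nat) (t : R) : 1 <= t ->
  lambda ^+ k * psi (2 ^+ k * t) <= psi t.
Proof.
move=> t1; elim: k => [|k IH]; first by rewrite !expr0 !mul1r.
have k1 : 1 <= 2 ^+ k :> R by rewrite exprn_ege1// ler1n.
have tk : 1 <= 2 ^+ k * t.
  by nra.
have p0 : 0 < psi (2 * (2 ^+ k * t)) by apply: psi_pos; lra.
have := psi_ratio tk; rewrite ler_pdivlMr// => h.
apply: le_trans IH; rewrite exprSr -mulrA.
by rewrite ler_pM2l ?exprn_gt0 ?(lt_trans _ hlambda)// exprS -mulrA.
Qed.

(** Iterating the ratio condition: a constant factor in time buys any constant factor in all
    [psi t ^ alpha i] at once. Constants in the height of [u] can thus be traded for constants in
    [t], in both cases of the theorem. *)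
Lemma psi_pow_small (e : R) : 0 < e -> exists k : nat, forall i t, 1 <= t ->
  psi (2 ^+ k * t) `^ alpha i <= e * psi t `^ alpha i.
Proof.
move=> e0.
have l0 : 0 < lambda by exact: lt_trans hlambda.
have : \forall k \near \oo, forall i, (lambda^-1 ^+ k) `^ alpha i <= e.
  apply: filter_forall => i.
  have L : (lambda^-1) ^+ k @[k --> \oo] --> (0 : R).
    by apply: cvg_expr; rewrite ger0_norm ?invr_ge0 ?(ltW l0)// invf_lt1.
  have e1 : 0 < e `^ (alpha i)^-1 by rewrite powR_gt0.
  move/cvgrPdist_lt: L => /(_ _ e1); apply: filterS => k.
  rewrite sub0r normrN ger0_norm ?exprn_ge0 ?invr_ge0 ?(ltW l0)// => h.
  have -> : e = (e `^ (alpha i)^-1) `^ alpha i.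
    by rewrite -powRrM mulVf ?gt_eqF// powRr1// ltW.
  by apply: powR_le; rewrite ?exprn_ge0 ?invr_ge0 ?ltW.
move=> [k _ /(_ k (leqnn k)) h]; exists k => i t t1.
have t0 : 0 < t by exact: lt_le_trans t1.
have p0 : 0 < psi (2 ^+ k * t) by rewrite psi_pos// mulr_gt0// exprn_gt0.
have : psi (2 ^+ k * t) <= lambda^-1 ^+ k * psi t.
  by rewrite exprVn ler_pdivlMl ?exprn_gt0// psi_pow2.
move=> /(powR_le (ltW p0))/(_ (ltW (halpha i)))/le_trans; apply.
rewrite powRM ?exprn_ge0 ?invr_ge0 ?(ltW l0) ?(ltW (psi_pos t0))//.
by rewrite ler_wpM2r ?powR_ge0.
Qed.

Lemma t_set_lb (u : 'cV[int]_m) : lbound [set t : R | 0 < t /\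
    forall i, `|(u i 0)%:~R| < psi t `^ (- alpha i)] 0.
Proof. by move=> t [/ltW]. Qed.

Lemma t_set_nonempty (u : 'cV[int]_m) : [set t : R | 0 < t /\
    forall i, `|(u i 0)%:~R| < psi t `^ (- alpha i)] !=set0.
Proof.
have : \forall t \near +oo%R, 1 < t /\
    forall i, `|(u i 0)%:~R| < psi t `^ (- alpha i).
  near=> t; split; first by near: t; exact: nbhs_pinfty_gt.
  near: t; apply: filter_forall => i.
  pose e : R := (`|(u i 0)%:~R| + 1) `^ (- (alpha i)^-1).
  have u1 : 0 < `|(u i 0)%:~R| + 1 :> R by rewrite ltr_wpDl.
  have e0 : 0 < e by rewrite powR_gt0.
  have [T T1 hT] := psi_small e0.
  near=> t.
  have tT : T <= t by near: t; exact: nbhs_pinfty_ge (num_real _).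
  have t0 : 0 < t by exact: lt_le_trans (lt_le_trans ltr01 T1) tT.
  have : e `^ (- alpha i) <= psi t `^ (- alpha i).
    by apply: powRN_le; rewrite ?psi_pos// ltW// hT.
  apply: lt_le_trans; rewrite /e -powRrM mulrNN mulVf ?gt_eqF// powRr1 ?ltW//.
  by rewrite ltrDl.
by move=> /filter_ex[t [t1 h]]; exists t; split => //; exact: lt_trans t1.
Unshelve. all: by end_near.
Qed.

Lemma t_of_lt (u : 'cV[int]_m) (t : R) : t_of alpha psi u < t ->
  forall i, `|(u i 0)%:~R| < psi t `^ (- alpha i).
Proof.
move=> h i; have [s [s0 hs] st] := inf_lt (t_set_nonempty u) h.
apply: lt_le_trans (hs i) _; apply: powRN_le; last exact: ltW.
  by apply: psi_pos; exact: lt_trans st.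
by apply: psi_decr => //; exact: ltW.
Qed.

Lemma t_of_le (C : R) : 0 < C -> exists2 C', 1 <= C' &
  forall (u : 'cV[int]_m) (t : R), 1 <= t ->
  (forall i, `|(u i 0)%:~R| <= C * psi t `^ (- alpha i)) ->
  t_of alpha psi u <= C' * t.
Proof.
move=> C0; have e0 : 0 < (C + 1)^-1 by rewrite invr_gt0 ltr_pwDl.
have [k hk] := psi_pow_small e0.
exists (2 ^+ k); first by rewrite exprn_ege1// ler1n.
move=> u t t1 hu.
have t0 : 0 < t by exact: lt_le_trans t1.
have kt : 0 < 2 ^+ k * t by rewrite mulr_gt0// exprn_gt0.
apply: ge_inf; first by exists 0; exact: t_set_lb.
split => // i; apply: le_lt_trans (hu i) _.
have := hk i t t1; rewrite !powRN.
have p0 : 0 < psi t `^ alpha i by rewrite powR_gt0// psi_pos.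
have q0 : 0 < psi (2 ^+ k * t) `^ alpha i by rewrite powR_gt0// psi_pos.
rewrite (mulrC _^-1) ler_pdivlMr ?ltr_pwDl// => h.
rewrite -(ltr_pM2r q0) mulVf ?gt_eqF// -(ltr_pM2r p0) mul1r.
rewrite mulrAC -(mulrA C) mulVf ?gt_eqF// mulr1.
by move: h; rewrite mulrDr mulr1 mulrC => h; lra.
Qed.

Lemma t_of_large (T : R) : 0 < T -> exists r : R, forall u : 'cV[int]_m,
  r <= `|real_vec u : 'cV[R]_m| -> T <= t_of alpha psi u.
Proof.
move=> T0; exists (1 + \sum_i psi T `^ (- alpha i)) => u; apply: contraTT.
rewrite -!ltNge => /t_of_lt h.
have s0 : 0 <= \sum_i psi T `^ (- alpha i) by apply: sumr_ge0 => i _; exact: powR_ge0.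
apply: mxnorm_lt => [|i j]; first by rewrite ltr_pwDl.
rewrite ord1 mxE; apply: lt_trans (h i) _.
rewrite (bigD1 i)//= addrCA ltrDl ltr_pwDl//.
by apply: sumr_ge0 => l _; exact: powR_ge0.
Qed.

End InverseScale.

(** * Hausdorff contents and covers of planks *)

Section HausdorffContent.
Context {R : realType} {m n : nat}.
Implicit Types (f : R -> R) (E F : set 'M[R]_(m, n)).
Local Open Scope ereal_scope.

Lemma dimension_function_small f (e : R) : dimension_function f ->
  (0 < e)%R -> exists2 d : R, (0 < d)%R & (forall r, 0 <= r <= d -> f r < e)%R.
Proof.
move=> [fc fM f0 f00] e0.
have : {within `[0%R, +oo[, continuous f} by [].
move=> /continuous_within_itvcyP[_ h].
move/cvgrPdist_lt: h => /(_ _ e0); rewrite near_withinE f00.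
move=> /nbhs_ballP[d /= d0 hd]; exists (d / 2)%R; first by rewrite divr_gt0.
move=> r /andP[r0 rd]; have [->|rN] := eqVneq r 0%R; first by rewrite f00.
have rp : (0 < r)%R by rewrite lt0r rN.
have := hd r; rewrite /ball/= sub0r normrN sub0r normrN ger0_norm//.
rewrite ger0_norm ?f0//; apply => //; lra.
Qed.

Lemma content_mono f E F (eta : R) : E `<=` F ->
  hausdorff_content f E eta <= hausdorff_content f F eta.
Proof.
move=> EF; apply: ereal_inf_le_tmp => _ [c [r [h1 h2 ->]]].
by exists c, r; split => //; exact: subset_trans h2.
Qed.

Lemma content_ge0 f E (eta : R) : dimension_function f ->
  0 <= hausdorff_content f E eta.
Proof.
move=> [_ _ f0 _]; apply: le_ereal_inf_tmp => _ [c [r [h1 h2 ->]]].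
apply: nneseries_ge0 => k _ _; rewrite lee_fin f0//.
by have [r0 _] := h1 k; rewrite mulr_ge0// ltW.
Qed.

(** Covers are sequences of balls of positive radius, so the integers that code no element of [J]
    are given balls so small that their total cost is at most [e]. *)
Lemma content_le_esum (I : countType) (J : set I) f E (eta : R)
    (c : I -> 'M[R]_(m, n)) (r : I -> R) :
  dimension_function f -> (0 < eta)%R ->
  (forall i, J i -> 0 < r i /\ 2 * r i <= eta)%R ->
  E `<=` \bigcup_(i in J) ball (c i) (r i) ->
  hausdorff_content f E eta <= \esum_(i in J) (f (2 * r i))%:E.
Proof.
move=> df eta0 hr hE; have [_ _ f0 f00] := df.
apply/lee_addgt0Pr => e e0.
have small k : exists2 s : R, (0 < s /\ 2 * s <= eta)%R & (f (2 * s) <= e / (2 ^ k.+1)%:R)%R.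
  have ek : (0 < e / (2 ^ k.+1)%:R)%R by rewrite divr_gt0// ltr0n expn_gt0.
  have [d d0 hd] := dimension_function_small df ek.
  exists (Num.min d eta / 2)%R; first split.
  - by rewrite divr_gt0// lt_min d0.
  - by rewrite mulrC divfK// ge_min lexx orbT.
  - by rewrite mulrC divfK//; apply/ltW/hd; rewrite ge_min lexx le_min (ltW d0) (ltW eta0).
pose s k := s2val (cid2 (small k)).
have sP k : (0 < s k /\ 2 * s k <= eta)%R := s2valP (cid2 (small k)).
have sS k : (f (2 * s k) <= e / (2 ^ k.+1)%:R)%R := s2valP' (cid2 (small k)).
pose pk k := if @pickle_inv I k is Some i then if `[< J i >] then Some i else None else None.
pose g k := if pk k is Some i then (f (2 * r i))%:E else 0.
pose c' k := if pk k is Some i then c i else 0%R.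
pose r' k := if pk k is Some i then r i else s k.
have pkJ k i : pk k = Some i -> J i /\ pickle i = k.
  rewrite /pk; case E1 : (@pickle_inv I k) => [j|]//; case: asboolP => // Jj [<-].
  by split => //; have := @pickle_invK I k; rewrite E1.
have pkp i : J i -> pk (pickle i) = Some i.
  by move=> Ji; rewrite /pk pickleK_inv; case: asboolP.
have g0 k : 0 <= g k.
  rewrite /g; case E1 : (pk k) => [i|]//; have [Ji _] := pkJ _ _ E1.
  by rewrite lee_fin f0// mulr_ge0// ltW//; have [] := hr _ Ji.
have gE : \sum_(0 <= k <oo) g k = \esum_(i in J) (f (2 * r i))%:E.
  rewrite nneseries_esumT//.
  transitivity (\esum_(k in [set pickle i | i in J]) g k).
    rewrite [RHS]esum_mkcond; apply: eq_esum => k _; case: ifPn => // /negP kJ.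
    rewrite /g; case E1 : (pk k) => [i|]//; exfalso; apply: kJ; rewrite inE.
    by have [Ji ik] := pkJ _ _ E1; exists i.
  rewrite esum_image; last by move=> i j _ _; exact: (pcan_inj pickleK).
  by apply: eq_esum => i Ji; rewrite /g pkp.
apply: ge_ereal_inf; exists (\sum_(0 <= k <oo) (f (2 * r' k))%:E).
  exists c', r'; split => //.
    move=> k; rewrite /r'; case E1 : (pk k) => [i|]; last exact: sP.
    by apply: hr; have [] := pkJ _ _ E1.
  move=> A /hE[i Ji Ai]; exists (pickle i) => //.
  by rewrite /c' /r' pkp.
rewrite -gE; apply: le_trans (epsilon_trick xpredT g0 (ltW e0)).
apply: lee_nneseries => [k _ _|k _].
  rewrite lee_fin f0// mulr_ge0// /r'; case E1 : (pk k) => [i|]; last by have [/ltW] := sP k.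
  by have [Ji _] := pkJ _ _ E1; have [/ltW] := hr _ Ji.
rewrite /r' /g; case E1 : (pk k) => [i|]; last by rewrite add0e lee_fin.
by rewrite -[leLHS]adde0 leeD2l// lee_fin divr_ge0// ltW.
Qed.

Lemma hausdorff_measure0 f E : dimension_function f ->
  (forall eta e : R, (0 < eta)%R -> (0 < e)%R ->
     hausdorff_content f E eta <= e%:E) ->
  hausdorff_measure f E = 0.
Proof.
move=> df h; apply: lim_near_cst; first exact: ereal_hausdorff.
near=> eta.
have eta0 : (0 < eta)%R by near: eta; exact: nbhs_right_gt.
apply/eqP; rewrite eq_le content_ge0// andbT.
by apply/lee_addgt0Pr => e e0; rewrite add0e h.
Unshelve. all: by end_near.
Qed.

Lemma hausdorff_measure_infty f E :
  (forall M : R, exists2 eta0 : R, 0 < eta0 &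
    forall eta : R, 0 < eta <= eta0 -> (M%:E <= hausdorff_content f E eta)%E)%R ->
  hausdorff_measure f E = +oo.
Proof.
move=> h; apply: cvg_lim; first exact: ereal_hausdorff.
apply/cvgeyPge => M; have [e e0 he] := h M.
near=> eta; apply: he; apply/andP; split.
  by near: eta; exact: nbhs_right_gt.
by near: eta; exact: nbhs_right_le.
Unshelve. all: by end_near.
Qed.

End HausdorffContent.

Section BoundedFunctions.

Lemma card_bounded_ffun (aT : finType) (B : nat) (bnd : aT -> nat) :
  (#|[set g : {ffun aT -> 'I_B} | [forall x, (g x < bnd x)%N]]%SET| <=
   \prod_x bnd x)%N.
Proof.
have -> : #|[set g : {ffun aT -> 'I_B} | [forall x, (g x < bnd x)%N]]%SET| =
    #|family (fun x => [pred y : 'I_B | (y < bnd x)%N])|.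
  by apply: eq_card => g; rewrite inE; apply/forallP/familyP => h x; have := h x.
rewrite card_family foldrE big_map big_enum/=; apply: leq_prod => x _.
have [b|b] := leqP (bnd x) B.
  rewrite -[leqRHS](card_ord (bnd x)).
  have wi : injective (widen_ord b) by move=> y z /(congr1 val)/= /val_inj.
  rewrite -(fintype.card_image wi).
  apply/subset_leq_card/fintype.subsetP => y yb.
  by apply/codomP; exists (Ordinal (yb : (y < bnd x)%N)); exact: val_inj.
by rewrite (leq_trans (max_card _))// card_ord ltnW.
Qed.

End BoundedFunctions.

(** * Efficient covers of a plank *)

Section PlankCover.
Context {R : realType} {m n : nat}.

Lemma truncn_le (x : R) : 0 <= x -> (Num.truncn x)%:R <= x.
Proof. by move=> x0; have /andP[] := truncn_itv x0. Qed.

Lemma truncn_gt (x : R) : 0 <= x -> x < (Num.truncn x).+1%:R.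
Proof. by move=> x0; have /andP[] := truncn_itv x0. Qed.

Definition plank (C : R) (u : 'cV[int]_m) (eta : 'I_n -> R) : set 'M[R]_(m, n) :=
  [set A | exists p : 'cV[int]_n, forall l,
     `|(A^T *m real_vec u) l 0 - (p l 0)%:~R| <= C * eta l].

(** Let [i0] be a row where [u] is largest. The other rows are rounded freely to multiples of [rho];
    together with [p l] they determine the entry [A i0 l] up to [C * eta l / h + m * rho], which is
    covered by [2 * Os l + 1] steps of length [rho]. The [O(h)] values of each [p l] account for
    [h ^+ n]. *)
Lemma plank_cover (C : R) : 1 <= C -> exists2 K : R, 0 < K &
  forall (u : 'cV[int]_m) (eta : 'I_n -> R) (rho : R),
  let h := `|real_vec u : 'cV[R]_m| in
  u != 0 -> (forall l, 0 <= eta l <= 1) -> 0 < rho <= 1 ->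
  exists (N : nat) (c : nat -> 'M[R]_(m, n)),
    unit_cube `&` plank C u eta `<=` \bigcup_(k in [set k | (k < N)%N]) ball (c k) rho /\
    N%:R <= K * h ^+ n * rho ^- (m.-1 * n) *
       \prod_(l < n) Num.max 1 (eta l / h / rho).
Proof.
(* One copy of the squared factor bounds the offsets, the other the integers [p l], and [2 ^+ m.-1]
   the rounding of the free rows. *)
move=> C1; pose K0 : R := (2 * m%:R + 2 * C + 3) ^+ 2 * 2 ^+ m.-1.
have m0 : 0 <= m%:R :> R by [].
have K00 : 0 < K0 by rewrite mulr_gt0 ?exprn_gt0//; lra.
exists (K0 ^+ n); first by rewrite exprn_gt0.
move=> u eta rho h u0 heta /andP[rho0 rho1].
have [i0 hi0] : exists i0, h = `|(u i0 0)%:~R|.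
  have hN : h != 0.
    rewrite normr_eq0; apply: contra_neq u0 => /matrixP z.
    by apply/matrixP => i j; have := z i j; rewrite !mxE => /eqP; rewrite intr_eq0 => /eqP.
  have [[i j] ij] := mx_norm_neq0 hN; exists i; rewrite /h [LHS]ij/= mxE ord1.
  by [].
have h1 : 1 <= h.
  rewrite hi0 -intr_norm ler1z -gtz0_ge1 normr_gt0.
  apply: contra_neq u0 => ui; apply/matrixP => i j.
  have := mxnorm_ge (real_vec u : 'cV[R]_m) i j.
  rewrite -/h hi0 ui normr0 !mxE normr_le0 intr_eq0 => /eqP; by rewrite ord1.
have h0 : 0 < h by exact: lt_le_trans h1.
have ui0 : (u i0 0)%:~R != 0 :> R by rewrite -normr_eq0 -hi0 gt_eqF.
have uh i : `|(u i 0)%:~R : R| <= h.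
  by have := mxnorm_ge (real_vec u : 'cV[R]_m) i 0; rewrite mxE.
pose Nx := (Num.truncn rho^-1).+1.
pose Os l := (Num.truncn (C * (eta l / h / rho)) + m.+1)%N.
pose P := (Num.truncn ((m%:R + C) * h)).+1.
pose bnd (il : 'I_m * 'I_n) := if il.1 == i0 then (2 * Os il.2).+1 else Nx.
pose B' := (\max_il bnd il + 2 * P)%N; pose B := B'.+1.
have bB il v : (v < bnd il)%N -> (v < B)%N.
  by move=> h2; rewrite ltnS (leq_trans (ltnW h2))// (leq_trans (leq_bigmax il))// leq_addr.
pose T := ({ffun 'I_m * 'I_n -> 'I_B} * {ffun 'I_n -> 'I_B})%type.
pose S : {set T} := finset.setX
   [set g : {ffun 'I_m * 'I_n -> 'I_B} | [forall x, (g x < bnd x)%N]]%SET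
   [set e : {ffun 'I_n -> 'I_B} | [forall x, (e x < (2 * P).+1)%N]]%SET.
pose z (g : {ffun 'I_m * 'I_n -> 'I_B}) (e : {ffun 'I_n -> 'I_B}) l : R :=
  ((e l)%:R - P%:R - \sum_(i | i != i0) (u i 0)%:~R * ((g (i, l))%:R * rho))
  / (u i0 0)%:~R.
pose cen (x : T) : 'M[R]_(m, n) := \matrix_(i, l)
  if i == i0 then z x.1 x.2 l + ((x.1 (i0, l))%:R - (Os l)%:R) * rho
  else (x.1 (i, l))%:R * rho.
exists #|S|, (fun k => if insub k is Some j then cen (enum_val (j : 'I_#|S|)) else 0).
split.
  move=> A [A01 [p hp]].
  pose xv i l := Num.truncn (A i l / rho).
  have Ar i l : 0 <= A i l / rho by rewrite divr_ge0 ?(ltW rho0)//; have /andP[] := A01 i l.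
  have xv1 i l : (xv i l)%:R <= A i l / rho by exact: truncn_le.
  have xv2 i l : A i l / rho < (xv i l)%:R + 1.
    by have := truncn_gt (Ar i l); rewrite -natr1.
  have xv1' i l : (xv i l)%:R * rho <= A i l by rewrite -ler_pdivlMr.
  have xv2' i l : A i l < (xv i l)%:R * rho + rho.
    by have := xv2 i l; rewrite ltr_pdivrMr// mulrDl mul1r.
  have xvN i l : (xv i l < Nx)%N.
    rewrite ltnS; apply: le_truncn; rewrite ler_pdivrMr// mulVf ?gt_eqF//.
    by have /andP[] := A01 i l.
  pose zz l : R := ((p l 0)%:~R - \sum_(i | i != i0) (u i 0)%:~R * ((xv i l)%:R * rho))
     / (u i0 0)%:~R.
  have AuE l : (A^T *m real_vec u) l 0 = \sum_i (u i 0)%:~R * A i l.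
    by rewrite mxE; apply: eq_bigr => i _; rewrite !mxE mulrC.
  have Azz l : `|A i0 l - zz l| <= C * (eta l / h) + m%:R * rho.
    have E1 : (A i0 l - zz l) * (u i0 0)%:~R = ((A^T *m real_vec u) l 0 - (p l 0)%:~R)
        - \sum_(i | i != i0) (u i 0)%:~R * (A i l - (xv i l)%:R * rho).
      have -> : \sum_(i | i != i0) (u i 0)%:~R * (A i l - (xv i l)%:R * rho) =
          \sum_(i | i != i0) (u i 0)%:~R * A i l -
          \sum_(i | i != i0) (u i 0)%:~R * ((xv i l)%:R * rho).
        by rewrite -sumrB; apply: eq_bigr => i _; rewrite mulrBr.
      rewrite mulrBl divfK// AuE [X in X - (p l 0)%:~R](bigD1 i0)//=.
      by ring.
    have E2 : `|\sum_(i | i != i0) (u i 0)%:~R * (A i l - (xv i l)%:R * rho)| <= m%:R * (h * rho).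
      apply: le_trans (ler_norm_sum _ _ _) _.
      apply: (@le_trans _ _ (\sum_(i | i != i0) h * rho)).
        apply: ler_sum => i _; rewrite normrM ler_pM// ger0_norm.
          by rewrite lerBlDl ltW.
        by rewrite subr_ge0.
      rewrite sumr_const -[X in X <= _]mulr_natl ler_wpM2r ?mulr_ge0 ?(ltW h0) ?(ltW rho0)//.
      by rewrite ler_nat -[X in (_ <= X)%N]card_ord max_card.
    have : `|A i0 l - zz l| * h <= C * eta l + m%:R * (h * rho).
      rewrite hi0 -normrM E1; apply: le_trans (ler_normB _ _) _.
      by rewrite -hi0 lerD.
    rewrite -ler_pdivlMr// => /le_trans; apply.
    by apply: ler_eq; field; rewrite gt_eqF.
  pose w l := (A i0 l - zz l) / rho + (Os l)%:R.
  have OsE l : C * (eta l / h / rho) + m%:R <= (Os l)%:R.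
    rewrite /Os addnS -addSn natrD lerD2r ltW// truncn_gt// mulr_ge0 ?divr_ge0 ?(ltW rho0) ?(ltW h0)//.
      by rewrite (le_trans _ C1).
    by have /andP[] := heta l.
  have Azz' l : `|(A i0 l - zz l) / rho| <= (Os l)%:R.
    rewrite normrM (gtr0_norm (x := rho^-1)) ?invr_gt0// ler_pdivrMr//.
    apply: le_trans (Azz l) _; apply: le_trans (ler_wpM2r (ltW rho0) (OsE l)).
    by apply: ler_eq; field; rewrite !gt_eqF.
  have w0 l : 0 <= w l by have := Azz' l; rewrite ler_norml /w; lra.
  have w2 l : w l <= (2 * Os l)%:R.
    by have := Azz' l; rewrite ler_norml natrM /w; lra.
  pose ov l := Num.truncn (w l).
  have ov1 l : (ov l)%:R <= w l by exact: truncn_le.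
  have ov2 l : w l < (ov l)%:R + 1 by have := truncn_gt (w0 l); rewrite -natr1.
  have ovB l : (ov l < (2 * Os l).+1)%N.
    by rewrite ltnS -(ler_nat R) (le_trans (ov1 l)).
  have pP l : `|(p l 0)%:~R : R| <= P%:R.
    have E1 : `|(A^T *m real_vec u) l 0| <= m%:R * h.
      rewrite AuE; apply: le_trans (ler_norm_sum _ _ _) _.
      apply: (@le_trans _ _ (\sum_(i < m) h)).
        apply: ler_sum => i _; rewrite normrM -[leRHS]mulr1 ler_pM//.
        by have /andP[a1 a2] := A01 i l; rewrite ger0_norm.
      by rewrite sumr_const card_ord mulr_natl.
    have E2 : `|(p l 0)%:~R : R| <= m%:R * h + C.
      have -> : (p l 0)%:~R = (A^T *m real_vec u) l 0 - ((A^T *m real_vec u) l 0 - (p l 0)%:~R) :> R by ring.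
      apply: le_trans (ler_normB _ _) _; apply: lerD => //.
      apply: le_trans (hp l) _; have /andP[_ e1] := heta l.
      by rewrite ler_piMr// (le_trans _ C1).
    have E3 : (m%:R + C) * h < P%:R by rewrite /P truncn_gt// mulr_ge0 ?(ltW h0)//; lra.
    nra.
  pose g : {ffun 'I_m * 'I_n -> 'I_B} :=
    [ffun il => inord (if il.1 == i0 then ov il.2 else xv il.1 il.2)].
  have gE il : g il = (if il.1 == i0 then ov il.2 else xv il.1 il.2) :> nat.
    rewrite ffunE inordK// (@bB il)// /bnd; case: ifP => _; [exact: ovB|exact: xvN].
  pose e : {ffun 'I_n -> 'I_B} := [ffun l => inord (absz (p l 0 + P%:Z))].
  have pPz l : (- P%:Z <= p l 0 <= P%:Z)%R.
    have := pP l; rewrite -intr_norm -[P%:R]/(P%:Z%:~R) ler_int; lia.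
  have eB l : (absz (p l 0 + P%:Z)%R < (2 * P).+1)%N by have := pPz l; lia.
  have eE l : e l = absz (p l 0 + P%:Z) :> nat.
    by rewrite ffunE inordK// (leq_trans (eB l))// ltnS leq_addl.
  have eR l : (e l)%:R - P%:R = (p l 0)%:~R :> R.
    rewrite eE -[(_)%:R]/((absz (p l 0 + P%:Z))%:Z%:~R) gez0_abs; last by have := pPz l; lia.
    by rewrite rmorphD/= addrK.
  have geS : (g, e) \in S.
    rewrite !inE/=; apply/andP; split; apply/forallP => x; last by rewrite eE eB.
    rewrite gE /bnd; case: ifP => _; [exact: ovB|exact: xvN].
  have zE l : z g e l = zz l.
    rewrite /z /zz eR; congr ((_ - _) / _); apply: eq_bigr => i ii0.
    by rewrite gE/= (negbTE ii0).
  exists (enum_rank_in geS (g, e)); first by rewrite /=.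
  rewrite /= valK enum_rankK_in//.
  split => // i l; rewrite /ball/= mxE; case: ifPn => [/eqP->|ii0].
    rewrite zE gE/= eqxx.
    have -> : zz l + ((ov l)%:R - (Os l)%:R) * rho - A i0 l = ((ov l)%:R - w l) * rho.
      by rewrite /w; field; rewrite gt_eqF.
    rewrite normrM (gtr0_norm rho0) gtr_pMl//.
    by have := ov1 l; have := ov2 l; rewrite ltr_norml; lra.
  rewrite gE/= (negbTE ii0).
  by have := xv1' i l; have := xv2' i l; rewrite ltr_norml; lra.
have cS : (#|S| <= (\prod_il bnd il) * (\prod_(l < n) (2 * P).+1))%N.
  by rewrite cardsX leq_mul// card_bounded_ffun.
apply: (@le_trans _ _ ((\prod_il bnd il) * (\prod_(l < n) (2 * P).+1))%:R); first by rewrite ler_nat.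
have -> : (\prod_il bnd il = \prod_(l < n) \prod_(i < m) bnd (i, l))%N.
  by rewrite exchange_big/= pair_bigA/=; apply: eq_bigr => -[].
rewrite -big_split/= natr_prod.
have -> : K0 ^+ n * h ^+ n * rho ^- (m.-1 * n) * \prod_(l < n) Num.max 1 (eta l / h / rho) =
    \prod_(l < n) (K0 * h * rho ^- m.-1 * Num.max 1 (eta l / h / rho)).
  rewrite big_split/= prodr_const card_ord; congr (_ * _).
  by rewrite !exprMn exprVn exprM.
apply: ler_prod => l _; rewrite ler0n/=.
rewrite (bigD1 i0)//= /bnd/= eqxx.
rewrite (eq_bigr (fun=> Nx)); last by move=> i /negbTE ->.
rewrite prod_nat_const cardC1 card_ord.
set M1 := Num.max _ _.
have M11 : 1 <= M1 by rewrite le_max lexx.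
have M12 : eta l / h / rho <= M1 by rewrite le_max lexx orbT.
have e0 : 0 <= eta l / h / rho.
  by rewrite !divr_ge0 ?(ltW rho0) ?(ltW h0)//; have /andP[] := heta l.
have b1 : ((2 * Os l).+1)%:R <= (2 * m%:R + 2 * C + 3) * M1.
  have : (Num.truncn (C * (eta l / h / rho)))%:R <= C * (eta l / h / rho).
    by rewrite truncn_le// mulr_ge0// (le_trans _ C1).
  rewrite /Os -natr1 natrM natrD -natr1; set tr := (Num.truncn _)%:R.
  have : C * (eta l / h / rho) <= C * M1 by rewrite ler_wpM2l// (le_trans _ C1).
  have : m%:R <= m%:R * M1 by rewrite ler_peMr.
  lra.
have b2 : ((2 * P).+1)%:R <= (2 * m%:R + 2 * C + 3) * h.
  have : (Num.truncn ((m%:R + C) * h))%:R <= (m%:R + C) * h.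
    by rewrite truncn_le// mulr_ge0 ?(ltW h0)//; lra.
  rewrite /P -natr1 natrM -natr1; set tr := (Num.truncn _)%:R; lra.
have b3 : Nx%:R <= 2 * rho^-1.
  have r1 : 1 <= rho^-1 by rewrite invf_ge1.
  have : (Num.truncn rho^-1)%:R <= rho^-1 by rewrite truncn_le// (le_trans _ r1).
  rewrite /Nx -natr1; lra.
rewrite !natrM natrX.
have b4 : Nx%:R ^+ m.-1 <= 2 ^+ m.-1 * rho ^- m.-1 :> R.
  rewrite -exprVn -exprMn lerXn2r// ?nnegrE//; apply: le_trans b3.
  exact: ler0n.
apply: (@le_trans _ _ (((2 * m%:R + 2 * C + 3) * M1) * (2 ^+ m.-1 * rho ^- m.-1)
    * ((2 * m%:R + 2 * C + 3) * h))).
  by rewrite !ler_pM// mulr_ge0// exprn_ge0.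
by apply: ler_eq; rewrite /K0; field; rewrite expf_neq0// gt_eqF.
Qed.

End PlankCover.

(** * The convergence case *)

Section EsumLemmas.
Context {R : realType} {T : choiceType}.
Local Open Scope ereal_scope.

Lemma esumZ_le (S : set T) (a : T -> \bar R) (k : R) : (0 <= k)%R ->
  (forall i, 0 <= a i) ->
  \esum_(i in S) (k%:E * a i) <= k%:E * \esum_(i in S) a i.
Proof.
move=> k0 a0; apply: ub_ereal_sup => _ [X SX <-].
rewrite -ge0_mule_fsumr//; apply: lee_wpmul2l; first by rewrite lee_fin.
by apply: esum_ge; exists X.
Qed.

Lemma esum_tail (S : set T) (a : T -> \bar R) (e : R) : (0 < e)%R ->
  (forall i, 0 <= a i) -> \esum_(i in S) a i < +oo ->
  exists2 X : set T, finite_set X & \esum_(i in S `&` ~` X) a i <= e%:E.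
Proof.
move=> e0 a0 fin.
have fi : \esum_(i in S) a i \is a fin_num.
  by rewrite ge0_fin_numE//; apply: esum_ge0 => i _; exact: a0.
have [_ [X [fX SX] <-] hX] := ub_ereal_sup_adherent e0 fi.
exists X => //; move: hX; rewrite -/(esum S a).
have XE : \sum_(i \in X) a i = \esum_(i in S `&` X) a i.
  by rewrite (setIidr SX) esum_fset.
have fX' : \esum_(i in S `&` X) a i \is a fin_num.
  rewrite ge0_fin_numE; last by apply: esum_ge0 => i _; exact: a0.
  apply: le_lt_trans fin; rewrite (esumID X S)//.
  by rewrite leeDl// esum_ge0.
rewrite XE (esumID X S)// => h.
move: fX' h; clear XE.
case: (\esum_(i in S `&` X) a i) => [x| |]//= _.
case: (\esum_(i in S `&` ~` X) a i) => [y| |]//=.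
  by rewrite -EFinD lte_fin lee_fin; lra.
by move=> _; rewrite leNye.
Qed.

End EsumLemmas.

Lemma esum_cst_ord (R : realType) (N : nat) (x : \bar R) : (0 <= x)%E ->
  (\esum_(k in [set k | (k < N)%N]) x = N%:R%:E * x)%E.
Proof.
move=> x0; rewrite esum_fset; [|exact: finite_II|by []].
rewrite -fsbig_ord; elim: N => [|N IH]; first by rewrite big_ord0 mul0e.
by rewrite big_ord_recr/= IH -natr1 EFinD ge0_muleDl ?mul1e// lee_fin.
Qed.

Section GammaPhi.
Context {R : realType} {m n : nat}.
Variables (alpha : 'I_m -> R) (beta : 'I_n -> R) (psi f : R -> R).
Hypotheses (beta_decr : forall j l : 'I_n, (j <= l)%N -> beta l <= beta j).

Definition plank_width (t h : R) (l : 'I_n) : R := t `^ (- beta l) / h.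

Lemma plank_width_gt0 t h l : 0 < t -> 0 < h -> 0 < plank_width t h l.
Proof. by move=> t0 h0; rewrite divr_gt0// powR_gt0. Qed.

Lemma plank_width_mono t h (l k : 'I_n) : 1 <= t -> 0 < h -> (l <= k)%N ->
  plank_width t h l <= plank_width t h k.
Proof.
move=> t1 h0 lk; rewrite ler_pM2r ?invr_gt0//; apply: ler_powR => //.
by rewrite lerN2 beta_decr.
Qed.

(** The term of index [k] is [Phi] at the radius of width [k]: the quotient of widths [l] and [k] is
    [t ^ (beta k - beta l)], at least 1 for [k <= l] and at most 1 for [l <= k] because [t >= 1].
    [Phi_min] selects the index [j]. *)
Lemma gamma_PhiE (u : 'cV[int]_m) (j : 'I_n) : (0 < m)%N ->
  (forall x, 0 <= x -> 0 <= f x) ->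
  dim_lower (m.-1 * n + (n - j.+1)) f -> dim_upper f (m.-1 * n + (n - j)) ->
  u != 0 -> 1 <= t_of alpha psi u ->
  let h := `|real_vec u : 'cV[R]_m| in let t := t_of alpha psi u in
  gamma alpha beta psi f u =
    (Phi f (m.-1 * n) (plank_width t h) (plank_width t h j))%:E.
Proof.
move=> m0 f0 fl fu u0 t1 h t.
have h0 : 0 < h.
  rewrite normr_gt0; apply: contra_neq u0 => /matrixP z.
  by apply/matrixP => i k; have := z i k; rewrite !mxE => /eqP; rewrite intr_eq0 => /eqP.
have t0 : 0 < t by exact: lt_le_trans t1.
have termE k : f (t `^ (- beta k) / h) * (t `^ (- beta k) / h) `^ ((1 - m%:R) * n%:R)
     * \prod_(l < n | (k <= l)%N) t `^ (beta k - beta l) =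
     Phi f (m.-1 * n) (plank_width t h) (plank_width t h k).
  rewrite /Phi; congr (_ * _ * _).
    have -> : (1 - m%:R) * n%:R = - (m.-1 * n)%:R :> R.
      by rewrite natrM -[in LHS](prednK m0) -natr1; ring.
    by rewrite -/(plank_width t h k) powRN powR_mulrn// ltW// plank_width_gt0.
  rewrite big_mkcond/=; apply: eq_bigr => l _.
  have rE : plank_width t h l / plank_width t h k = t `^ (beta k - beta l).
    rewrite /plank_width invfM invrK mulrACA mulVf ?gt_eqF// mulr1 -powRN opprK.
    rewrite -powRD; first by rewrite addrC.
    by apply/implyP => _; rewrite gt_eqF.
  case: ifPn => [kl|]; rewrite rE.
    by rewrite max_r// -[1](powRr0 t) ler_powR// subr_ge0 beta_decr.
  rewrite -ltnNge => /ltnW lk; rewrite max_l//.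
  by rewrite -[X in _ <= X](powRr0 t) ler_powR// subr_le0 beta_decr.
rewrite /gamma -/h -/t; under eq_bigr do rewrite termE.
apply/eqP; rewrite eq_le bigmin_le/=; apply: le_bigmin => [|k _]; first exact: leey.
rewrite lee_fin; apply: Phi_min => //.
- by move=> l; exact: plank_width_gt0.
- by move=> l l'; exact: plank_width_mono.
- exact: plank_width_gt0.
Qed.

End GammaPhi.

Lemma shift_lt (B : nat) (z : int) : (- B%:Z <= z <= B%:Z)%R ->
  (absz (z + B%:Z)%R < (2 * B).+1)%N.
Proof. lia. Qed.

Lemma shiftK (B : nat) (z : int) : (- B%:Z <= z <= B%:Z)%R ->
  ((absz (z + B%:Z)%R)%:Z - B%:Z = z)%R.
Proof. lia. Qed.

Section Convergence.
Context {R : realType} {m n : nat}.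
Variables (alpha : 'I_m -> R) (beta : 'I_n -> R) (psi f : R -> R) (lambda : R)
  (b : 'cV[R]_m) (a : nat).
Hypotheses (hm : (1 <= m)%N)
  (halpha : forall i, 0 < alpha i) (hbeta : forall j, 0 < beta j)
  (sbeta : \sum_(j < n) beta j = 1)
  (beta_decr : forall j l : 'I_n, (j <= l)%N -> beta l <= beta j)
  (psi_pos : forall t, 0 < t -> 0 < psi t)
  (psi_decr : forall s t, 0 < s -> s <= t -> psi t <= psi s)
  (psi_lim : psi t @[t --> +oo] --> 0)
  (hlambda : 1 < lambda)
  (psi_ratio : forall t, 1 <= t -> lambda <= psi t / psi (2 * t))
  (hb : ~ exists z : 'cV[int]_m, b = real_vec z).

Lemma real_vec_eq0 (k : nat) (u : 'cV[int]_k) : u != 0 -> 0 < `|real_vec u : 'cV[R]_k|.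
Proof.
move=> u0; rewrite normr_gt0; apply: contra_neq u0 => /matrixP z.
by apply/matrixP => i j; have := z i j; rewrite !mxE => /eqP; rewrite intr_eq0 => /eqP.
Qed.

Lemma real_vec_norm_ge1 (k : nat) (u : 'cV[int]_k) :
  u != 0 -> 1 <= `|real_vec u : 'cV[R]_k|.
Proof.
move=> u0; have [i ui] : exists i, u i 0 != 0.
  apply: contrapT => h; move/eqP: u0; apply; apply/matrixP => i j; rewrite ord1 mxE.
  by apply: contrapT => /eqP ui; apply: h; exists i.
apply: le_trans (mxnorm_ge _ i 0); rewrite mxE -intr_norm ler1z.
by rewrite -gtz0_ge1 normr_gt0.
Qed.

Lemma nonint_coord : exists i, forall k : int, b i 0 <> k%:~R.
Proof.
apply: contrapT => /forallNP h; apply: hb.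
have h' i : {k : int | b i 0 = k%:~R}.
  by apply: cid; have /existsNP[k /contrapT] := h i; exists k.
by exists (\col_i sval (h' i)); apply/matrixP => i j; rewrite ord1 !mxE; exact: (svalP (h' i)).
Qed.

Lemma beta_le1 j : beta j <= 1.
Proof.
rewrite -sbeta (bigD1 j)//= lerDl; apply: sumr_ge0 => l _; exact: ltW.
Qed.

Lemma frequently_unsolvable (A : 'M[R]_(m, n)) :
  Dirichlet_set_compl alpha beta psi b A ->
  unit_cube A /\
  forall T, exists2 t, T <= t & ~ solvable_at alpha beta psi b A t.
Proof.
move=> [cA nA]; split => // T; apply: contrapT => h; apply: nA; split => //.
rewrite /= /is_Dirichlet; near=> t.
apply: contrapT => nt; apply: h; exists t => //.
Unshelve. all: by end_near.
Qed.

Lemma unsolvable_approx : exists2 C : R, 1 <= C & exists T0 : R,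
  forall (A : 'M[R]_(m, n)) t, T0 <= t ->
  ~ solvable_at alpha beta psi b A t ->
  1 <= t /\
  exists (u : 'cV[int]_m) (p : 'cV[int]_n), [/\ u != 0,
    forall i, `|(u i 0)%:~R| <= C * psi t `^ (- alpha i) &
    forall j, `|(A^T *m real_vec u) j 0 - (p j 0)%:~R| <= C * t `^ (- beta j)].
Proof.
have [C C1 tr] := @linear_form_transference R m n; exists C => //.
have [i0 hi0] := nonint_coord.
have d0 := dist_int_gt0 hi0; set d := dist_int _ in d0.
have e0 : 0 < d `^ (alpha i0)^-1 by rewrite powR_gt0.
(* Past [T1] the bound [psi t ^ alpha i0] is below the distance of [b i0] to the integers, so
   [q = 0] does not solve the system of the transference. Past [T2] every [t ^ beta j] exceeds [C],
   which excludes [u = 0]. *)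
have [T1 T11 hT1] := psi_small psi_pos psi_lim e0.
pose T2 : R := 1 + \sum_j (C + 1) `^ (beta j)^-1.
have C0 : 0 < C + 1 by rewrite ltr_wpDl// (le_trans _ C1).
exists (Num.max T1 T2) => A t; rewrite ge_max => /andP[tT1 tT2] ns.
have t1 : 1 <= t by exact: le_trans tT1.
have t0 : 0 < t by exact: lt_le_trans t1.
split => //.
have tb j : C + 1 <= t `^ beta j.
  have -> : C + 1 = ((C + 1) `^ (beta j)^-1) `^ beta j.
    by rewrite -powRrM mulVf ?gt_eqF// powRr1// ltW.
  apply: powR_le; rewrite ?powR_ge0 ?(ltW (hbeta j))//.
  apply: le_trans tT2; rewrite /T2 (bigD1 j)//= addrCA lerDl addr_ge0//.
  by apply: sumr_ge0 => l _; exact: powR_ge0.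
have [|||u [p [upN hu hp]]] := tr A b (fun i => psi t `^ alpha i) (fun j => t `^ beta j).
- by move=> i; rewrite powR_gt0// psi_pos.
- by move=> j; rewrite powR_gt0.
- move=> [q [k [h1 h2]]].
  have [q0|qN] := eqVneq q 0.
    have := h1 i0; rewrite q0.
    have -> : (A *m real_vec 0 + b) i0 0 = b i0 0.
      have -> : real_vec 0 = 0 :> 'cV[R]_n by apply/matrixP => i j; rewrite !mxE.
      by rewrite mulmx0 add0r.
    apply/negP; rewrite -leNgt; apply: le_trans (dist_int_le _ _).
    have -> : dist_int (b i0 0) = (d `^ (alpha i0)^-1) `^ alpha i0.
      by rewrite -powRrM mulVf ?gt_eqF// powRr1// ltW.
    apply: powR_le; [by rewrite ltW// psi_pos|by rewrite ltW// hT1|exact: ltW].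
  apply: ns; exists q; split => //.
    by apply/weighted_dist_intP => //; [exact: psi_pos|move=> i; exists (k i 0)].
  by apply/weighted_normP => // j; rewrite mxE.
exists u, p; split.
- apply: contraTN upN => /eqP u0; rewrite u0 eqxx/= negbK.
  apply/eqP/matrixP => j l; rewrite ord1 [RHS]mxE; apply: contrapT => /eqP pj.
  have := hp j; rewrite u0.
  have -> : (A^T *m real_vec 0) j 0 = 0.
    have -> : real_vec 0 = 0 :> 'cV[R]_m by apply/matrixP => i k; rewrite !mxE.
    by rewrite mulmx0 mxE.
  rewrite sub0r normrN; apply/negP; rewrite -ltNge.
  have p1 : 1 <= `|(p j 0)%:~R : R|.
    by rewrite -intr_norm ler1z -gtz0_ge1 normr_gt0.
  apply: (@lt_le_trans _ _ (t `^ beta j)).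
    by apply: lt_le_trans (tb j); rewrite ltrDl.
  by rewrite ler_peMr// powR_ge0.
- move=> i; have := hu i; rewrite powRN.
  by rewrite ler_pdivlMr ?powR_gt0 ?psi_pos// mulrC.
- move=> j; have := hp j; rewrite powRN.
  by rewrite ler_pdivlMr ?powR_gt0// mulrC.
Qed.

(** Unsolvable times tend to infinity, but the vectors they produce may have bounded height. In that
    event one fixed [u] serves arbitrarily large times, so [A^T u] is integral and its multiples do
    the rest. *)
Lemma compl_limsup : exists2 C : R, 1 <= C &
  forall A, Dirichlet_set_compl alpha beta psi b A -> forall r : R,
  exists u : 'cV[int]_m, [/\ u != 0, r <= `|real_vec u : 'cV[R]_m| &
    plank C u (fun l => t_of alpha psi u `^ (- beta l)) A].
Proof.
have [C C1 [T0 hT0]] := unsolvable_approx.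
have C0 : 0 < C by exact: lt_le_trans C1.
have [C' C'1 hC'] := t_of_le halpha psi_pos hlambda psi_ratio C0.
have C'0 : 0 < C' by exact: lt_le_trans C'1.
exists (C * C').
  by rewrite -[1]mulr1 ler_pM.
move=> A /frequently_unsolvable[cA freq] r.
have [r1 hr1] := t_of_large halpha psi_pos psi_decr psi_lim (ltr01 : (0 : R) < 1).
pose r' := Num.max r r1.
have [[T hT]|nT] := pselect (exists T, forall (t : R) (u : 'cV[int]_m) (p : 'cV[int]_n), T <= t -> 1 <= t -> u != 0 ->
    (forall i, `|(u i 0)%:~R| <= C * psi t `^ (- alpha i)) ->
    (forall j, `|(A^T *m real_vec u) j 0 - (p j 0)%:~R| <= C * t `^ (- beta j)) ->
    `|real_vec u : 'cV[R]_m| < r'); last first.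
  have /forallNP/(_ 1)/existsNP[t] := nT.
  move=> /existsNP[u /existsNP[p]].
  move=> /not_implyP[_ /not_implyP[t1 /not_implyP[u0 /not_implyP[hu /not_implyP[hp /negP]]]]].
  rewrite -leNgt ge_max => /andP[ru r1u]; exists u; split => //.
  exists p => j; apply: le_trans (hp j) _; rewrite -mulrA ler_pM2l//.
  have tu := hC' u t t1 hu.
  have tu1 := hr1 u r1u.
  have tu0 : 0 < t_of alpha psi u by exact: lt_le_trans tu1.
  have t0 : 0 < t by exact: lt_le_trans t1.
  have : (C' * t) `^ (- beta j) <= t_of alpha psi u `^ (- beta j).
    by apply: powRN_le => //; exact: ltW.
  rewrite powRM ?(ltW C'0) ?(ltW t0)// powRN => h.
  have cb : 0 < C' `^ beta j by rewrite powR_gt0.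
  have : t `^ (- beta j) <= C' `^ beta j * t_of alpha psi u `^ (- beta j).
    by rewrite -ler_pdivrMl.
  move=> /le_trans; apply; rewrite ler_wpM2r ?powR_ge0//.
  by apply: ler1_powR => //; exact: beta_le1.
(* All multiples of such a [u] satisfy the plank condition with error zero, whatever their time. *)
suff [u [p [u0 up]]] : exists (u : 'cV[int]_m) (p : 'cV[int]_n), u != 0 /\
    forall j, (A^T *m real_vec u) j 0 = (p j 0)%:~R.
  pose k := (Num.truncn `|r|).+1.
  have kr : r <= k%:R by rewrite (le_trans (ler_norm r))// ltW// truncn_gt.
  have kE : real_vec (k%:Z *: u) = k%:R *: real_vec u :> 'cV[R]_m.
    by apply/matrixP => i j; rewrite !mxE rmorphM.
  exists (k%:Z *: u); split.
  - apply: contra_neq u0 => /matrixP z; apply/matrixP => i j.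
    by have := z i j; rewrite !mxE => /eqP; rewrite mulf_eq0/= => /eqP.
  - rewrite kE normrZ ger0_norm//; apply: le_trans kr _.
    by rewrite ler_peMr// real_vec_norm_ge1.
  - exists (k%:Z *: p) => j; rewrite kE -scalemxAr mxE up mxE rmorphM/= subrr normr0.
    by rewrite !mulr_ge0 ?powR_ge0 ?(ltW C0) ?(ltW C'0).
(* Otherwise each [u] serves only times up to [Tu]. The vectors of height below [r'] are finitely
   many, so the sum [S] of their bounds is exceeded by some unsolvable time. *)
apply: contrapT => nint.
have dpos (u : 'cV[int]_m) : u != 0 -> exists j, 0 < dist_int ((A^T *m real_vec u) j 0).
  move=> u0; apply: contrapT => h; apply: nint.
  have h' j : {k : int | (A^T *m real_vec u) j 0 = k%:~R}.
    apply: cid; apply: contrapT => /forallNP hj; apply: h; exists j.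
    exact: dist_int_gt0.
  exists u, (\col_j sval (h' j)); split => // j; rewrite [in RHS]mxE.
  exact: (svalP (h' j)).
have Tu (u : 'cV[int]_m) : {Tu : R | 0 <= Tu & u != 0 -> forall t (p : 'cV[int]_n), 1 <= t ->
   (forall j, `|(A^T *m real_vec u) j 0 - (p j 0)%:~R| <= C * t `^ (- beta j)) -> t <= Tu}.
  apply: cid2; have [->|u0] := eqVneq u 0; first by exists 0.
  have [j dj] := dpos u u0; set d := dist_int _ in dj.
  exists ((C / d) `^ (beta j)^-1); first exact: powR_ge0.
  move=> _ t p t1 /(_ j) h.
  have t0 : 0 < t by exact: lt_le_trans t1.
  have := le_trans (dist_int_le _ _) h; rewrite -/d powRN ler_pdivlMr ?powR_gt0//.
  rewrite mulrC -ler_pdivlMr// => h2.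
  have -> : t = (t `^ beta j) `^ (beta j)^-1.
    by rewrite -powRrM mulfV ?gt_eqF// powRr1// ltW.
  by apply: powR_le; rewrite ?powR_ge0// invr_ge0 ltW.
pose B := (Num.truncn `|r'|).+1.
pose ug (g : {ffun 'I_m -> 'I_(2 * B).+1}) : 'cV[int]_m := \col_i ((g i)%:Z - B%:Z).
pose S := \sum_g s2val (Tu (ug g)).
have [t tS ns] := freq (Num.max T0 (Num.max T (S + 1))).
move: tS; rewrite !ge_max => /and3P[tT0 tT tS].
have [t1 [u [p [u0 hu hp]]]] := hT0 A t tT0 ns.
have ur := hT t u p tT t1 u0 hu hp.
have uB i : (- B%:Z <= u i 0 <= B%:Z)%R.
  have : `|(u i 0)%:~R : R| < B%:R.
    have := mxnorm_ge (real_vec u : 'cV[R]_m) i 0; rewrite mxE => /le_lt_trans; apply.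
    by apply: lt_le_trans ur _; rewrite (le_trans (ler_norm r'))// ltW// truncn_gt.
  by rewrite -intr_norm -[B%:R]/(B%:Z%:~R) ltr_int ltr_norml => /andP[/ltW -> /ltW ->].
have [g gu] : exists g, ug g = u.
  exists [ffun i => inord (absz (u i 0 + B%:Z))]; apply/matrixP => i j.
  rewrite ord1 !mxE ffunE inordK; last exact: shift_lt (uB i).
  exact: shiftK (uB i).
have := s2valP' (Tu u) u0 t p t1 hp.
have : s2val (Tu u) <= S.
  rewrite -gu /S (bigD1 g)//= lerDl; apply: sumr_ge0 => g' _.
  exact: (s2valP (Tu (ug g'))).
lra.
Qed.

Hypotheses (hf : dimension_function f) (ha : (1 <= a <= n - 1)%N)
  (f_ge : dim_lower (m.-1 * n + (n - a)) f)
  (f_le : dim_upper f (m.-1 * n + (n - a.-1))).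

Lemma convergence_case :
  (gamma_series alpha beta psi f < +oo)%E ->
  hausdorff_measure f (Dirichlet_set_compl alpha beta psi b) = 0%E.
Proof.
move=> fin; apply: hausdorff_measure0 => // eta e eta0 e0.
have [C C1 hC] := compl_limsup.
have [K K0 hK] := @plank_cover R m n C C1.
have f0 : forall x, 0 <= x -> 0 <= f x by have [] := hf.
have an : (a.-1 < n)%N by lia.
(* Indices start at 0 here, so the minimum sits at [a - 1]. *)
pose ja : 'I_n := Ordinal an.
have fl' : dim_lower (m.-1 * n + (n - ja.+1)) f.
  by have -> : (n - ja.+1 = n - a)%N by rewrite /=; lia.
pose s := (m.-1 * n + (n - a.-1))%N.
have [r1 hr1] := t_of_large halpha psi_pos psi_decr psi_lim (ltr01 : (0 : R) < 1).
pose S : set 'cV[int]_m := [set u | u != 0].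
pose h (u : 'cV[int]_m) : R := `|real_vec u : 'cV[R]_m|.
pose w u : \bar R := (gamma alpha beta psi f u * (h u ^+ n)%:E)%E.
pose good (u : 'cV[int]_m) := u != 0 /\ r1 <= h u.
pose rho u := plank_width beta (t_of alpha psi u) (h u).
have goodP u : good u -> w u = (Phi f (m.-1 * n) (rho u) (rho u ja) * h u ^+ n)%:E.
  move=> [u0 ru]; rewrite /w (gamma_PhiE beta_decr hm f0 fl' f_le u0)//.
  exact: hr1.
(* The identification of [gamma] with [Phi] needs [t(u) >= 1]. Setting the other terms to zero does
   not affect the tail. *)
pose w' u := if `[< good u >] then w u else 0%E.
have rho0 u l : good u -> 0 < rho u l.
  move=> [u0 ru]; apply: plank_width_gt0; last exact: real_vec_eq0.
  by apply: lt_le_trans (hr1 u ru).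
have w'0 u : (0 <= w' u)%E.
  rewrite /w'; case: asboolP => // gu; rewrite goodP// lee_fin mulr_ge0//; last by rewrite exprn_ge0// /h.
  by apply: Phi_ge0; [apply: f0; apply: ltW|]; exact: rho0.
have fin' : (\esum_(u in S) w' u < +oo)%E.
  apply: le_lt_trans fin; apply: le_esum => u u0; rewrite /w'.
  case: asboolP => // ngu; rewrite mule_ge0 ?lee_fin ?exprn_ge0//.
  apply: le_bigmin => [|k _]; first exact: leey.
  rewrite lee_fin; apply: mulr_ge0; last by apply: prodr_ge0 => l _; exact: powR_ge0.
  by rewrite mulr_ge0 ?powR_ge0// f0// divr_ge0// powR_ge0.
(* The content charges diameters [2 * rho], and doubling the argument costs at most [2 ^+ s] in
   [f]. *)
pose K2 := K * 2 ^+ s.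
have K20 : 0 < K2 by rewrite mulr_gt0// exprn_gt0.
have eK : 0 < e / K2 by rewrite divr_gt0.
have [X fX tail] := esum_tail eK w'0 fin'.
have [r2 hr2] : exists r2, forall u, X u -> h u < r2.
  have /finite_seqP[q qX] := fX; exists (1 + \sum_(v <- q) h v) => u.
  rewrite qX /= => uq; rewrite (big_rem u)//= addrCA ltrDl ltr_pwDl//.
  by apply: sumr_ge0 => v _; rewrite /h.
(* The height [r] ensures [t(u) >= 1], avoids the finite set [X], and makes radii at most 1 and
   diameters at most [eta], as [rho u ja <= 1 / h u]. *)
pose r := Num.max (Num.max r1 r2) (Num.max 1 (2 / eta)).
pose D := [set u : 'cV[int]_m | u != 0 /\ r <= h u].
have Dgood u : D u -> good u by move=> [u0]; rewrite !ge_max => /andP[/andP[? _] _].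
have DX u : D u -> ~ X u.
  by move=> [u0]; rewrite !ge_max => /andP[/andP[_ r2u] _] /hr2; rewrite ltNge r2u.
have eta1 u l : D u -> 0 <= t_of alpha psi u `^ (- beta l) <= 1.
  move=> Du; rewrite powR_ge0/= powRN invf_le1; have [_ ru] := Dgood u Du; last first.
    by rewrite powR_gt0// (lt_le_trans _ (hr1 _ ru)).
  rewrite -[X in X <= _](powRr0 (t_of alpha psi u)); apply: ler_powR; last exact: ltW.
  exact: hr1.
have rho1 u : D u -> 0 < rho u ja <= 1 /\ 2 * rho u ja <= eta.
  move=> Du; have [u0 ru] := Du; rewrite rho0/=; last exact: Dgood.
  have h0 : 0 < h u := real_vec_eq0 u0.
  have rr : rho u ja <= (h u)^-1.
    rewrite /rho /plank_width ler_piMl ?invr_ge0 ?(ltW h0)//.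
    by have /andP[] := eta1 u ja Du.
  move: ru; rewrite !ge_max => /andP[_ /andP[h1 h2]]; split.
    by rewrite (le_trans rr)// invf_le1.
  have : 2 * (h u)^-1 <= eta by rewrite ler_pdivrMr// mulrC -ler_pdivrMr.
  lra.
have cov u : {Nc : nat * (nat -> 'M[R]_(m, n)) | D u ->
   unit_cube `&` plank C u (fun l => t_of alpha psi u `^ (- beta l))
     `<=` \bigcup_(k in [set k | (k < Nc.1)%N]) ball (Nc.2 k) (rho u ja) /\
    Nc.1%:R <= K * h u ^+ n * rho u ja ^- (m.-1 * n) *
       \prod_(l < n) Num.max 1 (rho u l / rho u ja)}.
  apply: cid; have [Du|nD] := pselect (D u); last by exists (0%N, fun=> 0).
  have [u0 _] := Du; have [rr _] := rho1 u Du.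
  have [N [c [c1 c2]]] := hK u _ (rho u ja) u0 (fun l => eta1 u l Du) rr.
  by exists (N, c).
pose N u := (sval (cov u)).1; pose c u := (sval (cov u)).2.
pose J := [set uk : 'cV[int]_m * nat | D uk.1 /\ (uk.2 < N uk.1)%N].
apply: le_trans (content_le_esum (J := J) (c := fun uk => c uk.1 uk.2)
  (r := fun uk => rho uk.1 ja) hf eta0 _ _) _.
- by move=> [u k] [/= Du _]; have [/andP[]] := rho1 u Du.
- move=> A dA; have [u [u0 ru pA]] := hC A dA r.
  have Du : D u by [].
  have [cA _] := frequently_unsolvable dA.
  have [/(_ A (conj cA pA))[k kN Ak] _] := svalP (cov u) Du.
  by exists (u, k).
have -> : (\esum_(i in J) (f (2 * rho i.1 ja))%:E =
   \esum_(u in D) \esum_(k in [set k | (k < N u)%N]) (f (2 * rho u ja))%:E)%E.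
  rewrite esum_esum; last first.
    move=> u k Du _; rewrite lee_fin f0// mulr_ge0//; have [/andP[/ltW]] := rho1 u Du.
    by [].
  by congr esum; apply/seteqP; split => -[u k].
apply: (@le_trans _ _ (\esum_(u in D) (K2%:E * w' u))%E).
  apply: le_esum => u Du; have gu := Dgood u Du.
  have r0 := rho0 u ja gu.
  have f20 : 0 <= f (2 * rho u ja) by rewrite f0// mulr_ge0// ltW.
  rewrite esum_cst_ord ?lee_fin//.
  rewrite /w'; case: asboolP => // _; rewrite goodP// -!EFinM lee_fin.
  have [_ Nle] := svalP (cov u) Du.
  have f2 : f (2 * rho u ja) <= 2 ^+ s * f (rho u ja).
    by apply: dim_upper_scale => //; rewrite ler1n.
  apply: (le_trans (ler_pM _ _ Nle f2)) => //.
  by rewrite /Phi /K2; apply: ler_eq; ring.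
apply: le_trans (esumZ_le D (ltW K20) w'0) _.
apply: (@le_trans _ _ (K2%:E * (e / K2)%:E)%E); last first.
  by rewrite -EFinM lee_fin mulrC divfK// gt_eqF.
apply: lee_wpmul2l; first by rewrite lee_fin ltW.
apply: le_trans tail; rewrite [leLHS]esum_mkcond [leRHS]esum_mkcond.
apply: le_esum => u _; case: ifPn => [|_]; last by case: ifP.
rewrite inE => Du; rewrite ifT// inE; split; first by have [] := Du.
exact: DX.
Qed.

End Convergence.

(** * Weighted collections of cells *)

Section Cells.
Context {R : realType} {m n : nat}.
Variable g : nat.
Hypothesis g2 : (1 < g)%N.
Local Notation cellT := 'M[nat]_(m, n).
Local Notation wcell := ('M[nat]_(m, n) * R)%type.

Let g0 : (0 < g)%N. Proof. exact: ltnW. Qed.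
Let gR0 : 0 < g%:R :> R. Proof. by rewrite ltr0n. Qed.

(** Closed cubes, so that nested cells meet in a point; the price is that neighbours share faces. *)
Definition cell (l : nat) (x : cellT) : set 'M[R]_(m, n) :=
  [set A | forall i j, (x i j)%:R / g%:R ^+ l <= A i j <= (x i j).+1%:R / g%:R ^+ l].

Definition coarse (e : nat) (x : cellT) : cellT := map_mx (fun v => v %/ g ^ e)%N x.

Definition refine (e : nat) (x c : cellT) : cellT :=
  \matrix_(i, j) (x i j * g ^ e + c i j)%N.

Definition bounded_cell (e : nat) (c : cellT) := forall i j, (c i j < g ^ e)%N.

Lemma coarse0 x : coarse 0 x = x.
Proof. by apply/matrixP => i j; rewrite mxE expn0 divn1. Qed.

Lemma coarse_coarse a b x : coarse a (coarse b x) = coarse (a + b) x.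
Proof. by apply/matrixP => i j; rewrite !mxE -divnMA -expnD addnC. Qed.

Lemma coarse_refine e x c : bounded_cell e c -> coarse e (refine e x c) = x.
Proof.
move=> hc; apply/matrixP => i j; rewrite !mxE divnMDl ?expn_gt0 ?g0//.
by rewrite divn_small ?addn0// hc.
Qed.

Lemma coarse_refine_partial e l x c y : (l <= e)%N -> bounded_cell e c ->
  (coarse (e - l) (refine e x c) == y) =
  (x == coarse l y) && (coarse (e - l) c == map_mx (fun v => v %% g ^ l)%N y).
Proof.
move=> le hc.
have gl : (0 < g ^ l)%N by rewrite expn_gt0 g0.
have gel : (0 < g ^ (e - l))%N by rewrite expn_gt0 g0.
have eE : (g ^ e = g ^ l * g ^ (e - l))%N by rewrite -expnD subnKC.
have cl i j : (c i j %/ g ^ (e - l) < g ^ l)%N by rewrite ltn_divLR// -eE hc.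
have rE i j : ((x i j * g ^ e + c i j) %/ g ^ (e - l) = x i j * g ^ l + c i j %/ g ^ (e - l))%N.
  by rewrite eE mulnA divnMDl.
apply/eqP/andP => [<-|[/eqP xE /eqP cE]].
  split; apply/eqP/matrixP => i j; rewrite !mxE rE.
    by rewrite divnMDl// divn_small ?addn0.
  by rewrite modnMDl modn_small.
apply/matrixP => i j; rewrite !mxE rE xE mxE.
by move/matrixP/(_ i j): cE; rewrite !mxE => ->; rewrite -divn_eq.
Qed.

Lemma cell_coarse l e x : cell (l + e) x `<=` cell l (coarse e x).
Proof.
move=> A hA i j; have /andP[h1 h2] := hA i j; rewrite mxE.
have gl : 0 < g%:R ^+ l :> R by rewrite exprn_gt0.
have ge : 0 < g%:R ^+ e :> R by rewrite exprn_gt0.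
have gE : g%:R ^+ e = (g ^ e)%:R :> R by rewrite natrX.
have ge' : (0 < g ^ e)%N by rewrite expn_gt0 g0.
move: h1 h2; rewrite exprD ler_pdivrMr ?mulr_gt0// => h1.
rewrite ler_pdivlMr ?mulr_gt0// => h2.
rewrite ler_pdivrMr// ler_pdivlMr//; apply/andP; split.
  rewrite -(ler_pM2r ge) -mulrA (le_trans _ h1)// gE -natrM ler_nat.
  exact: leq_divM.
rewrite -(ler_pM2r ge) -mulrA (le_trans h2)// gE -natrM ler_nat.
exact: ltn_ceil.
Qed.

Definition mass (s : seq wcell) (P : pred cellT) : R := \sum_(p <- s | P p.1) p.2.

Definition cells (s : seq wcell) : seq cellT := [seq p.1 | p <- s].

(** A probability vector on the cells of level [l] in the unit cube. A cell may be listed several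
    times; only [mass] matters. *)
Definition weights (l : nat) (s : seq wcell) :=
  [/\ forall p, p \in s -> 0 <= p.2, forall p, p \in s -> bounded_cell l p.1
    & mass s predT = 1].

Lemma mass_ge0 l s P : weights l s -> 0 <= mass s P.
Proof.
by move=> [h _ _]; rewrite /mass big_seq_cond; apply: sumr_ge0 => p /andP[/h].
Qed.

Lemma mass_le l s (P Q : pred cellT) : weights l s ->
  (forall x, x \in cells s -> P x -> Q x) -> mass s P <= mass s Q.
Proof.
move=> [h _ _] PQ; rewrite /mass big_mkcond [leRHS]big_mkcond/=.
rewrite big_seq [leRHS]big_seq; apply: ler_sum => p ps.
case: ifPn => [Pp|_]; last by case: ifP => // _; exact: h.
by rewrite (PQ p.1)//; apply: map_f.
Qed.

Lemma mass_union (I : finType) l s (P : pred cellT) (Q : I -> pred cellT) :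
  weights l s -> (forall x, x \in cells s -> P x -> exists i, Q i x) ->
  mass s P <= \sum_i mass s (Q i).
Proof.
move=> [h _ _] PQ; rewrite /mass big_mkcond/=.
under [leRHS]eq_bigr do rewrite big_mkcond/=.
rewrite exchange_big/= big_seq [leRHS]big_seq; apply: ler_sum => p ps.
have nn i : 0 <= (if Q i p.1 then p.2 else 0) by case: ifP => // _; exact: h.
case: ifPn => [Pp|_]; last by apply: sumr_ge0 => i _; exact: nn.
have [i Qi] := PQ p.1 (map_f _ ps) Pp.
rewrite (bigD1 i)//= Qi lerDl; apply: sumr_ge0 => k _; exact: nn.
Qed.

Lemma mass_le1 l s P : weights l s -> mass s P <= 1.
Proof. by move=> ws; have [_ _ <-] := ws; apply: (mass_le ws). Qed.

(** Every cell of [s] receives the same pattern [t]. Hence masses at coarse levels are unchanged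
    ([wprod_coarse]) and those at fine levels are products ([wprod_fine]). *)
Definition wprod (L : nat) (s t : seq wcell) : seq wcell :=
  [seq (refine L p.1 q.1, p.2 * q.2) | p <- s, q <- t].

Lemma mass_wprod L s t P :
  mass (wprod L s t) P =
  \sum_(p <- s) \sum_(q <- t) (if P (refine L p.1 q.1) then p.2 * q.2 else 0).
Proof.
by rewrite /mass /wprod big_mkcond/= big_allpairs_dep.
Qed.

Lemma wprod_coarse L lv l s t y : weights L t -> (l <= lv)%N ->
  mass (wprod L s t) (fun x => coarse (lv + L - l) x == y) =
  mass s (fun x => coarse (lv - l) x == y).
Proof.
move=> [_ hb h1] llv; rewrite mass_wprod /mass [RHS]big_mkcond/=.
apply: eq_bigr => p _; rewrite -[RHS]mulr1 -h1 /mass mulr_sumr.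
rewrite big_seq [RHS]big_seq; apply: eq_bigr => q qt.
have -> : (lv + L - l = (lv - l) + L)%N by lia.
rewrite -coarse_coarse coarse_refine; last exact: hb.
by case: ifP => _; rewrite ?mul0r.
Qed.

Lemma wprod_fine L l s t y : weights L t -> (l <= L)%N ->
  mass (wprod L s t) (fun x => coarse (L - l) x == y) =
  mass s (fun x => x == coarse l y) *
  mass t (fun x => coarse (L - l) x == map_mx (fun v => v %% g ^ l)%N y).
Proof.
move=> [_ hb h1] lL; rewrite mass_wprod /mass mulr_suml [RHS]big_mkcond/=.
apply: eq_bigr => p _; rewrite [in RHS]big_mkcond/= mulr_sumr.
rewrite big_seq.
have -> : (if p.1 == coarse l y then \sum_(q <- t)
     p.2 * (if coarse (L - l) q.1 == map_mx (fun v => v %% g ^ l)%N y then q.2 else 0) else 0) =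
   \sum_(q <- t) (if p.1 == coarse l y then 
     p.2 * (if coarse (L - l) q.1 == map_mx (fun v => v %% g ^ l)%N y then q.2 else 0) else 0).
  by case: ifP => // _; rewrite big1.
rewrite [RHS]big_seq; apply: eq_bigr => q qt.
rewrite coarse_refine_partial//; last exact: hb.
by case: (p.1 == _) => //=; case: (coarse (L - l) q.1 == _); rewrite ?mulr0.
Qed.

Lemma wprod_weights L lv s t : weights lv s -> weights L t ->
  weights (lv + L) (wprod L s t).
Proof.
move=> ws wt; have [s0 sb s1] := ws; have [t0 tb t1] := wt; split.
- move=> _ /allpairsP[[p q] [/= ps qt ->]]; by apply: mulr_ge0; [exact: s0|exact: t0].
- move=> _ /allpairsP[[p q] [/= ps qt ->]] i j; rewrite mxE.
  have := sb p ps i j; have := tb q qt i j; rewrite expnD.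
  move: (p.1 i j) (q.1 i j) (g ^ L)%N (g ^ lv)%N => x y G H yG xH.
  by apply: (@leq_trans (x.+1 * G)); [rewrite mulSn addnC ltn_add2r|rewrite leq_mul2r xH orbT].
- transitivity (mass s predT * mass t predT); last by rewrite s1 t1 mulr1.
  rewrite mass_wprod /mass mulr_suml.
  by apply: eq_bigr => p _; rewrite mulr_sumr.
Qed.

Lemma wprod_cells L s t x : x \in cells (wprod L s t) ->
  exists p q, [/\ p \in s, q \in t & x = refine L p.1 q.1].
Proof. by move=> /mapP[_ /allpairsP[[p q] [/= ps qt ->]] ->]; exists p, q. Qed.

Definition uniform (e : nat) : seq wcell :=
  [seq (map_mx val c, g%:R ^- (e * (m * n))) | c <- enum {: 'M['I_(g ^ e)]_(m, n)}].

Lemma mass_uniform e P : mass (uniform e) P =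
  #|[pred c : 'M['I_(g ^ e)]_(m, n) | P (map_mx val c)]|%:R * g%:R ^- (e * (m * n)).
Proof.
rewrite /mass /uniform big_map/= big_enum_cond/= sumr_const mulr_natl.
by congr (_ *+ _); apply: eq_card => c; rewrite !inE.
Qed.

Lemma uniform_weights e : weights e (uniform e).
Proof.
split.
- by move=> _ /mapP[c _ ->]; rewrite invr_ge0 exprn_ge0.
- by move=> _ /mapP[c _ ->] i j; rewrite mxE; exact: ltn_ord.
rewrite mass_uniform.
have -> : #|[pred c : 'M['I_(g ^ e)]_(m, n) | predT (map_mx val c)]| = (g ^ (e * (m * n)))%N.
  by rewrite expnM -[in RHS](card_ord (g ^ e)) -card_mx; apply: eq_card.
by rewrite natrX divff// expf_neq0// gt_eqF.
Qed.

Lemma uniform_mass e l y : (l <= e)%N ->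
  mass (uniform e) (fun x => coarse (e - l) x == y) <= g%:R ^- (l * (m * n)).
Proof.
move=> le; rewrite mass_uniform.
suff h : (#|[pred c : 'M['I_(g ^ e)]_(m, n) | coarse (e - l) (map_mx val c) == y]| <=
    g ^ ((e - l) * (m * n)))%N.
  rewrite -(@ler_nat R) natrX in h.
  rewrite ler_pdivrMr ?exprn_gt0//; apply: (le_trans h).
  rewrite ler_pdivlMl ?exprn_gt0// -exprD -mulnDl subnKC//.
have gel : (0 < g ^ (e - l))%N by rewrite expn_gt0 g0.
pose F (c : 'M['I_(g ^ e)]_(m, n)) : 'M['I_(g ^ (e - l))]_(m, n) :=
  \matrix_(i, j) Ordinal (ltn_pmod (c i j) gel).
rewrite -(card_in_image (f := F)).
  by rewrite (leq_trans (max_card _))// card_mx card_ord -expnM.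
move=> c c'; rewrite !inE => /eqP cy /eqP c'y /matrixP Fcc.
apply/matrixP => i j; apply: val_inj => /=.
rewrite (divn_eq (c i j) (g ^ (e - l))) (divn_eq (c' i j) (g ^ (e - l))).
have := Fcc i j; rewrite !mxE => /(congr1 val)/= ->.
by move/matrixP/(_ i j): cy; move/matrixP/(_ i j): c'y; rewrite !mxE => -> ->.
Qed.

End Cells.

(** * Cantor stages *)

Section Cantor.
Context {R : realType} {m n : nat}.
Variables (g : nat) (f : R -> R) (good : R -> set 'M[R]_(m, n)).
Hypotheses (g2 : (1 < g)%N) (hf : dimension_function f)
  (fu : dim_upper f (m * n))
  (f_lim : f r / r ^+ (m * n) @[r --> 0^'+] --> +oo).
Local Notation cellT := 'M[nat]_(m, n).
Local Notation wcell := ('M[nat]_(m, n) * R)%type.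
Local Notation d := (m * n)%N.
Local Notation G l := (g%:R ^- l : R).

Let g0 : (0 < g)%N. Proof. exact: ltnW. Qed.
Let gR0 : 0 < g%:R :> R. Proof. by rewrite ltr0n. Qed.
Let gR1 : 1 < g%:R :> R. Proof. by rewrite ltr1n. Qed.
Let G0 l : 0 < G l. Proof. by rewrite invr_gt0 exprn_gt0. Qed.
Let f0 x : 0 <= x -> 0 <= f x. Proof. by have [_ _ + _] := hf; apply. Qed.

Lemma GD a b : G (a + b) = G a * G b.
Proof. by rewrite exprD invfM. Qed.

Lemma G_le a b : (a <= b)%N -> G b <= G a.
Proof.
by move=> ab; rewrite lef_pV2 ?posrE ?exprn_gt0// ler_eXn2l.
Qed.

Lemma G_small (e : R) : 0 < e -> exists k, G k <= e.
Proof.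
move=> e0; have L : (g%:R^-1 : R) ^+ k @[k --> \oo] --> (0 : R).
  by apply: cvg_expr; rewrite ger0_norm ?invr_ge0// invf_lt1.
move/cvgrPdist_lt: L => /(_ _ e0)[k _ /(_ k (leqnn k))].
by rewrite sub0r normrN exprVn gtr0_norm// => /ltW; exists k.
Qed.

Lemma f_slack (K : R) : exists k0, forall k, (k0 <= k)%N -> K * G k ^+ d <= f (G k).
Proof.
move/cvgryPge: f_lim => /(_ K); rewrite near_withinE => /nbhs_ballP[e /= e0 h].
have [k0 hk0] := G_small (divr_gt0 e0 (ltr0n R 2)); exists k0 => k kk.
have := h (G k); rewrite /ball/= sub0r normrN gtr0_norm// => /(_ _ (G0 k)).
rewrite ler_pdivlMr ?exprn_gt0//; apply.
by apply: le_lt_trans (G_le kk) _; apply: le_lt_trans hk0 _; lra.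
Qed.

(** The first term is the share of a uniform distribution, the second a Frostman bound at the
    absolute scale [lv + l] with an arbitrarily large [K]. It is essential that [C] does not depend
    on [lv], [K] or [T]. *)
Definition pattern_supply (C : R) := forall (lv : nat) (K T : R), 0 < K ->
  exists (L : nat) (t : seq wcell), [/\ weights g L t,
    forall l y, (l <= L)%N ->
      mass t (fun x => coarse g (L - l) x == y) <= C * (G l ^+ d + f (G (lv + l)) / K)
  & forall c x, c \in cells t -> cell g (lv + L) (refine g L x c) `<=` good T].

(** A Frostman condition with constant [1 / M]. Since the total mass is 1 it can hold only from a
    level [l0] on, and [l0] must stay fixed along all stages. *)
Definition regular (M : R) (l0 lv : nat) (s : seq wcell) :=
  forall l y, (l0 <= l <= lv)%N ->
    mass s (fun x => coarse g (lv - l) x == y) <= f (G l) / M.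

Lemma regular_wprod M l0 lv L s t : (l0 <= lv)%N ->
  weights g lv s -> weights g L t -> regular M l0 lv s ->
  (forall l x y, (l <= L)%N ->
    mass s (fun z => z == x) * mass t (fun z => coarse g (L - l) z == y)
    <= f (G (lv + l)) / M) ->
  regular M l0 (lv + L) (wprod g L s t).
Proof.
move=> l0lv ws wt rs h l y /andP[l0l llL].
have [llv|lvl] := leqP l lv.
  by rewrite wprod_coarse//; apply: rs; rewrite l0l.
have lE : l = (lv + (l - lv))%N by lia.
have -> : (lv + L - l = L - (l - lv))%N by lia.
rewrite wprod_fine//; last by lia.
by rewrite [X in f (g%:R ^- X)]lE; apply: h; lia.
Qed.

Definition stage (M : R) (l0 : nat) (ls : nat * seq wcell) :=
  [/\ (l0 <= ls.1)%N, weights g ls.1 ls.2 & regular M l0 ls.1 ls.2].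

Lemma f_coarse l e : f (G l) * G e ^+ d <= f (G (l + e)).
Proof.
have := fu (G0 (l + e)) (G_le (leq_addr e l)).
set F := f (G (l + e)); rewrite GD exprMn mulrCA [F * _]mulrC.
by rewrite ler_pM2l ?exprn_gt0.
Qed.

Lemma mass_point M l0 lv s x : stage M l0 (lv, s) ->
  mass s (fun z => z == x) <= f (G lv) / M.
Proof.
move=> [/= l0lv ws rs]; have := rs lv x; rewrite l0lv leqnn subnn => /(_ isT).
by under eq_fun do rewrite coarse0.
Qed.

(** Uniform subdivision divides the mass by the volume ratio, and the bound [f (G l)] decreases no
    faster because [f] is dominated by the power [mn]. *)
Lemma stage_refine M l0 lv s e : 0 < M -> stage M l0 (lv, s) ->
  stage M l0 ((lv + e)%N, wprod g e s (uniform g e)).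
Proof.
move=> M0 st; have [/= l0lv ws rs] := st; split => /=; first by lia.
  by apply: wprod_weights => //; exact: uniform_weights.
apply: regular_wprod => //; first exact: uniform_weights.
move=> l x y le.
apply: (@le_trans _ _ (f (G lv) / M * G l ^+ d)).
  apply: ler_pM; [exact: mass_ge0 ws|exact: mass_ge0 (uniform_weights g2 e)|exact: mass_point st|].
  apply: le_trans (uniform_mass _ _ _) _ => //.
  by rewrite -exprVn exprM exprVn.
by rewrite mulrAC ler_pM2r ?invr_gt0// f_coarse.
Qed.

Lemma stage_next M C l0 lv s T : 0 < M -> 1 <= C -> pattern_supply C ->
  stage M l0 (lv, s) -> exists lv' s', [/\ (lv < lv')%N, stage M l0 (lv', s'),
    forall x, x \in cells s' -> coarse g (lv' - lv) x \in cells s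
  & forall x, x \in cells s' -> cell g lv' x `<=` good T].
Proof.
move=> M0 C1 ps st; have [/= l0lv ws rs] := st.
have C0 : 0 < C by exact: lt_le_trans C1.
(* After [e] levels of uniform refinement each cell has mass at most [G e ^+ d], whereas its volume
   is smaller by a further [G lv ^+ d]; the factor [g ^ (lv * d)] makes up for it. The uniform term
   of the pattern then uses at most half of [f / M], and the choice [K = 2 * M * C] leaves its other
   term at most the other half. *)
have [e0 he0] := f_slack (2 * M * C * g%:R ^+ (lv * d)).
pose e := e0.+1; have := stage_refine e M0 st.
set s1 := wprod g e s _ => st1; have [/= l0lv1 ws1 rs1] := st1.
have s1p x : mass s1 (fun z => z == x) <= G e ^+ d.
  have := wprod_fine g2 s x (uniform_weights g2 e) (leqnn e).
  rewrite subnn; under eq_fun do rewrite coarse0.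
  move=> ->; apply: (@le_trans _ _ (1 * G e ^+ d)); last by rewrite mul1r.
  apply: ler_pM; [exact: mass_ge0 ws|exact: mass_ge0 (uniform_weights g2 e)|exact: mass_le1 ws|].
  have E := uniform_mass (R := R) g2 (map_mx (fun v => v %% g ^ e)%N x) (leqnn e).
  rewrite subnn in E; apply: le_trans E _.
  by rewrite -exprVn exprM exprVn.
have K0 : 0 < 2 * M * C by rewrite !mulr_gt0.
have [L [t [wt ht tgood]]] := ps (lv + e)%N (2 * M * C) T K0.
exists (lv + e + L)%N, (wprod g L s1 t); split.
- by rewrite /e; lia.
- split => /=; [by lia|by apply: wprod_weights|].
  apply: regular_wprod => // l x y lL.
  have fl0 : 0 <= f (G (lv + e + l)) by rewrite f0// ltW.
  apply: (@le_trans _ _ (G e ^+ d * (C * (G l ^+ d + f (G (lv + e + l)) / (2 * M * C))))).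
    by apply: ler_pM; [exact: mass_ge0 ws1|exact: mass_ge0 wt|exact: s1p|exact: ht].
  have h1 : G e ^+ d * (C * G l ^+ d) <= f (G (lv + e + l)) / (2 * M).
    have := he0 (lv + e + l)%N; rewrite /e => /(_ _).
    have -> : (e0 <= lv + e0.+1 + l)%N by lia.
    move=> /(_ isT) h; rewrite ler_pdivlMr ?mulr_gt0//; apply: le_trans h.
    rewrite -/e !GD !exprMn.
    have -> : G lv ^+ d = g%:R ^- (lv * d) by rewrite -exprVn -exprM exprVn.
    apply: ler_eq; field; rewrite ?expf_neq0 ?gt_eqF//.
  have h2 : G e ^+ d * (C * (f (G (lv + e + l)) / (2 * M * C))) <= f (G (lv + e + l)) / (2 * M).
    have -> : C * (f (G (lv + e + l)) / (2 * M * C)) = f (G (lv + e + l)) / (2 * M).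
      by field; rewrite !gt_eqF.
    rewrite ler_piMl ?divr_ge0 ?mulr_ge0 ?(ltW M0)// exprn_ile1 ?(ltW (G0 _))//.
    by rewrite invf_le1 ?exprn_gt0// exprn_ege1// ltW.
  have -> : f (G (lv + e + l)) / M = f (G (lv + e + l)) / (2 * M) + f (G (lv + e + l)) / (2 * M).
    by field; rewrite gt_eqF.
  by rewrite !mulrDr lerD.
- move=> x /wprod_cells[p [q [ps1 qt ->]]].
  have -> : (lv + e + L - lv = e + L)%N by lia.
  rewrite -coarse_coarse coarse_refine//; last by have [_ + _] := wt; apply.
  have : p.1 \in cells s1 by apply: map_f.
  move=> /wprod_cells[p' [q' [ps' qt' ->]]].
  rewrite coarse_refine//; first exact: map_f.
  by have [_ + _] := uniform_weights (R := R) (m := m) (n := n) g2 e; apply.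
- move=> x /wprod_cells[p [q [ps1 qt ->]]].
  by apply: tgood; apply: map_f.
Qed.

Lemma stage0 M : 0 < M -> exists l0 s, stage M l0 (l0, s).
Proof.
move=> M0; have [l0 h] := f_slack M; exists l0, (uniform g l0); split => //=.
  exact: uniform_weights.
move=> l y; rewrite -eqn_leq => /eqP <-.
apply: le_trans (uniform_mass _ _ _) _ => //.
rewrite ler_pdivlMr// mulrC; apply: le_trans (h l0 (leqnn _)).
by rewrite -exprVn exprM exprVn.
Qed.

Lemma stage_sequence M C : 0 < M -> 1 <= C -> pattern_supply C ->
  exists (l0 : nat) (lv : nat -> nat) (s : nat -> seq wcell), [/\
    forall k, stage M l0 (lv k, s k), forall k, (lv k < lv k.+1)%N,
    forall k x, x \in cells (s k.+1) -> coarse g (lv k.+1 - lv k) x \in cells (s k)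
  & forall k x, x \in cells (s k.+1) -> cell g (lv k.+1) x `<=` good k%:R].
Proof.
move=> M0 C1 ps; have [l0 [s0 st0]] := stage0 M0.
pose ST := {ls : nat * seq wcell | stage M l0 ls}.
have nxt (k : nat) (S : ST) : {S' : ST | [/\ ((sval S).1 < (sval S').1)%N,
    forall x, x \in cells (sval S').2 ->
      coarse g ((sval S').1 - (sval S).1) x \in cells (sval S).2
  & forall x, x \in cells (sval S').2 -> cell g (sval S').1 x `<=` good k%:R]}.
  apply: cid; case: S => -[lv s] st /=.
  have [lv' [s' [h1 h2 h3 h4]]] := stage_next k%:R M0 C1 ps st.
  by exists (exist _ (lv', s') h2).
pose S := fix S k : ST := if k is k'.+1 then sval (nxt k' (S k')) else exist _ (l0, s0) st0.
exists l0, (fun k => (sval (S k)).1), (fun k => (sval (S k)).2); split.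
- by move=> k; have := svalP (S k); case: (sval (S k)).
- by move=> k; have [] := svalP (nxt k (S k)).
- by move=> k; have [] := svalP (nxt k (S k)).
- by move=> k; have [] := svalP (nxt k (S k)).
Qed.

End Cantor.

(** * Content of the Cantor set *)

Lemma int_window (v : int) (z : nat) :
  (v < z%:Z + 1)%R -> (z%:Z < v + 2)%R -> (v <= z%:Z <= v + 1)%R.
Proof. lia. Qed.

Lemma int_window_offset (v : int) (z : nat) : (v <= z%:Z <= v + 1)%R ->
  (absz (z%:Z - v)%R < 2)%N /\ z = absz (v + (absz (z%:Z - v)%R)%:Z)%R.
Proof. lia. Qed.

Section CantorContent.
Context {R : realType} {m n : nat}.
Variables (g : nat) (f : R -> R) (M : R) (l0 : nat) (lv : nat -> nat)
  (s : nat -> seq ('M[nat]_(m, n) * R)).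
Hypotheses (g2 : (1 < g)%N) (hf : dimension_function f)
  (fu : dim_upper f (m * n)) (M0 : 0 < M)
  (st : forall k, stage g f M l0 (lv k, s k))
  (lvS : forall k, (lv k < lv k.+1)%N)
  (nest : forall k x, x \in cells (s k.+1) ->
     coarse g (lv k.+1 - lv k) x \in cells (s k)).
Local Notation cellT := 'M[nat]_(m, n).
Local Notation d := (m * n)%N.
Local Notation G l := (g%:R ^- l : R).

Let g0 : (0 < g)%N. Proof. exact: ltnW. Qed.
Let gR0 : 0 < g%:R :> R. Proof. by rewrite ltr0n. Qed.
Let gR1 : 1 < g%:R :> R. Proof. by rewrite ltr1n. Qed.
Let G0 l : 0 < G l. Proof. by rewrite invr_gt0 exprn_gt0. Qed.
Let f0 x : 0 <= x -> 0 <= f x. Proof. by have [_ _ + _] := hf; apply. Qed.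

Definition cantor_set : set 'M[R]_(m, n) :=
  [set A | forall k, exists2 x, x \in cells (s k) & cell g (lv k) x A].

Lemma lv_mono k k' : (k <= k')%N -> (lv k <= lv k')%N.
Proof.
elim: k' => [|k' IH]; first by rewrite leqn0 => /eqP ->.
rewrite leq_eqVlt => /predU1P[->//|]; rewrite ltnS => /IH h.
exact: leq_trans h (ltnW (lvS _)).
Qed.

Lemma lv_ge k : (k <= lv k)%N.
Proof. by elim: k => // k IH; exact: leq_ltn_trans IH (lvS k). Qed.

Lemma nest_le k k' x : (k <= k')%N -> x \in cells (s k') ->
  coarse g (lv k' - lv k) x \in cells (s k).
Proof.
elim: k' x => [|k' IH] x.
  by rewrite leqn0 => /eqP ->; rewrite subnn coarse0.
rewrite leq_eqVlt => /predU1P[->|]; first by rewrite subnn coarse0.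
rewrite ltnS => kk /nest /(IH _ kk); rewrite coarse_coarse.
by have -> : (lv k' - lv k + (lv k'.+1 - lv k') = lv k'.+1 - lv k)%N
  by have := lv_mono kk; have := lvS k'; lia.
Qed.

(** The least [l >= l0] with [G l.+1 < r] gives [G l < g * r]; the lost factor [g] costs [g ^+ d] in
    [f]. *)
Lemma scale_level (r : R) : 0 < r -> r <= G l0 ->
  exists2 l, (l0 <= l)%N & r <= G l /\ f (G l) <= g%:R ^+ d * f r.
Proof.
move=> r0 rl0; have [k hk] := G_small (R := R) g2 r0.
have ex : exists l, (l0 <= l)%N && (G l.+1 < r).
  exists (maxn l0 k); rewrite leq_maxl/=; apply: lt_le_trans hk.
  rewrite ltf_pV2 ?posrE ?exprn_gt0// ltr_eXn2l//; lia.
case: (ex_minnP ex) => l /andP[l0l rl] lmin.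
exists l => //; split.
  have [ll|ll] := leqP l l0; first by have -> : l = l0 by lia.
  rewrite leNgt; apply/negP => h.
  have := lmin l.-1; rewrite prednK; last by lia.
  by rewrite h andbT => /(_ _); lia.
apply: (@le_trans _ _ (f (g%:R * r))); last first.
  by apply: dim_upper_scale => //; exact: ltW.
have [_ fm _ _] := hf; apply: fm; first exact: ltW.
by move: rl; rewrite exprS invfM ltr_pdivrMl// => /ltW.
Qed.

(* An open interval of length at most the side of a cell meets at most two of
   the consecutive closed cells. *)
Lemma mass_ball k (c : 'M[R]_(m, n)) (r : R) (l : nat) :
  (l0 <= l <= lv k)%N -> 0 < r -> 2 * r <= G l ->
  mass (s k) (fun x => `[< exists A, cell g (lv k) x A /\ ball c r A >])
  <= 2 ^+ d * (f (G l) / M).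
Proof.
move=> /andP[l0l llv] r0 rl; have [_ ws rs] := st k.
pose v i j := Num.floor ((c i j - r) * g%:R ^+ l).
pose y (o : {ffun 'I_m * 'I_n -> 'I_2}) : cellT :=
  \matrix_(i, j) absz (v i j + (o (i, j) : nat)%:Z).
apply: (@le_trans _ _ (\sum_o mass (s k) (fun x => coarse g (lv k - l) x == y o))).
  apply: (mass_union ws) => x xs /asboolP[A [xA [_ cA]]].
  have gl : 0 < g%:R ^+ l :> R by rewrite exprn_gt0.
  have cx : cell g l (coarse g (lv k - l) x) A.
    by apply: cell_coarse => //; rewrite subnKC.
  set z := coarse g (lv k - l) x in cx *.
  have bnd i j : (v i j <= (z i j)%:Z <= v i j + 1)%R.
    have /andP[h1 h2] := cx i j; have := cA i j; rewrite /ball/= => h3.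
    have /andP[f1 f2] := floor_itv ((c i j - r) * g%:R ^+ l); rewrite -/(v i j) in f1 f2.
    move: h1 h2; rewrite ler_pdivrMr// ler_pdivlMr// -natr1 => h1 h2.
    have rg : 2 * r * g%:R ^+ l <= 1 by rewrite -ler_pdivlMr// mul1r.
    move: h3; rewrite ltr_norml => /andP[h3 h4].
    have a1 : (c i j - r) * g%:R ^+ l < A i j * g%:R ^+ l by rewrite ltr_pM2r//; lra.
    have a2 : A i j * g%:R ^+ l < (c i j + r) * g%:R ^+ l by rewrite ltr_pM2r//; lra.
    rewrite intrD in f2.
    have b1 : (v i j)%:~R < ((z i j)%:Z + 1)%:~R :> R.
      by rewrite intrD -[((z i j)%:Z)%:~R]/((z i j)%:R); lra.
    have b2 : ((z i j)%:Z)%:~R < (v i j + 2)%:~R :> R.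
      rewrite intrD -[((z i j)%:Z)%:~R]/((z i j)%:R).
      have : (c i j + r) * g%:R ^+ l = (c i j - r) * g%:R ^+ l + 2 * r * g%:R ^+ l by ring.
      by move=> E; rewrite -[2%:~R]/(2 : R); lra.
    by move: b1 b2; rewrite !ltr_int; exact: int_window.
  exists [ffun ij => inord (absz ((z ij.1 ij.2)%:Z - v ij.1 ij.2))].
  apply/eqP/matrixP => i j; have [w1 w2] := int_window_offset (bnd i j).
  by rewrite [RHS]mxE ffunE inordK.
apply: (@le_trans _ _ (\sum_(o : {ffun 'I_m * 'I_n -> 'I_2}) f (G l) / M)).
  by apply: ler_sum => o _; apply: rs; rewrite l0l.
by rewrite sumr_const card_ffun card_ord card_prod !card_ord -[leLHS]mulr_natl natrX.
Qed.

Section Cover.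
Variables (c : nat -> 'M[R]_(m, n)) (r : nat -> R).
Hypotheses (r0 : forall i, 0 < r i) (rl0 : forall i, 2 * r i <= G l0)
  (small : forall j, \sum_(i < j) f (2 * r i) < M / (2 ^+ d * g%:R ^+ d)).

Let U j : set 'M[R]_(m, n) := [set A | exists2 i, (i < j)%N & ball (c i) (r i) A].

(** Finitely many cheap balls meet cells of total mass below 1, as soon as the stage is finer than
    all the levels attached to these balls. *)
Lemma finite_cover_fails j : exists k0, forall k, (k0 <= k)%N ->
  exists2 x, x \in cells (s k) & forall A, cell g (lv k) x A -> ~ U j A.
Proof.
have lev i : {l | (l0 <= l)%N & 2 * r i <= G l /\ f (G l) <= g%:R ^+ d * f (2 * r i)}.
  by apply: cid2; apply: scale_level => //; rewrite mulr_gt0.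
exists (\max_(i < j) s2val (lev i)) => k kk.
apply: contrapT => h; have [_ ws rs] := st k.
have : mass (s k) predT <= \sum_(i < j) (2 ^+ d * (f (G (s2val (lev i))) / M)).
  apply: (@le_trans _ _ (\sum_(i < j) mass (s k)
     (fun x => `[< exists A, cell g (lv k) x A /\ ball (c i) (r i) A >]))).
    apply: (mass_union ws) => x xs _; apply: contrapT => h2; apply: h.
    exists x => // A xA [i ij Ai]; apply: h2; exists (Ordinal ij).
    by apply/asboolP; exists A.
  apply: ler_sum => i _; apply: mass_ball => //.
    rewrite (s2valP (lev i))/=; apply: leq_trans (lv_ge k).
    by apply: leq_trans kk; exact: (leq_bigmax i).
  by have [] := s2valP' (lev i).
have [_ _ ->] := ws; apply/negP; rewrite -ltNge.
apply: (@le_lt_trans _ _ (\sum_(i < j) (2 ^+ d * g%:R ^+ d / M * f (2 * r i)))).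
  apply: ler_sum => i _; have [_ h2] := s2valP' (lev i).
  have p0 : 0 < 2 ^+ d / M :> R by rewrite divr_gt0// exprn_gt0.
  have h3 := ler_wpM2l (ltW p0) h2.
  have -> : 2 ^+ d * (f (G (s2val (lev i))) / M) = 2 ^+ d / M * f (G (s2val (lev i))) by ring.
  by rewrite (_ : 2 ^+ d * g%:R ^+ d / M * _ = 2 ^+ d / M * (g%:R ^+ d * f (2 * r i))) //; ring.
rewrite -mulr_sumr -ltr_pdivlMl; last by rewrite divr_gt0// mulr_gt0// exprn_gt0.
by rewrite mulr1 invfM invrK mulrC.
Qed.

(** A branch argument of Koenig type replaces compactness: a cell is alive if, for every [N], some
    descendant of level index at least [N] avoids the first [N] balls. *)
Let alive k x := forall N, exists k' y, [/\ (k <= k')%N, (N <= k')%N, y \in cells (s k'),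
  coarse g (lv k' - lv k) y = x & forall A, cell g (lv k') y A -> ~ U N A].

Let U_mono j j' : (j <= j')%N -> U j `<=` U j'.
Proof. by move=> jj A [i ij Ai]; exists i => //; exact: leq_trans jj. Qed.

Lemma alive_in k x : alive k x -> x \in cells (s k).
Proof. by move=> /(_ 0%N)[k' [y [kk _ yk <- _]]]; exact: nest_le. Qed.

(** Each stage has finitely many cells. If none with [P] were alive, the maximum of their failing
    thresholds would contradict the hypothesis. *)
Lemma alive_pick k (P : pred cellT) :
  (forall N, exists k' y, [/\ (k <= k')%N, (N <= k')%N, y \in cells (s k'),
     P (coarse g (lv k' - lv k) y) & forall A, cell g (lv k') y A -> ~ U N A]) ->
  exists2 x, P x & alive k x.
Proof.
move=> h; apply: contrapT => nex.
have bad x : {N | P x -> ~ exists k' y, [/\ (k <= k')%N, (N <= k')%N, y \in cells (s k'),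
     coarse g (lv k' - lv k) y = x & forall A, cell g (lv k') y A -> ~ U N A]}.
  apply: cid; have [Px|nPx] := boolP (P x); last by exists 0%N.
  by apply: contrapT => /forallNP hx; apply: nex; exists x => // N; apply: contrapT => h2;
     apply: (hx N) => _.
pose N := \max_(x <- cells (s k)) sval (bad x).
have [k' [y [kk Nk yk Py yU]]] := h N.
have xs := nest_le kk yk; set x := coarse g _ y in Py xs.
have Nx : (sval (bad x) <= N)%N by rewrite /N (leq_bigmax_seq x).
apply: (svalP (bad x) Py); exists k', y; split => //.
  exact: leq_trans Nk.
by move=> A /yU UA /(U_mono Nx).
Qed.

Lemma alive_root : exists x, alive 0 x.
Proof.
have [|x _ ax] := @alive_pick 0 predT; last by exists x.
move=> N; have [k0 hk0] := finite_cover_fails N.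
have [y ys yU] := hk0 (maxn k0 N) (leq_maxl _ _).
by exists (maxn k0 N), y; split => //; exact: leq_maxr.
Qed.

Lemma alive_child k x : alive k x ->
  exists2 y, coarse g (lv k.+1 - lv k) y = x & alive k.+1 y.
Proof.
move=> ax.
have [|y /eqP yx ay] := @alive_pick k.+1 (fun y => coarse g (lv k.+1 - lv k) y == x);
  last by exists y.
move=> N; have [k' [y [kk Nk yk yx yU]]] := ax (maxn N k.+1).
exists k', y; split => //.
- exact: leq_trans (leq_maxr _ _) Nk.
- exact: leq_trans (leq_maxl _ _) Nk.
- rewrite coarse_coarse -yx; apply/eqP; congr coarse.
  have kk' : (k.+1 <= k')%N := leq_trans (leq_maxr _ _) Nk.
  by have := lv_mono kk'; have := lvS k; lia.
- by move=> A /yU UA /(U_mono (leq_maxl N k.+1)).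
Qed.

Lemma uncovered_point : exists2 A, cantor_set A & forall i, ~ ball (c i) (r i) A.
Proof.
pose ST k := {x | alive k x}.
pose x0 : ST 0%N := cid alive_root.
pose nx k (x : ST k) : ST k.+1 :=
  let y := cid2 (alive_child (svalP x)) in exist _ (s2val y) (s2valP' y).
pose X := fix X k : ST k := if k is k'.+1 then nx k' (X k') else x0.
pose x k := sval (X k).
have xa k : alive k (x k) := svalP (X k).
have xS k : coarse g (lv k.+1 - lv k) (x k.+1) = x k.
  exact: (s2valP (cid2 (alive_child (svalP (X k))))).
have xle k k' : (k <= k')%N -> coarse g (lv k' - lv k) (x k') = x k.
  elim: k' => [|k' IH]; first by rewrite leqn0 => /eqP ->; rewrite subnn coarse0.
  rewrite leq_eqVlt => /predU1P[->|]; first by rewrite subnn coarse0.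
  rewrite ltnS => kk; rewrite -(IH kk) -(xS k') coarse_coarse; congr coarse.
  by have := lv_mono kk; have := lvS k'; lia.
pose lo k : 'M[R]_(m, n) := \matrix_(i, j) ((x k i j)%:R / g%:R ^+ lv k).
have locell k : cell g (lv k) (x k) (lo k).
  move=> i j; rewrite mxE lexx/= ler_pM2r ?invr_gt0 ?exprn_gt0// ler_nat; exact: leqnSn.
have nestcell k k' : (k <= k')%N ->
    cell (R := R) g (lv k') (x k') `<=` cell g (lv k) (x k).
  move=> kk A h; rewrite -(xle _ _ kk); apply: cell_coarse => //.
  by rewrite subnKC// lv_mono.
pose S i j := range (fun k => lo k i j).
have Sub i j k : ubound (S i j) ((x k i j).+1%:R / g%:R ^+ lv k).
  move=> _ [k' _ <-]; have [kk|kk] := leqP k k'.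
    by have /andP[] := nestcell k k' kk (lo k') (locell k') i j.
  have /andP[+ _] := nestcell k' k (ltnW kk) (lo k) (locell k) i j.
  rewrite !mxE => h; apply: le_trans h _.
  by rewrite ler_pM2r ?invr_gt0 ?exprn_gt0// ler_nat leqnSn.
pose A : 'M[R]_(m, n) := \matrix_(i, j) sup (S i j).
have Acell k : cell g (lv k) (x k) A.
  move=> i j; rewrite mxE; apply/andP; split.
    apply: ub_le_sup; first by exists ((x 0%N i j).+1%:R / g%:R ^+ lv 0%N); exact: Sub.
    by exists k => //; rewrite mxE.
  by apply: ge_sup; [exists (lo 0%N i j), 0%N|exact: Sub].
exists A => [k|i [_ Ai]]; first by exists (x k) => //; exact: alive_in.
(* The ball is open and there are finitely many coordinates, so [A] has a positive margin [r i - e].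
   A cell of the branch with side at most half the margin lies inside the ball, although it has a
   descendant avoiding that ball. *)
pose e := \big[Order.max/0]_(ij : 'I_m * 'I_n) `|c i ij.1 ij.2 - A ij.1 ij.2|.
have er : e < r i by apply: bigmax_lt => // -[i' j'] _; exact: Ai.
have [k hk] : exists k, G k <= (r i - e) / 2.
  by apply: G_small => //; rewrite divr_gt0// subr_gt0.
have [k' [y [kk Nk yk yx yU]]] := xa k i.+1.
pose B : 'M[R]_(m, n) := \matrix_(i, j) ((y i j)%:R / g%:R ^+ lv k').
have yB : cell g (lv k') y B.
  move=> i' j'; rewrite mxE lexx/= ler_pM2r ?invr_gt0 ?exprn_gt0// ler_nat; exact: leqnSn.
apply: (yU B yB); exists i => //; split => // i' j'.
have Bx : cell g (lv k) (x k) B.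
  by rewrite -yx; apply: cell_coarse => //; rewrite subnKC// lv_mono.
have /andP[b1 b2] := Bx i' j'; have /andP[a1 a2] := Acell k i' j'.
have gk : G (lv k) <= (r i - e) / 2.
  apply: le_trans hk; exact: G_le (lv_ge k).
have ce : `|c i i' j' - A i' j'| <= e.
  exact: (@le_bigmax _ _ _ 0 (fun ij : 'I_m * 'I_n => `|c i ij.1 ij.2 - A ij.1 ij.2|) (i', j')).
have AB : `|A i' j' - B i' j'| <= G (lv k).
  have E : (x k i' j').+1%:R / g%:R ^+ lv k = (x k i' j')%:R / g%:R ^+ lv k + G (lv k).
    by rewrite -natr1 mulrDl mul1r.
  by rewrite E in a2 b2; rewrite ler_norml; lra.
rewrite /ball/=.
have -> : c i i' j' - B i' j' = (c i i' j' - A i' j') + (A i' j' - B i' j') by ring.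
apply: le_lt_trans (ler_normD _ _) _; lra.
Qed.

End Cover.

(** The factor [2 ^+ d] counts the cells met by a ball, [g ^+ d] comes from rounding its diameter to
    a level. *)
Lemma cantor_content (eta : R) : eta <= G l0 ->
  ((M / (2 ^+ d * g%:R ^+ d))%:E <= hausdorff_content f cantor_set eta)%E.
Proof.
move=> etal; apply: le_ereal_inf_tmp => _ [c [r [hr hE ->]]].
rewrite leNgt; apply/negP => lt.
have [|||A EA nA] := @uncovered_point c r.
- by move=> i; have [] := hr i.
- by move=> i; have [_ h] := hr i; exact: le_trans etal.
- move=> j; rewrite -lte_fin; apply: le_lt_trans lt.
  rewrite -sumEFin -(big_mkord xpredT (fun i => (f (2 * r i))%:E)).
  apply: nneseries_lim_ge => k _; rewrite lee_fin f0// mulr_ge0//.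
  by have [/ltW] := hr k.
by have [i _ Ai] := hE A EA; exact: (nA i).
Qed.

End CantorContent.

(** * Transporting mass to the coarsest valid cell *)

Lemma wrap_div (P Q : nat) (a : int) : (0 < P)%N -> (0 < Q)%N ->
  (absz (a %% (Q * P)%N%:Z)%Z %/ P = absz ((a %/ P%:Z)%Z %% Q%:Z)%Z)%N.
Proof.
move=> P0 Q0.
have Pz : (0 < P%:Z)%R by rewrite ltz_nat.
have Qz : (0 < Q%:Z)%R by rewrite ltz_nat.
pose q := (a %/ P%:Z)%Z; pose r := (a %% P%:Z)%Z.
pose q1 := (q %/ Q%:Z)%Z; pose q2 := (q %% Q%:Z)%Z.
have r0 : (0 <= r < P%:Z)%R by rewrite modz_ge0 ?ltz_pmod// gt_eqF.
have q20 : (0 <= q2 < Q%:Z)%R by rewrite modz_ge0 ?ltz_pmod// gt_eqF.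
have aE : (a = q1 * (Q * P)%N%:Z + (q2 * P%:Z + r))%R.
  rewrite [LHS](divz_eq a P%:Z) -/q -/r [X in (X * _ + _)%R](divz_eq q Q%:Z) -/q1 -/q2.
  by rewrite PoszM; ring.
have b0 : (0 <= q2 * P%:Z + r < (Q * P)%N%:Z)%R.
  rewrite PoszM; move: r0 q20 => /andP[h1 h2] /andP[h3 h4]; apply/andP; split; nia.
have -> : (a %% (Q * P)%N%:Z)%Z = (q2 * P%:Z + r)%R.
  by rewrite {1}aE modzMDl modz_small.
have -> : absz (q2 * P%:Z + r)%R = (absz q2 * P + absz r)%N.
  by move: r0 q20 => /andP[h1 h2] /andP[h3 h4]; nia.
rewrite divnMDl// divn_small ?addn0//; lia.
Qed.

Lemma cell_offset (P Q O z z1 : nat) (e k : int) : (0 < P)%N -> (0 < Q)%N ->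
  (z1 < Q * P)%N -> (`|e| <= (O * P)%N%:Z)%R ->
  (z1%:Z = z%:Z + e + k * (Q * P)%N%:Z)%R ->
  exists o w : nat, [/\ (o < (2 * O).+1)%N, (w < Q * P)%N, (w %/ P = z1 %/ P)%N &
    exists k' : int, (w%:Z = z%:Z + (o%:Z - O%:Z) * P%:Z + k' * (Q * P)%N%:Z)%R].
Proof.
move=> P0 Q0 z1b he hz1.
have Pz : (0 < P%:Z)%R by rewrite ltz_nat.
have QPz : (0 < (Q * P)%N%:Z)%R by rewrite ltz_nat muln_gt0 P0 Q0.
pose q1 := ((z%:Z + e) %/ P%:Z)%Z; pose q := (z%:Z %/ P%:Z)%Z.
have zeE := divz_eq (z%:Z + e) P%:Z; have zE := divz_eq z%:Z P%:Z.
have r0 : (0 <= (z%:Z %% P%:Z)%Z < P%:Z)%R by rewrite modz_ge0 ?ltz_pmod// gt_eqF.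
have r1 : (0 <= ((z%:Z + e) %% P%:Z)%Z < P%:Z)%R by rewrite modz_ge0 ?ltz_pmod// gt_eqF.
have qq : (- O%:Z <= q1 - q <= O%:Z)%R.
  move: zeE zE r0 r1 he; rewrite -/q -/q1 PoszM.
  move: (z%:Z %% P%:Z)%Z ((z%:Z + e) %% P%:Z)%Z q q1 z%:Z P%:Z Pz O%:Z.
  clear => a b q q1 z P P0 O h1 h2 /andP[h3 h4] /andP[h5 h6] h7.
  apply/andP; split; nia.
pose a := (z%:Z + (q1 - q) * P%:Z)%R.
have am0 : (0 <= (a %% (Q * P)%N%:Z)%Z)%R by rewrite modz_ge0// gt_eqF.
exists (absz (q1 - q + O%:Z)), (absz (a %% (Q * P)%N%:Z)%Z); split.
- by move: qq; clear; lia.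
- by rewrite -ltz_nat gez0_abs// ltz_pmod.
- have -> : z1 = absz ((z%:Z + e) %% (Q * P)%N%:Z)%Z.
    by rewrite -(modzMDl k) addrC -hz1 modz_small ?ltz_nat ?z1b//.
  rewrite !wrap_div//; congr (absz (_ %% _)%Z).
  by rewrite /a addrC divzMDl ?gt_eqF// -/q subrK.
- exists (- (a %/ (Q * P)%N%:Z)%Z)%R.
  rewrite gez0_abs// gez0_abs; last by move: qq; clear; lia.
  by rewrite addrK -/a mulNr [X in _ = X - _](divz_eq a (Q * P)%N%:Z) addrAC subrr add0r.
Qed.

Lemma residue_uniq (q a b : nat) (A B k k' : int) :
  (B = a%:Z + A + k * q%:Z)%R -> (B = b%:Z + A + k' * q%:Z)%R ->
  (a < q)%N -> (b < q)%N -> a = b.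
Proof.
move=> h1 h2 aq bq.
have E : (a%:Z - b%:Z = (k' - k) * q%:Z)%R.
  have : (a%:Z + A + k * q%:Z = b%:Z + A + k' * q%:Z)%R by rewrite -h1 -h2.
  by rewrite mulrBl; move: (k * q%:Z)%R (k' * q%:Z)%R => x y; clear; lia.
move: E; move: (k' - k)%R => c E; clear h1 h2.
have c0 : c = 0 by nia.
by move: E; rewrite c0 mul0r => /eqP; rewrite subr_eq0 eqz_nat => /eqP.
Qed.

Section Kernel.
Context {R : realType} {m n : nat}.
Variables (g L : nat).
Hypothesis g2 : (1 < g)%N.
Local Notation d := (m * n)%N.
Local Notation G l := (g%:R ^- l : R).
Local Notation Om := 'M['I_(g ^ L)]_(m, n).

Let g0 : (0 < g)%N. Proof. exact: ltnW. Qed.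
Let gR0 : 0 < g%:R :> R. Proof. by rewrite ltr0n. Qed.

Implicit Types (x y z c : Om) (w : Om -> R).

Definition same_cell (l : nat) (x y : Om) :=
  [forall i, [forall j, x i j %/ g ^ (L - l) == y i j %/ g ^ (L - l)]]%N.

Lemma same_cellP l x y :
  reflect (forall i j, x i j %/ g ^ (L - l) = y i j %/ g ^ (L - l))%N (same_cell l x y).
Proof. by apply: (iffP 'forall_forallP) => h i j; apply/eqP; rewrite h. Qed.

Lemma same_cell_sym l x y : same_cell l x y = same_cell l y x.
Proof. by apply/same_cellP/same_cellP => h i j; rewrite h. Qed.

Lemma same_cell_trans l x y z : same_cell l x y -> same_cell l y z -> same_cell l x z.
Proof. by move=> /same_cellP h /same_cellP k; apply/same_cellP => i j; rewrite h. Qed.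

Lemma same_cell_coarse l s x y : (l <= s <= L)%N -> same_cell s x y -> same_cell l x y.
Proof.
move=> /andP[ls sL] /same_cellP h; apply/same_cellP => i j.
have -> : (L - l = (L - s) + (s - l))%N by lia.
by rewrite expnD !divnMA h.
Qed.

Lemma card_same_cell l x : (l <= L)%N ->
  (#|[pred y | same_cell l x y]| <= g ^ ((L - l) * d))%N.
Proof.
move=> lL; have gel : (0 < g ^ (L - l))%N by rewrite expn_gt0 g0.
pose F (c : Om) : 'M['I_(g ^ (L - l))]_(m, n) :=
  \matrix_(i, j) Ordinal (ltn_pmod (c i j) gel).
rewrite -(card_in_image (f := F)).
  by rewrite (leq_trans (max_card _))// card_mx card_ord -expnM.
move=> c c'; rewrite !inE => /same_cellP cy /same_cellP c'y /matrixP Fcc.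
apply/matrixP => i j; apply: val_inj => /=.
rewrite (divn_eq (c i j) (g ^ (L - l))) (divn_eq (c' i j) (g ^ (L - l))).
have := Fcc i j; rewrite !mxE => /(congr1 val)/= ->.
by rewrite -cy -c'y.
Qed.

Variables (V : nat -> Om -> (Om -> R) -> Prop) (allowed : Om -> Prop)
  (B : nat -> R).
Hypotheses (B_ge0 : forall l, 0 <= B l)
  (V_cell : forall s x y w, V s x w -> same_cell s x y -> V s y w)
  (V_level : forall s x w, V s x w -> (s <= L)%N)
  (V_ge0 : forall s x w c, V s x w -> 0 <= w c)
  (V_supp : forall s x w c, V s x w -> w c != 0 -> same_cell s x c /\ allowed c)
  (V_sum : forall s x w, V s x w -> \sum_c w c = 1)
  (V_ball : forall s x w l y, V s x w -> (s <= l <= L)%N ->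
     G s ^+ d * \sum_(c | same_cell l y c) w c <= B l).

Definition valid_at s x := `[< exists w, V s x w >].
Definition covered x := `[< exists s, valid_at s x >].

Let lev (x : Om) : nat :=
  if pselect (exists s, valid_at s x) is left h then ex_minn h else 0%N.

Let levP x : covered x -> valid_at (lev x) x.
Proof.
by move=> /asboolP h; rewrite /lev; case: pselect => // h'; case: ex_minnP.
Qed.

Let lev_min x s : valid_at s x -> (lev x <= s)%N.
Proof.
move=> h; rewrite /lev; case: pselect => // h'; case: ex_minnP => k _; exact.
Qed.

Let valid_cell s x y : same_cell s x y -> valid_at s x -> valid_at s y.
Proof. by move=> xy /asboolP[w Vw]; apply/asboolP; exists w; exact: V_cell xy. Qed.

Let valid_level s x : valid_at s x -> (s <= L)%N.
Proof. by move=> /asboolP[w /V_level]. Qed.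

Let lev_cell x y : covered x -> same_cell (lev x) x y -> covered y /\ lev y = lev x.
Proof.
move=> cx xy; have vx := levP cx; have vy := valid_cell xy vx.
have cy : covered y by apply/asboolP; exists (lev x).
split=> //; apply/eqP; rewrite eqn_leq lev_min//= lev_min//.
apply: valid_cell (levP cy); rewrite same_cell_sym.
by apply: same_cell_coarse xy; rewrite lev_min// (valid_level vx).
Qed.

(** The choice depends on the set only; points of one cell have the same set of kernels, hence the
    same kernel ([ker_cell]). *)
Let pick (P : set (Om -> R)) : Om -> R :=
  if pselect (exists w, P w) is left h then sval (cid h) else fun=> 0.

Let ker (x : Om) : Om -> R := pick [set w | V (lev x) x w].

Let kerP x : covered x -> V (lev x) x (ker x).
Proof.
move=> /levP/asboolP h; rewrite /ker /pick; case: pselect => // h'.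
exact: (svalP (cid h')).
Qed.

Let ker_cell x y : covered x -> same_cell (lev x) x y -> ker y = ker x.
Proof.
move=> cx xy; have [cy ly] := lev_cell cx xy.
rewrite /ker ly; congr pick; apply/seteqP; split => w /= Vw; apply: V_cell Vw _ => //.
by rewrite same_cell_sym.
Qed.

Let nu (c : Om) : R := \sum_(x | covered x) ker x c.

(** Each covered point sends unit mass through the kernel at its coarsest level [lev x], and this
    stays in its cell of that level. Points with [lev x >= l] reach the cell of [y] only from inside
    it, hence the volume term. Those with [lev x < l] lie in the cell of level [lev y] around [y]
    and share its kernel, to which [V_ball] applies. *)
Lemma kernel_ball l y : (l <= L)%N ->
  \sum_(c | same_cell l y c) nu c <= g%:R ^+ (L * d) * (G l ^+ d + B l).
Proof.
move=> lL; rewrite exchange_big/=.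
pose a x := \sum_(c | same_cell l y c) ker x c.
have a1 x : covered x -> 0 <= a x <= 1.
  move=> cx; rewrite sumr_ge0/=; last by move=> c _; exact: V_ge0 (kerP cx).
  rewrite -(V_sum (kerP cx)) [leRHS](bigID (same_cell l y))/= lerDl.
  by apply: sumr_ge0 => c _; exact: V_ge0 (kerP cx).
have aN x : covered x -> a x != 0 -> exists c, [/\ same_cell l y c,
    same_cell (lev x) x c & (lev x <= L)%N].
  move=> cx; rewrite psumr_neq0; last by move=> c _; exact: V_ge0 (kerP cx).
  move=> /hasP[c _ /andP[yc kc]]; exists c; split => //.
    by have [] := V_supp (kerP cx) (lt0r_neq0 kc).
  exact: V_level (kerP cx).
rewrite (bigID (fun x => (l <= lev x)%N))/= mulrDr; apply: lerD.
  apply: (@le_trans _ _ (\sum_(x | same_cell l y x) 1)).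
    rewrite big_mkcond [leRHS]big_mkcond; apply: ler_sum => x _.
    case: ifPn => [/andP[cx lx]|_]; last by case: ifP.
    case: ifPn => yx; first by have /andP[] := a1 x cx.
    rewrite leNgt lt0r negb_and negbK; apply/orP; left.
    apply: contraNT yx => /(aN x cx)[c [yc xc lL']].
    apply: same_cell_trans yc _; rewrite same_cell_sym.
    by apply: same_cell_coarse xc; rewrite lx.
  rewrite sumr_const.
  apply: (@le_trans _ _ ((g ^ ((L - l) * d))%:R)).
    by rewrite ler_nat; exact: card_same_cell.
  rewrite natrX mulnBl -exprVn -exprM exprVn exprB// ?leq_mul2r ?lL ?orbT//.
  by rewrite unitfE gt_eqF.
have [cy|ncy] := boolP (covered y && (lev y < l)%N); last first.
  rewrite big1; last first.
    move=> x /andP[cx]; rewrite -ltnNge => xl; apply: contrapT => /eqP /(aN x cx)[c [yc xc _]].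
    case/negP: ncy; have yc' := same_cell_coarse (l := lev x) _ yc.
    have [|cy ly] := lev_cell cx (same_cell_trans xc _ : same_cell (lev x) x y).
      by rewrite same_cell_sym yc'// ltnW.
    by rewrite cy ly.
  by rewrite mulr_ge0 ?exprn_ge0.
move: cy => /andP[cy yl].
apply: (@le_trans _ _ (\sum_(x | same_cell (lev y) y x) a y)).
  rewrite big_mkcond [leRHS]big_mkcond; apply: ler_sum => x _.
  have ay0 : 0 <= a y by have /andP[] := a1 y cy.
  case: ifPn => [/andP[cx]|_]; last by case: ifP.
  rewrite -ltnNge -/(a x) => xl; have [->|/(aN x cx)[c [yc xc xL]]] := eqVneq (a x) 0.
    by case: ifP.
  have yc' : same_cell (lev x) y c by apply: same_cell_coarse yc; rewrite ltnW.
  have xy : same_cell (lev x) x y.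
    by apply: same_cell_trans xc _; rewrite same_cell_sym.
  have [_ ly] := lev_cell cx xy.
  by rewrite ly same_cell_sym xy /a (ker_cell cx xy).
rewrite sumr_const -[leLHS]mulr_natl.
have yL : (lev y <= L)%N := V_level (kerP cy).
apply: (@le_trans _ _ ((g ^ ((L - lev y) * d))%:R * a y)).
  rewrite ler_wpM2r//; first by have /andP[] := a1 y cy.
  by rewrite ler_nat; exact: card_same_cell.
have := V_ball y (kerP cy) (_ : (lev y <= l <= L)%N); rewrite (ltnW yl) lL => /(_ isT).
rewrite -/(a y) -exprVn -exprM exprVn => h.
rewrite natrX mulnBl exprB ?leq_mul2r ?yL ?orbT ?unitfE ?gt_eqF//.
by rewrite -mulrA ler_wpM2l// exprn_ge0.
Qed.

(** Normalizing by the number of covered points costs [1 / kappa] when they fill a proportion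
    [kappa] of the grid. *)
Lemma kernel_weights (kappa : R) : 0 < kappa ->
  kappa * g%:R ^+ (L * d) <= #|[pred x | covered x]|%:R ->
  exists t : seq ('M[nat]_(m, n) * R), [/\ weights g L t,
    forall l (y : 'M[nat]_(m, n)), (l <= L)%N ->
      mass t (fun x : 'M[nat]_(m, n) => coarse g (L - l) x == y) <= kappa^-1 * (G l ^+ d + B l)
  & forall x : 'M[nat]_(m, n), x \in cells t -> exists2 c, allowed c & x = map_mx val c].
Proof.
move=> kap0 hcov.
set N : R := #|[pred x | covered x]|%:R in hcov.
have gL0 : 0 < g%:R ^+ (L * d) :> R by rewrite exprn_gt0.
have N0 : 0 < N by apply: lt_le_trans hcov; rewrite mulr_gt0.
have nu0 c : 0 <= nu c by apply: sumr_ge0 => x cx; exact: V_ge0 (kerP cx).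
pose t : seq ('M[nat]_(m, n) * R) :=
  [seq (map_mx val c, nu c / N) | c <- enum [pred c : Om | nu c != 0]].
have massE P : mass t P = (\sum_(c | P (map_mx val c)) nu c) / N.
  rewrite /mass /t big_map/= big_enum_cond/= mulr_suml.
  rewrite big_mkcond [RHS]big_mkcond; apply: eq_bigr => c _; rewrite inE.
  by case: eqP => [->|]//=; case: ifP; rewrite ?mul0r.
exists t; split.
- split.
  + by move=> _ /mapP[c _ ->]; rewrite divr_ge0// ltW.
  + by move=> _ /mapP[c _ ->] i j; rewrite mxE; exact: ltn_ord.
  rewrite massE/= exchange_big/= (eq_bigr (fun=> 1)); last first.
    by move=> x cx; rewrite (V_sum (kerP cx)).
  by rewrite sumr_const divff// gt_eqF.
- move=> l y lL; rewrite massE ler_pdivrMr//.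
  have rhs0 : 0 <= kappa^-1 * (G l ^+ d + B l).
    by rewrite mulr_ge0 ?invr_ge0 ?(ltW kap0)// addr_ge0// exprn_ge0// invr_ge0 exprn_ge0.
  have [[c0 hc0]|nc] := pselect (exists c0 : Om, coarse g (L - l) (map_mx val c0) = y);
    last first.
    rewrite big_pred0; first by rewrite (mulr_ge0 rhs0)// ltW.
    move=> c; apply/negP => /eqP h.
    by apply: nc; exists c.
  rewrite (eq_bigl (same_cell l c0)); last first.
    move=> c; apply/eqP/same_cellP.
      move=> h i j; have := congr1 (fun M : 'M[nat]_(m, n) => M i j) (etrans h (esym hc0)).
      by rewrite !mxE.
    by move=> h; rewrite -hc0; apply/matrixP => i j; rewrite !mxE h.
  apply: le_trans (kernel_ball c0 lL) _.
  have q0 : 0 <= G l ^+ d + B l.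
    by rewrite addr_ge0// exprn_ge0// invr_ge0 exprn_ge0.
  by rewrite [leRHS]mulrAC ler_wpM2r// mulrC ler_pdivlMr// mulrC.
- move=> x /mapP[_ /mapP[c + ->] ->] /=; rewrite mem_enum inE => nuc.
  exists c => //; move: nuc; rewrite /nu psumr_neq0; last first.
    by move=> y cy; exact: V_ge0 (kerP cy).
  move=> /hasP[y _ /andP[cy kc]].
  by have [] := V_supp (kerP cy) (lt0r_neq0 kc).
Qed.

(* Cells near a covered cell are counted through the translation by the offset
   at the coarsest valid level, which the target of the translation remembers. *)
Lemma covered_count (O : nat) (Z : pred Om) :
  (forall z, Z z -> exists s z1, valid_at s z1 /\ forall i j, exists e k : int,
     (`|e| <= (O * g ^ (L - s))%:Z)%R /\
     ((z1 i j : nat)%:Z = (z i j : nat)%:Z + e + k * (g ^ L)%:Z)%R) ->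
  (#|Z| <= (2 * O).+1 ^ d * #|[pred x | covered x]|)%N.
Proof.
move=> hZ.
have GL0 : (0 < g ^ L)%N by rewrite expn_gt0 g0.
pose P s := (g ^ (L - s))%N.
pose rel (z : Om) (oz : {ffun 'I_m * 'I_n -> 'I_(2 * O).+1} * Om) :=
  covered oz.2 /\ forall i j, exists k : int,
    ((oz.2 i j : nat)%:Z = (z i j : nat)%:Z +
       ((oz.1 (i, j) : nat)%:Z - O%:Z) * (P (lev oz.2))%:Z + k * (g ^ L)%:Z)%R.
have ex z : Z z -> exists oz, rel z oz.
  move=> /hZ[s [z1 [v1 h]]].
  have c1 : covered z1 by apply/asboolP; exists s.
  have ls := lev_min v1; have sL := valid_level v1.
  set s' := lev z1 in ls; pose P' := P s'.
  have P'0 : (0 < P')%N by rewrite expn_gt0 g0.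
  have PE : (g ^ L = g ^ s' * P')%N by rewrite -expnD subnKC//; lia.
  have loc i j : exists (o : 'I_(2 * O).+1) (w : 'I_(g ^ L)),
      (w %/ P' = z1 i j %/ P')%N /\ exists k : int, ((w : nat)%:Z = (z i j : nat)%:Z +
         ((o : nat)%:Z - O%:Z) * P'%:Z + k * (g ^ L)%:Z)%R.
    have [e [k [he hk]]] := h i j.
    have he' : (`|e| <= (O * P')%N%:Z)%R.
      apply: le_trans he _; rewrite lez_nat leq_mul2l.
      by rewrite leq_exp2l// leq_sub2l// orbT.
    have zb : (z1 i j < g ^ s' * P')%N by rewrite -PE.
    have hk2 : ((z1 i j : nat)%:Z = (z i j : nat)%:Z + e + k * (g ^ s' * P')%N%:Z)%R.
      by rewrite -PE.
    have gs0 : (0 < g ^ s')%N by rewrite expn_gt0 g0.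
    have [ov [w [ob wb wz [k' hk']]]] := cell_offset P'0 gs0 zb he' hk2.
    have wb' : (w < g ^ L)%N by rewrite PE.
    by exists (Ordinal ob), (Ordinal wb'); split => //; exists k'; move: hk'; rewrite -PE.
  pose oo i j := cid (loc i j); pose ww i j := cid (svalP (oo i j)).
  pose z2 : Om := \matrix_(i, j) sval (ww i j).
  have z12 : same_cell s' z1 z2.
    apply/same_cellP => i j; rewrite mxE.
    by have [-> _] := svalP (ww i j).
  have [c2 l2] := lev_cell c1 z12.
  exists ([ffun ij => sval (oo ij.1 ij.2)], z2); split => //= i j.
  rewrite l2 ffunE mxE /=.
  by have [_] := svalP (ww i j).
pose F z := if pselect (exists oz, rel z oz) is left h then sval (cid h) else
  ([ffun=> ord0], z).
have FP z : Z z -> rel z (F z).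
  by move=> /ex h; rewrite /F; case: pselect => // h'; exact: (svalP (cid h')).
have Finj : {in Z &, injective F}.
  move=> z z' /FP[_ h1] /FP[_ h2] Fz; rewrite -Fz in h2.
  apply/matrixP => i j; apply: val_inj => /=.
  have [k hk] := h1 i j; have [k' hk'] := h2 i j.
  exact: (residue_uniq hk hk' (ltn_ord _) (ltn_ord _)).
rewrite -(card_in_image Finj).
apply: (@leq_trans #|[predX predT & [pred x | covered x]]|).
  apply/subset_leq_card/fintype.subsetP => _ /fintype.imageP[z Zz ->].
  have [c2 _] := FP z Zz.
  move: (F z) c2 => [ov w2] /= c2.
  exact: c2.
rewrite cardX leq_mul2r; apply/orP; right.
have -> : #|predT : pred {ffun 'I_m * 'I_n -> 'I_(2 * O).+1}| = ((2 * O).+1 ^ d)%N.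
  by rewrite -[in RHS](card_ord (2 * O).+1) -[in RHS](card_ord m) -[in RHS](card_ord n) -card_prod -card_ffun.
by [].
Qed.

End Kernel.

(** * Mass on a plank inside a cell *)

Lemma dist_nat_lt (a b w q : nat) : (a < w)%N -> (b < w)%N -> (w <= q)%N ->
  (`|a%:Z - b%:Z| < q%:Z)%R.
Proof. lia. Qed.

Lemma dist_half (j o : nat) : (j < (2 * o).+1)%N -> (`|j%:Z - o%:Z| <= o%:Z)%R.
Proof. lia. Qed.

Section Piece.
Context {R : realType} {m n : nat}.
Variables (g L : nat) (f : R -> R).
Hypothesis g2 : (1 < g)%N.
Local Notation d := (m * n)%N.
Local Notation G l := (g%:R ^- l : R).
Local Notation Om := 'M['I_(g ^ L)]_(m, n).

Let g0 : (0 < g)%N. Proof. exact: ltnW. Qed.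
Let gR0 : 0 < g%:R :> R. Proof. by rewrite ltr0n. Qed.
Let GL0 : (0 < g ^ L)%N. Proof. by rewrite expn_gt0 g0. Qed.

Lemma wrap_proof (a : int) : (absz (a %% (g ^ L)%:Z)%Z < g ^ L)%N.
Proof.
have : (0 <= (a %% (g ^ L)%:Z)%Z < (g ^ L)%:Z)%R.
  by rewrite modz_ge0 ?ltz_pmod// ?ltz_nat// eqz_nat -lt0n.
lia.
Qed.

Definition wrap (a : int) : 'I_(g ^ L) := Ordinal (wrap_proof a).

Lemma wrapE a : exists k : int, ((wrap a : nat)%:Z = a + k * (g ^ L)%:Z)%R.
Proof.
exists (- (a %/ (g ^ L)%:Z)%Z)%R.
rewrite /= gez0_abs; first by rewrite mulNr [X in _ = X - _](divz_eq a (g ^ L)%:Z) addrAC subrr add0r.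
by rewrite modz_ge0// eqz_nat -lt0n.
Qed.

Lemma wrap_nat (a : 'I_(g ^ L)) : wrap (a : nat)%:Z = a.
Proof. by apply: val_inj; rewrite /= modz_nat absz_nat modn_small. Qed.

Lemma wrap_cell s (a b : int) : (s <= L)%N ->
  (a %/ (g ^ (L - s))%:Z)%Z = (b %/ (g ^ (L - s))%:Z)%Z ->
  (wrap a %/ g ^ (L - s) = wrap b %/ g ^ (L - s))%N.
Proof.
move=> sL ab; have E : (g ^ L = g ^ s * g ^ (L - s))%N by rewrite -expnD subnKC.
by rewrite /= E !wrap_div ?expn_gt0 ?g0// ab.
Qed.

Lemma wrap_inj (a b : int) : (wrap a = wrap b :> nat) ->
  (`|a - b| < (g ^ L)%:Z)%R -> a = b.
Proof.
have [k ka] := wrapE a; have [l lb] := wrapE b => ab.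
have E : (a - b = (l - k) * (g ^ L)%:Z)%R.
  have : (a + k * (g ^ L)%:Z = b + l * (g ^ L)%:Z)%R by rewrite -ka -lb ab.
  rewrite mulrBl; move: (k * _)%R (l * _)%R => x y; clear; lia.
rewrite E normrM; move: GL0; move: E; move: (l - k)%R (g ^ L)%N => c q E q0 h.
have c0 : c = 0 by nia.
by move: E; rewrite c0 mul0r => /eqP; rewrite subr_eq0 => /eqP.
Qed.

Definition valid_kernel (allowed : Om -> Prop) (B : nat -> R) (s : nat) (x : Om)
    (w : Om -> R) :=
  [/\ (s <= L)%N, forall c, 0 <= w c,
      forall c, w c != 0 -> same_cell s x c /\ allowed c,
      \sum_c w c = 1
    & forall l y, (s <= l <= L)%N ->
        G s ^+ d * \sum_(c | same_cell l y c) w c <= B l].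

(** Half of the width is held back for the passage from a grid point to all points of its cell. *)
Definition in_plank (v : 'I_m -> nat) (eta : 'I_n -> R) (c : Om) :=
  exists p : 'I_n -> int, forall l,
    `|\sum_i (v i)%:R * (c i l : nat)%:R - (p l)%:~R * g%:R ^+ L| <= g%:R ^+ L * (eta l / 2).

Lemma card_bounded_ffunE (aT : finType) (N : nat) (bnd : aT -> nat) :
  (forall x, bnd x <= N)%N ->
  #|[pred q : {ffun aT -> 'I_N} | [forall x, (q x < bnd x)%N]]| = (\prod_x bnd x)%N.
Proof.
move=> bN.
have -> : #|[pred q : {ffun aT -> 'I_N} | [forall x, (q x < bnd x)%N]]| =
    #|family (fun x => [pred y : 'I_N | (y < bnd x)%N])|.
  apply: eq_card => q; apply/idP/familyP => [/forallP hq x|hq]; first exact: (hq x).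
  by apply/forallP => x; exact: (hq x).
rewrite card_family foldrE big_map big_enum/=; apply: eq_bigr => x _.
rewrite -[RHS](card_ord (bnd x)).
have wi : injective (widen_ord (bN x)) by move=> y z /(congr1 val)/= /val_inj.
rewrite -(fintype.card_image wi); apply: eq_card => y.
apply/idP/codomP => [yb|[y' ->]]; last exact: (ltn_ord y').
by exists (Ordinal (yb : (y < bnd x)%N)); exact: val_inj.
Qed.

Variables (v : 'I_m -> nat) (i0 : 'I_m) (eta : 'I_n -> R) (s : nat) (K : R)
  (y : 'I_m -> 'I_n -> R) (p : 'I_n -> int) (z : Om).
Local Notation h := (v i0).
Local Notation P := (g ^ (L - s))%N.
Local Notation GL := (g%:R ^+ L : R).
Local Notation PR := (g%:R ^+ (L - s) : R).
Local Notation sig := (G s).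
Hypotheses (v_le : forall i, (v i <= h)%N) (h_gt0 : (0 < h)%N)
  (eta_gt0 : forall l, 0 < eta l) (sL : (s <= L)%N)
  (L_large : forall l, 4 * m.+1%:R * h%:R <= GL * eta l)
  (y_near : forall l, `|\sum_i (v i)%:R * y i l - (p l)%:~R| <=
     1 / 4 * Num.max (eta l) (sig * h%:R))
  (zy : forall i l, (z i l : nat)%:R <= GL * y i l < (z i l : nat).+1%:R).

Let hR0 : 0 < h%:R :> R. Proof. by rewrite ltr0n. Qed.
Let GLR0 : 0 < GL. Proof. by rewrite exprn_gt0. Qed.
Let P0 : (0 < P)%N. Proof. by rewrite expn_gt0 g0. Qed.
Let PRE : P%:R = PR. Proof. by rewrite natrX. Qed.
Let sigP : GL * sig = PR.
Proof. by rewrite -{1}(subnK sL) exprD mulfK// gt_eqF ?exprn_gt0. Qed.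

(** The length of the window left to the entry of row [i0]: it moves the linear form by at most
    [eta l / 4] and does not exceed a cell side. *)
Let q l : R := Num.min (eta l / (4 * h%:R)) sig.
Let W l : nat := Num.truncn (GL * q l).

Let qge1 l : 1 <= GL * q l.
Proof.
rewrite /q minr_pMr ?(ltW GLR0)// le_min sigP; apply/andP; split; last first.
  by rewrite exprn_ege1// ler1n.
rewrite mulrA ler_pdivlMr ?mulr_gt0// mul1r (le_trans _ (L_large l))//.
by rewrite ler_pM2r// ler_peMr// ler1n.
Qed.

Let Wge l : GL * q l <= 2 * (W l)%:R.
Proof.
have q0 : 0 <= GL * q l by exact: le_trans (qge1 l).
have := truncn_gt q0; rewrite -natr1 -/(W l) => h1.
have : 1 <= (W l)%:R :> R.
  by rewrite ler1n lt0n; apply/eqP => W0; have := qge1 l; move: h1; rewrite W0; lra.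
lra.
Qed.

Let Wle l : (W l)%:R <= GL * q l.
Proof. by apply: truncn_le; exact: le_trans (qge1 l). Qed.

Let W0 l : (0 < W l)%N.
Proof.
rewrite lt0n; apply/eqP => W00; have := Wge l; have := qge1 l.
by rewrite W00; lra.
Qed.

Let WP l : (W l <= P)%N.
Proof.
rewrite -(ler_nat R) PRE (le_trans (Wle l))// -sigP ler_pM2l//.
by rewrite ge_min lexx orbT.
Qed.

Let Weta l : (W l)%:R * h%:R <= GL * (eta l / 4).
Proof.
rewrite -ler_pdivlMr//; apply: le_trans (Wle l) _; rewrite -mulrA ler_pM2l//.
rewrite ge_min; apply/orP; left; apply: ler_eq; field; by rewrite gt_eqF.
Qed.

Let PL : (P <= g ^ L)%N. Proof. by rewrite leq_exp2l// leq_subr. Qed.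

Let vy l : R := \sum_i (v i)%:R * y i l.
(** A target value within [eta l / 4] of the integer [p l] and also within a quarter of [sig * h] of
    the value at [y]: the first keeps the points in the plank, the second keeps them near [z]. *)
Let cl l : R := if `|vy l - (p l)%:~R| <= 1 / 4 * eta l then vy l else (p l)%:~R.

Let cl_p l : `|cl l - (p l)%:~R| <= 1 / 4 * eta l.
Proof.
rewrite /cl; case: ifP => //; rewrite subrr normr0 => _.
by rewrite mulr_ge0// ltW.
Qed.

Let cl_y l : `|cl l - vy l| <= 1 / 4 * (sig * h%:R).
Proof.
rewrite /cl; case: ifPn => [_|]; first by rewrite subrr normr0 mulr_ge0// mulr_ge0// ?invr_ge0 ?exprn_ge0.
rewrite -ltNge => h1; rewrite distrC; have := y_near l; rewrite -/(vy l).
by rewrite maxEle; case: ifP => // _ h2; move: (lt_le_trans h1 h2); rewrite ltxx.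
Qed.

Let bnd (il : 'I_m * 'I_n) := if il.1 == i0 then W il.2 else P.
Let Par := {ffun 'I_m * 'I_n -> 'I_(g ^ L)}.
Let PP : pred Par := [pred a : Par | [forall il, (a il < bnd il)%N]].

Let xo (a : Par) i l : nat := (z i l %/ P * P + a (i, l))%N.
(** The rows other than [i0] run over the cell of [z]; the entry in row [i0] is solved from the
    linear equation and then moved by the window parameter. *)
Let base (a : Par) l : int :=
  Num.floor ((cl l * GL - \sum_(i | i != i0) (v i)%:R * (xo a i l)%:R) / h%:R).
Let xi (a : Par) l : int := base a l + (a (i0, l) : nat)%:Z.
Let T (a : Par) : Om := \matrix_(i, l) if i == i0 then wrap (xi a l) else wrap (xo a i l)%:Z.

Let xo_lt (a : Par) i l : PP a -> i != i0 -> (xo a i l < g ^ L)%N /\ (xo a i l %/ P = z i l %/ P)%N.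
Proof.
move=> /forallP/(_ (i, l)); rewrite /bnd/= => + ii; rewrite (negbTE ii) => aP.
have e2 : (xo a i l %/ P = z i l %/ P)%N by rewrite /xo divnMDl// (divn_small aP) addn0.
split => //; have E : (g ^ L = g ^ s * P)%N by rewrite -expnD subnKC.
by rewrite E -ltn_divLR// e2 ltn_divLR// -E.
Qed.

Let eq1 (a : Par) l : PP a ->
  `|\sum_(i | i != i0) (v i)%:R * (xo a i l)%:R + h%:R * (xi a l)%:~R - cl l * GL|
  <= (W l)%:R * h%:R.
Proof.
move=> /forallP/(_ (i0, l)); rewrite /bnd/= eqxx => aW.
set S := \sum_(i | _) _; set X := (cl l * GL - S) / h%:R.
have /andP[f1 f2] := floor_itv X; rewrite intrD in f2.
have E : cl l * GL = S + h%:R * X by rewrite /X; field; rewrite gt_eqF.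
rewrite -[Num.floor X]/(base a l) in f1 f2.
rewrite E /xi intrD.
have -> : S + h%:R * ((base a l)%:~R + ((a (i0, l) : nat)%:Z)%:~R) - (S + h%:R * X) =
   ((base a l)%:~R + (a (i0, l) : nat)%:R - X) * h%:R.
  by rewrite -[((a (i0, l) : nat)%:Z)%:~R]/((a (i0, l) : nat)%:R); ring.
rewrite normrM (gtr0_norm hR0) ler_pM2r//.
have aW' : (a (i0, l) : nat)%:R + 1 <= (W l)%:R :> R by rewrite natr1 ler_nat.
have a0 : 0 <= (a (i0, l) : nat)%:R :> R by [].
by rewrite ler_norml; lra.
Qed.

(** After division by [h], each of the [m.-1] free rows contributes at most one side, the window
    one, the target a quarter, and rounding [y] to [z] one more. *)
Let loc (a : Par) l : PP a -> `|(xi a l)%:~R - (z i0 l : nat)%:R| <= m.+2%:R * PR.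
Proof.
move=> aP; have := eq1 l aP; set S := \sum_(i | _) _ => h1.
have E : h%:R * ((xi a l)%:~R - GL * y i0 l) =
   (S + h%:R * (xi a l)%:~R - cl l * GL) + (cl l - vy l) * GL +
   \sum_(i | i != i0) (v i)%:R * (GL * y i l - (xo a i l)%:R).
  have -> : \sum_(i | i != i0) (v i)%:R * (GL * y i l - (xo a i l)%:R) =
      GL * \sum_(i | i != i0) (v i)%:R * y i l - S.
    by rewrite mulr_sumr -sumrB; apply: eq_bigr => i _; ring.
  by rewrite /vy (bigD1 i0)//=; ring.
have h2 : `|(cl l - vy l) * GL| <= 1 / 4 * (PR * h%:R).
  rewrite normrM (gtr0_norm GLR0) -sigP; apply: le_trans (ler_wpM2r (ltW GLR0) (cl_y l)) _.
  by apply: ler_eq; ring.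
have h3 : `|\sum_(i | i != i0) (v i)%:R * (GL * y i l - (xo a i l)%:R)| <= m.-1%:R * (h%:R * PR).
  apply: le_trans (ler_norm_sum _ _ _) _.
  apply: (@le_trans _ _ (\sum_(i | i != i0) h%:R * PR)); last first.
    by rewrite sumr_const cardC1 card_ord [leRHS]mulr_natl.
  apply: ler_sum => i ii; rewrite normrM; apply: ler_pM => //.
    by rewrite ger0_norm// ler_nat.
  have [_ xP] := xo_lt l aP ii; have /andP[z1 z2] := zy i l.
  have x1 : (z i l %/ P * P <= xo a i l < (z i l %/ P).+1 * P)%N.
    by rewrite -xP leq_divM ltn_ceil.
  have y1 : (z i l %/ P * P)%:R <= GL * y i l.
    by apply: le_trans z1; rewrite ler_nat leq_divM.
  have y2 : GL * y i l < ((z i l %/ P).+1 * P)%:R.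
    by apply: lt_le_trans z2 _; rewrite ler_nat ltn_ceil.
  have /andP[x2 x3] := x1; move: x2 x3; rewrite -(ler_nat R) -(ltr_nat R) => x2 x3.
  by move: y2 x3; rewrite mulSn natrD PRE => y2 x3; rewrite ler_norml; lra.
have W1 : (W l)%:R <= PR by rewrite -PRE ler_nat.
have /andP[z1 z2] := zy i0 l.
have PR1 : 1 <= PR by rewrite exprn_ege1// ler1n ltnW.
have h4 : `|(xi a l)%:~R - GL * y i0 l| <= (m.-1%:R + 5 / 4) * PR.
  rewrite -(ler_pM2l hR0) -{1}(gtr0_norm hR0) -normrM E.
  apply: le_trans (ler_normD _ _) _; apply: le_trans (lerD (ler_normD _ _) (lexx _)) _.
  have : (W l)%:R * h%:R <= PR * h%:R by rewrite ler_pM2r.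
  by move: h1 h2 h3; set A := `|_|; set B := `|_|; set D := `|_|; lra.
have m1 : m.-1%:R + 1 = m%:R :> R.
  by rewrite natr1 prednK//; exact: leq_ltn_trans (leq0n _) (ltn_ord i0).
rewrite -natr1 -natr1 -m1.
move: h4; rewrite !ler_norml => /andP[b1 b2]; rewrite -natr1 in z2.
have -> : (m.-1%:R + 1 + 1 + 1) * PR = (m.-1%:R + 5 / 4) * PR + PR + 3 / 4 * PR by field.
lra.
Qed.

(** The [m.+2] sides of [loc], plus one for passing to cell indices. *)
Let O : nat := m.+3.
Let idx (a : Par) : {ffun 'I_n -> 'I_(2 * O).+1} :=
  [ffun l => inord (absz ((xi a l %/ P%:Z)%Z - (z i0 l %/ P)%:Z + O%:Z))].

Let idxE (a : Par) l : PP a ->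
  ((xi a l %/ P%:Z)%Z = (z i0 l %/ P)%:Z + (idx a l : nat)%:Z - O%:Z)%R.
Proof.
move=> aP; rewrite ffunE.
suff : (- O%:Z <= (xi a l %/ P%:Z)%Z - (z i0 l %/ P)%:Z <= O%:Z)%R.
  by move: (xi a l %/ P%:Z)%Z (z i0 l %/ P)%N O => A B C h1; rewrite inordK; lia.
have := loc l aP; rewrite ler_norml => /andP[l1 l2].
have L1 : (- (m.+2 * P)%:Z <= xi a l - (z i0 l : nat)%:Z <= (m.+2 * P)%:Z)%R.
  rewrite -!(ler_int R) !rmorphN rmorphB/= -!pmulrn natrM PRE.
  by rewrite -mulNr in l1; apply/andP; split; [rewrite -mulNr|].
have e1 := divz_eq (xi a l) P%:Z.
have P0' : (0 < P%:Z)%R by rewrite ltz_nat.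
have r0 : (0 <= (xi a l %% P%:Z)%Z < P%:Z)%R by rewrite modz_ge0 ?ltz_pmod// gt_eqF.
have e2 := divn_eq (z i0 l) P; have r2 := ltn_pmod (z i0 l) P0.
move: L1 e1 P0' r0 e2 r2; rewrite /O.
move: (xi a l) ((xi a l %/ P%:Z)%Z) ((xi a l %% P%:Z)%Z) (val (z i0 l)) P => X1 A r1 Z1 Pn.
move: (Z1 %/ Pn)%N (Z1 %% Pn)%N m => B r2 mm L1 e1 P0' r0 e2 r2'.
rewrite PoszM in L1; apply/andP; split; nia.
Qed.

Let xi_cell (a : Par) l : PP a ->
  (xi a l %/ P%:Z)%Z = (((z i0 l : nat)%:Z + ((idx a l : nat)%:Z - O%:Z) * P%:Z) %/ P%:Z)%Z.
Proof.
move=> aP; rewrite (idxE l aP) (addrC (z i0 l : nat)%:Z) divzMDl; last by rewrite eqz_nat -lt0n.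
by rewrite divz_nat [RHS]addrC addrA.
Qed.

Let zj (J : {ffun 'I_n -> 'I_(2 * O).+1}) : Om := \matrix_(i, l)
  if i == i0 then wrap ((z i0 l : nat)%:Z + ((J l : nat)%:Z - O%:Z) * P%:Z) else z i l.

Let T_cell (a : Par) : PP a -> same_cell s (zj (idx a)) (T a).
Proof.
move=> aP; apply/same_cellP => i l; rewrite !mxE; case: ifPn => ii.
  by apply: wrap_cell => //; rewrite xi_cell.
have [xb xP] := xo_lt l aP ii.
by rewrite -[z i l]wrap_nat; apply: wrap_cell => //; rewrite !divz_nat xP.
Qed.

Let T_plank (a : Par) : PP a -> in_plank v eta (T a).
Proof.
move=> aP.
have Tk l : exists k : int, \sum_i (v i)%:R * (T a i l : nat)%:R =
    \sum_(i | i != i0) (v i)%:R * (xo a i l)%:R + h%:R * (xi a l)%:~R + k%:~R * GL :> R.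
  have [k hk] := wrapE (xi a l); exists (k * h%:Z).
  rewrite (bigD1 i0)//= mxE eqxx addrC -[RHS]addrA; congr (_ + _).
    apply: eq_bigr => i ii; rewrite mxE (negbTE ii); have [xb _] := xo_lt l aP ii.
    by rewrite /= modz_nat absz_nat modn_small.
  have -> : (wrap (xi a l) : nat)%:R = ((wrap (xi a l) : nat)%:Z)%:~R :> R by [].
  by rewrite hk intrD !intrM -!pmulrn natrX; ring.
exists (fun l => p l + sval (cid (Tk l))) => l.
have e1 := svalP (cid (Tk l)); set k := sval _ in e1 *.
rewrite e1 intrD; set S := \sum_(i | _) _.
have -> : S + h%:R * (xi a l)%:~R + k%:~R * GL - ((p l)%:~R + k%:~R) * GL =
   (S + h%:R * (xi a l)%:~R - cl l * GL) + (cl l - (p l)%:~R) * GL by ring.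
apply: le_trans (ler_normD _ _) _; rewrite [X in _ + X]normrM (gtr0_norm GLR0).
have h1 := le_trans (eq1 l aP) (Weta l).
have h2 := ler_wpM2r (ltW GLR0) (cl_p l).
apply: le_trans (lerD h1 h2) _; apply: ler_eq.
by field.
Qed.

Let T_base (a a' : Par) : (forall i l, i != i0 -> a (i, l) = a' (i, l)) ->
  forall l, base a l = base a' l.
Proof.
move=> aa l; rewrite /base (eq_bigr (fun i => (v i)%:R * (xo a' i l)%:R))// => i ii.
by rewrite /xo aa.
Qed.

Let cntE : #|PP| = (\prod_il bnd il)%N.
Proof.
apply: card_bounded_ffunE => il; rewrite /bnd; case: ifP => _ //.
exact: leq_trans (WP _) PL.
Qed.

Let bnd' (l : nat) (il : 'I_m * 'I_n) :=
  if il.1 == i0 then minn (W il.2) (g ^ (L - l)) else (g ^ (L - l))%N.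

(** In a given cell of level [l], entries are known from their residues modulo [Pl]. In row [i0] the
    parameter itself is recorded when its window is the shorter of the two, which gives the minimum
    in [bnd']. *)
Let cnt_ball l yy : (s <= l <= L)%N ->
  (#|[pred a | PP a && same_cell l yy (T a)]| <= \prod_il bnd' l il)%N.
Proof.
move=> /andP[sl lL]; set Pl := (g ^ (L - l))%N.
have Pl0 : (0 < Pl)%N by rewrite expn_gt0 g0.
have PlL : (Pl <= g ^ L)%N by rewrite leq_exp2l// leq_subr.
have modL k : (k %% Pl < g ^ L)%N by rewrite (leq_trans (ltn_pmod _ Pl0)).
pose F (a : Par) : Par := [ffun il => if (il.1 == i0) && (W il.2 <= Pl)%N then a il
  else Ordinal (modL (T a il.1 il.2))].
apply: leq_trans (card_bounded_ffun _ _).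
have Finj : {in [pred a | PP a && same_cell l yy (T a)] &, injective F}.
  move=> a a'; rewrite !inE => /andP[aP /same_cellP aY] /andP[aP' /same_cellP aY'].
  move=> /ffunP FF.
  have TT i j : ~~ ((i == i0) && (W j <= Pl)%N) -> (T a i j = T a' i j :> nat).
    move=> hij; have := FF (i, j); rewrite !ffunE/= (negbTE hij) => /(congr1 val)/= e1.
    rewrite (divn_eq (T a i j) Pl) (divn_eq (T a' i j) Pl) e1; congr (_ * _ + _)%N.
    by rewrite -aY -aY'.
  have oth i j : i != i0 -> a (i, j) = a' (i, j).
    move=> ii; have := TT i j; rewrite (negbTE ii)/= => /(_ isT).
    rewrite !mxE (negbTE ii)/=; have [xb _] := xo_lt j aP ii; have [xb' _] := xo_lt j aP' ii.
    rewrite !modz_nat !absz_nat !modn_small// => /addnI; exact: val_inj.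
  have bb := T_base oth.
  apply/ffunP => -[i j]; have [ii|ii] := eqVneq i i0; last exact: oth.
  rewrite ii; have [WPl|WPl] := leqP (W j) Pl.
    by have := FF (i0, j); rewrite !ffunE/= eqxx WPl.
  have := TT i0 j; rewrite eqxx/= leqNgt WPl => /(_ isT).
  rewrite !mxE eqxx => /wrap_inj; rewrite /xi bb => E.
  move/forallP/(_ (i0, j)): aP; move/forallP/(_ (i0, j)): aP'; rewrite /bnd/= eqxx => b1 b2.
  have wl := leq_trans (WP j) PL.
  have := E _; rewrite opprD addrACA subrr add0r => E'.
  apply: val_inj => /=; apply/eqP; rewrite -eqz_nat -(inj_eq (addrI (base a' j))); apply/eqP.
  exact: E' (dist_nat_lt b2 b1 wl).
rewrite -(card_in_image Finj); apply/subset_leq_card/fintype.subsetP => _ /fintype.imageP[a + ->].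
rewrite !inE => /andP[aP _]; apply/forallP => -[i j]; rewrite ffunE/= /bnd'/=.
have := forallP aP (i, j); rewrite /bnd/=; case: (eqVneq i i0) => //= [ii|ii] aW.
  case: ifPn => Wl; first by rewrite (minn_idPl Wl).
  move: Wl; rewrite -ltnNge => Wl; rewrite leq_min /= ltn_pmod// andbT.
  exact: leq_trans (ltn_pmod _ Pl0) (ltnW Wl).
by rewrite ltn_pmod.
Qed.

Hypotheses (K_gt0 : 0 < K) (f_ge0 : forall x, 0 <= x -> 0 <= f x)
  (content : forall r, 0 < r ->
     K * \prod_(l < n) Num.max (eta l / h%:R) sig <=
     Phi f (m.-1 * n) (fun l => eta l / h%:R) r).

(** The parametrized points may spread over [(2 * O).+1 ^ n] cells of level [s]; the most popular
    one carries the uniform weight. The ball condition compares [cnt_ball] with the number of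
    parameters, and is the hypothesis [content] at the radius [r = G l]. *)
Lemma piece_exists : exists (z1 : Om) (w : Om -> R),
  (forall i j, exists e k : int, (`|e| <= (m.+3 * P)%:Z)%R /\
     ((z1 i j : nat)%:Z = (z i j : nat)%:Z + e + k * (g ^ L)%:Z)%R) /\
  valid_kernel (in_plank v eta)
    (fun l => (8 * (2 * m.+3).+1%:R) ^+ n * (f (G l) / K)) s z1 w.
Proof.
(* A pigeonhole over the offsets [J], losing [(2 * O).+1 ^ n]. *)
pose cJ J := #|[pred a | PP a && (idx a == J)]|.
have [J hJ] : exists J, (#|PP| <= (2 * O).+1 ^ n * cJ J)%N.
  apply: contrapT => /forallNP hJ.
  have lt J : ((2 * O).+1 ^ n * cJ J < #|PP|)%N by rewrite ltnNge; apply/negP.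
  have E : (#|PP| = \sum_J cJ J)%N.
    rewrite -sum1_card (partition_big idx predT)//=; apply: eq_bigr => J _.
    by rewrite /cJ -sum1_card.
  have c0 : (0 < #|{ffun 'I_n -> 'I_(2 * O).+1}|)%N by rewrite card_ffun !card_ord expn_gt0.
  have : ((2 * O).+1 ^ n * #|PP| < (2 * O).+1 ^ n * #|PP|)%N; last by rewrite ltnn.
  rewrite {1}E big_distrr/=.
  apply: (@leq_trans (\sum_(J : {ffun 'I_n -> 'I_(2 * O).+1}) #|PP|)%N).
    have [J0 _] : exists J0, J0 \in {ffun 'I_n -> 'I_(2 * O).+1} by apply/card_gt0P.
    rewrite (bigD1 J0)//= [X in (_ < X)%N](bigD1 J0)//= -addSn leq_add//.
    by apply: leq_sum => J _; exact: ltnW.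
  by rewrite sum_nat_const card_ffun !card_ord.
have PP0 : (0 < #|PP|)%N.
  rewrite cntE prodn_gt0// => il; rewrite /bnd; case: ifP => _; [exact: W0|exact: P0].
have cJ0 : (0 < cJ J)%N by move: (leq_trans PP0 hJ); rewrite muln_gt0 => /andP[].
have cJR : 0 < (cJ J)%:R :> R by rewrite ltr0n.
pose w (c : Om) : R := #|[pred a | [&& PP a, idx a == J & T a == c]]|%:R / (cJ J)%:R.
have w0 c : 0 <= w c by rewrite divr_ge0.
have wsum (Q : pred Om) : \sum_(c | Q c) w c =
    #|[pred a | [&& PP a, idx a == J & Q (T a)]]|%:R / (cJ J)%:R.
  rewrite -mulr_suml -natr_sum; congr (_%:R / _).
  rewrite -sum1_card (partition_big T Q)/=; last by move=> a; rewrite inE => /and3P[].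
  apply: eq_bigr => c Qc; rewrite -sum1_card; apply: eq_bigl => a; rewrite !inE.
  by case: (T a =P c) => [->|]; rewrite ?Qc ?andbT ?andbF.
exists (zj J), w; split; last split => //.
- move=> i j; rewrite mxE; case: ifPn => [/eqP ->|_]; last first.
    by exists 0, 0; rewrite normr0 mul0r !addr0.
  have [k hk] := wrapE ((z i0 j : nat)%:Z + ((J j : nat)%:Z - O%:Z) * P%:Z).
  exists (((J j : nat)%:Z - O%:Z) * P%:Z), k; split => //.
  rewrite normrM PoszM; apply: ler_pM => //.
  exact: dist_half (ltn_ord (J j)).
- move=> c; rewrite mulf_eq0 negb_or pnatr_eq0 -lt0n => /andP[/card_gt0P[a +] _].
  rewrite inE => /and3P[aP /eqP aJ /eqP <-]; split; last exact: T_plank.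
  by rewrite -aJ; exact: T_cell.
- rewrite wsum; have -> : #|[pred a | [&& PP a, idx a == J & predT (T a)]]| = cJ J.
    by apply: eq_card => a; rewrite !inE andbT.
  by rewrite divff// gt_eqF.
move=> l yy sl; have /andP[sl1 lL] := sl.
rewrite wsum.
have c1 : #|[pred a | [&& PP a, idx a == J & same_cell l yy (T a)]]|%:R <= (\prod_il bnd' l il)%:R :> R.
  rewrite ler_nat (leq_trans _ (cnt_ball yy sl))//.
  by apply/subset_leq_card/fintype.subsetP => a; rewrite !inE => /and3P[-> _ ->].
have c2 : (\prod_il bnd il)%:R <= (2 * O).+1%:R ^+ n * (cJ J)%:R :> R.
  by rewrite -natrX -natrM ler_nat -cntE.
set r := G l; have r0 : 0 < r by rewrite invr_gt0 exprn_gt0.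
have sig0 : 0 < sig by rewrite invr_gt0 exprn_gt0.
have rs : r <= sig by rewrite lef_pV2 ?posrE ?exprn_gt0// ler_eXn2l// ltr1n.
have PlE : (g ^ (L - l))%:R = GL * r :> R.
  by rewrite natrX -{2}(subnK lL) exprD mulfK// gt_eqF ?exprn_gt0.
have b0 : 0 < (\prod_il bnd il)%:R :> R.
  by rewrite ltr0n prodn_gt0// => il; rewrite /bnd; case: ifP => _; [exact: W0|exact: P0].
have m1 : (0 < m)%N by exact: leq_ltn_trans (leq0n _) (ltn_ord i0).
have key : sig ^+ d * (\prod_il bnd' l il)%:R <=
    8 ^+ n * (f r / K) * (\prod_il bnd il)%:R.
  have pE (B : 'I_m * 'I_n -> nat) : (\prod_il B il)%:R =
      \prod_(k < n) \prod_(i < m) (B (i, k))%:R :> R.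
    rewrite natr_prod exchange_big/= pair_bigA/=; apply: eq_bigr => -[] //.
  rewrite !pE.
  have -> : sig ^+ d = \prod_(k < n) sig ^+ m by rewrite prodr_const card_ord -exprM.
  rewrite -big_split/=.
  pose rho k := eta k / h%:R; have rho0 k : 0 < rho k by rewrite divr_gt0.
  (* The estimate column by column. The constant 8 is a factor 4 from [eta / 4] in the window and 2
     from its truncation to an integer. *)
  have col k : sig ^+ m * \prod_(i < m) (bnd' l (i, k))%:R <=
     (8 * (r ^+ m.-1 * Num.max (rho k) sig * Num.min 1 (r / rho k))) *
      \prod_(i < m) (bnd (i, k))%:R.
    rewrite (bigD1 i0)//= [X in _ <= _ * X](bigD1 i0)//= /bnd' /bnd/= eqxx.
    rewrite (eq_bigr (fun=> (g ^ (L - l))%:R)); last by move=> i /negbTE ->.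
    rewrite [X in _ <= _ * (_ * X)](eq_bigr (fun=> P%:R)); last by move=> i /negbTE ->.
    rewrite !prodr_const cardC1 card_ord PlE PRE -sigP !exprMn.
    have -> : sig ^+ m = sig * sig ^+ m.-1 by rewrite -exprS prednK.
    have cc : 0 < sig ^+ m.-1 * GL ^+ m.-1 * r ^+ m.-1 by rewrite !mulr_gt0 ?exprn_gt0.
    set Mn := (minn _ _)%:R.
    have -> : sig * sig ^+ m.-1 * (Mn * (GL ^+ m.-1 * r ^+ m.-1)) =
       (sig ^+ m.-1 * GL ^+ m.-1 * r ^+ m.-1) * (sig * Mn) by ring.
    have -> : 8 * (r ^+ m.-1 * Num.max (rho k) sig * Num.min 1 (r / rho k)) *
       ((W k)%:R * (GL ^+ m.-1 * sig ^+ m.-1)) =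
       (sig ^+ m.-1 * GL ^+ m.-1 * r ^+ m.-1) *
       (8 * (Num.max (rho k) sig * Num.min 1 (r / rho k)) * (W k)%:R) by ring.
    rewrite ler_pM2l//.
    have Mn1 : Mn <= (W k)%:R by rewrite ler_nat geq_minl.
    have Mn2 : Mn <= GL * r by rewrite -PlE ler_nat geq_minr.
    have Wk := Wge k; have Wk0 : 0 < (W k)%:R :> R by rewrite ltr0n W0.
    have qE : q k = Num.min (rho k / 4) sig.
      by rewrite /q /rho; congr (Num.min _ _); field; rewrite gt_eqF.
    rewrite qE in Wk.
    have [rk|rk] := leP sig (rho k).
      rewrite min_r; last by rewrite ler_pdivrMr// mul1r (le_trans rs).
      have -> : 8 * (rho k * (r / rho k)) * (W k)%:R = 8 * r * (W k)%:R.
        by field; rewrite gt_eqF.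
      have q4 : sig / 4 <= Num.min (rho k / 4) sig by rewrite le_min; apply/andP; split; lra.
      have : GL * (sig / 4) <= 2 * (W k)%:R by apply: le_trans Wk; rewrite ler_pM2l.
      move=> h1; have h2 : sig * Mn <= sig * (GL * r) by rewrite ler_pM2l.
      apply: le_trans h2 _.
      have -> : sig * (GL * r) = 4 * r * (GL * (sig / 4)).
        by field; rewrite expf_neq0// gt_eqF.
      have -> : 8 * r * (W k)%:R = 4 * r * (2 * (W k)%:R) by ring.
      by rewrite ler_pM2l// mulr_gt0.
    rewrite -mulrA mulrCA -mulrA ler_pM2l// .
    have q4 : rho k / 4 <= Num.min (rho k / 4) sig by rewrite le_min lexx/=; have := rho0 k; lra.
    have h1 : GL * (rho k / 4) <= 2 * (W k)%:R by apply: le_trans Wk; rewrite ler_pM2l.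
    rewrite /Num.min; case: ifP => _; first by rewrite mul1r; lra.
    rewrite mulrC; have h2 : (W k)%:R * (r / rho k) * 8 = (2 * (W k)%:R) * (4 * (r / rho k)) by ring.
    have rr : 0 < 4 * (r / rho k) by rewrite mulr_gt0// divr_gt0.
    apply: le_trans Mn2 _.
    have : GL * (rho k / 4) * (4 * (r / rho k)) <= 2 * (W k)%:R * (4 * (r / rho k)) by rewrite ler_pM2r.
    have -> : GL * (rho k / 4) * (4 * (r / rho k)) = GL * r by field; rewrite gt_eqF.
    by move/le_trans; apply; apply: ler_eq; ring.
  apply: (@le_trans _ _ (\prod_(k < n) ((8 * (r ^+ m.-1 * Num.max (rho k) sig * Num.min 1 (r / rho k))) *
      \prod_(i < m) (bnd (i, k))%:R))).
    apply: ler_prod => k _; rewrite col andbT mulr_ge0 ?exprn_ge0 ?(ltW sig0)//.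
    by apply: prodr_ge0.
  rewrite big_split/=; apply: ler_wpM2r; first by do 2 (apply: prodr_ge0 => ? _).
  rewrite big_split/= prodr_const card_ord ler_pM2l ?exprn_gt0//.
  rewrite ler_pdivlMr//; have := content r0; rewrite /Phi => hc.
  have min0 k : 0 < Num.min 1 (r / rho k) by rewrite lt_min ltr01 divr_gt0.
  pose Mx := \prod_(k < n) Num.min 1 (r / rho k).
  have Mx0 : 0 < Mx by rewrite prodr_gt0.
  have mm k : Num.min 1 (r / rho k) * Num.max 1 (rho k / r) = 1.
    have E : rho k / r = (r / rho k)^-1 by rewrite invf_div.
    rewrite E; have x0 : 0 < r / rho k by rewrite divr_gt0.
    move: (r / rho k) x0 => x x0; have [x1|x1] := leP 1 x.
      by rewrite max_l ?mul1r// invf_le1.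
    by rewrite max_r ?mulfV ?gt_eqF// invf_ge1// ltW.
  have rr0 : 0 < r ^+ (m.-1 * n) by rewrite exprn_gt0.
  have := ler_wpM2r (ltW (mulr_gt0 Mx0 rr0)) hc.
  have -> : f r * r ^- (m.-1 * n) * \prod_(k < n) Num.max 1 (eta k / h%:R / r) * (Mx * r ^+ (m.-1 * n)) =
      f r * (\prod_(k < n) (Num.min 1 (r / rho k) * Num.max 1 (rho k / r))).
    by rewrite big_split/= -/Mx -/(rho _); field; rewrite gt_eqF.
  have -> : \prod_(k < n) (Num.min 1 (r / rho k) * Num.max 1 (rho k / r)) = 1.
    by rewrite big1.
  rewrite mulr1 => /(le_trans _); apply.
  rewrite big_split/= big_split/= prodr_const card_ord -exprM -/Mx.
  by apply: ler_eq; ring.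
have n0 : 0 < (2 * O).+1%:R ^+ n :> R by rewrite exprn_gt0// ltr0n.
rewrite [leLHS]mulrA ler_pdivrMr//.
apply: (@le_trans _ _ (sig ^+ d * (\prod_il bnd' l il)%:R)).
  by rewrite ler_pM2l// exprn_gt0.
apply: (le_trans key); rewrite exprMn -/O.
have fK : 0 <= f r / K by rewrite divr_ge0 ?f_ge0// ltW.
have -> : 8 ^+ n * (2 * O).+1%:R ^+ n * (f r / K) * (cJ J)%:R =
   8 ^+ n * (f r / K) * ((2 * O).+1%:R ^+ n * (cJ J)%:R) by ring.
by apply: ler_wpM2l c2; rewrite mulr_ge0// exprn_ge0.
Qed.

End Piece.

(** * Counting near-fractions on a grid *)

Section Counting.
Context {R : realType}.

Lemma card_window (N D : nat) (S : pred 'I_N) :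
  (forall a b, S a -> S b -> (a - b <= D)%N) -> (#|S| <= D.+1)%N.
Proof.
move=> h; have [S0|S0] := posnP #|S|; first by rewrite S0.
move/card_gt0P: (S0) => [a0 Sa0].
have [a Sa amin] := @arg_minnP _ a0 S (fun a => a : nat) Sa0.
have inj : {in S &, injective (fun b : 'I_N => inord (b - a) : 'I_D.+1)}.
  move=> b c Sb Sc /(congr1 val); rewrite /= !inordK ?ltnS ?h// => bc.
  by apply: val_inj => /=; have := amin b Sb; have := amin c Sc; move: bc; clear; lia.
by rewrite -(card_in_image inj) (leq_trans (max_card _))// card_ord.
Qed.

Lemma card_union_le (I T : finType) (S : pred I) (A : I -> pred T) :
  (#|[pred y | [exists p, S p && A p y]]| <= \sum_(p | S p) #|A p|)%N.
Proof.
apply: (@leq_trans #|\bigcup_(p | S p) [set y | A p y]%SET|).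
  apply/subset_leq_card/fintype.subsetP => y /existsP[p /andP[Sp Ap]].
  by apply/bigcupP; exists p => //; rewrite inE.
elim/big_ind2: _ => [|B b C c hB hC|p _].
- by rewrite cards0.
- by rewrite (leq_trans (leq_card_setU _ _))// leq_add.
- by rewrite cardsE.
Qed.

Lemma truncn_ge (k : nat) (x : R) : k%:R <= x -> (k <= Num.truncn x)%N.
Proof. by move=> kx; rewrite -[k](@natrK R) le_truncn. Qed.

Lemma card_window_real (N : nat) (S : pred 'I_N) (D : R) : 0 <= D ->
  (forall a b : 'I_N, S a -> S b -> (a : nat)%:R - (b : nat)%:R <= D) ->
  #|S|%:R <= D + 1.
Proof.
move=> D0 h; apply: (@le_trans _ _ (Num.truncn D).+1%:R).
  rewrite ler_nat; apply: card_window => a b Sa Sb; apply: truncn_ge.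
  have [ab|ab] := leqP a b; first by move: ab; rewrite -subn_eq0 => /eqP ->.
  by rewrite natrB ?h// ltnW.
by rewrite -natr1 lerD2r truncn_le.
Qed.

(* The reduced fractions p / k and p' / k' below are distinct, so that no term
   proportional to the greatest common divisor of k and k' appears. *)
Definition near_frac (M k : nat) (eta : R) (y : nat) :=
  exists p : int, coprime `|p|%N k /\ `|k%:R * y%:R - p%:~R * M%:R| <= eta * M%:R.

(** The map [p -> p * k' mod k] takes only multiples of [d = gcdn k k'], each at most [d] times.
    There are at most [2 * Z / d] nonzero ones within [Z] of 0 or [k], so [d] cancels; the residue
    zero would have added a term [d]. *)
Lemma card_residues (k k' : nat) (Z : R) : (0 < k)%N -> 0 <= Z ->
  #|[pred p : 'I_k | (0 < (p * k') %% k)%N &&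
     `[< ((p * k') %% k)%N%:R <= Z \/ (k - (p * k') %% k)%N%:R <= Z >]]|%:R <= 2 * Z.
Proof.
move=> k0 Z0; pose d := gcdn k k'; have d0 : (0 < d)%N by rewrite gcdn_gt0 k0.
have kE : k = (k %/ d * d)%N by rewrite divnK// dvdn_gcdl.
have kE' : k' = (k' %/ d * d)%N by rewrite divnK// dvdn_gcdr.
set k1 := (k %/ d)%N in kE; set k2 := (k' %/ d)%N in kE'.
have k10 : (0 < k1)%N by move: k0; rewrite kE muln_gt0 => /andP[].
have cop : coprime k1 k2.
  by rewrite /coprime -(eqn_pmul2r d0) mul1n muln_gcdl -kE -kE'.
have resE p : ((p * k') %% k = ((p * k2) %% k1) * d)%N.
  by rewrite kE' mulnA kE -muln_modl.
pose D := Num.truncn (Z / d%:R).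
have dR0 : 0 < d%:R :> R by rewrite ltr0n.
have Dd : D%:R * d%:R <= Z by rewrite -ler_pdivlMr// truncn_le// divr_ge0// ltW.
pose J := [pred r : 'I_k1 | (0 < r)%N && ((r <= D)%N || (k1 - r <= D)%N)].
have cJ : (#|J| <= 2 * D)%N.
  have -> : (2 * D = D + D)%N by lia.
  have [D0|D0] := posnP D.
    rewrite D0 leqn0; apply/eqP/eq_card0 => r; rewrite !inE D0.
    by have := ltn_ord r; lia.
  apply: (@leq_trans (#|[pred r : 'I_k1 | (0 < r <= D)%N]| + #|[pred r : 'I_k1 | (k1 - r <= D)%N]|)%N).
    rewrite -cardUI; apply: leq_trans (leq_addr _ _).
    apply/subset_leq_card/fintype.subsetP => r; rewrite !inE => /andP[-> /orP[->|->]] //.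
    by rewrite orbT.
  apply: leq_add; rewrite -[X in (_ <= X)%N](prednK D0); apply: card_window => a b; rewrite !inE.
    by lia.
  by have := ltn_ord a; have := ltn_ord b; lia.
have cI : (#|[pred p : 'I_k | (0 < (p * k') %% k)%N &&
     `[< ((p * k') %% k)%N%:R <= Z \/ (k - (p * k') %% k)%N%:R <= Z >]%R]| <= d * #|J|)%N.
  have pd (p : 'I_k) : (p %/ k1 < d)%N by rewrite ltn_divLR// mulnC -kE.
  have pr (p : 'I_k) : ((p * k2) %% k1 < k1)%N by rewrite ltn_pmod.
  pose F (p : 'I_k) : 'I_d * 'I_k1 := (Ordinal (pd p), Ordinal (pr p)).
  have Finj : injective F.
    move=> p p' [e1 e2]; apply: val_inj => /=.
    have e3 : (p %% k1 = p' %% k1)%N.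
      apply/eqP.
      have h : (p * k2 == p' * k2 %[mod k1])%N by apply/eqP.
      have [pp|pp] := leqP p' p.
        move: h; rewrite eqn_mod_dvd ?leq_mul2r ?pp ?orbT// -mulnBl Gauss_dvdl//.
        by rewrite -eqn_mod_dvd.
      move: h; rewrite eq_sym eqn_mod_dvd ?leq_mul2r ?(ltnW pp) ?orbT// -mulnBl Gauss_dvdl//.
      by rewrite -eqn_mod_dvd ?(ltnW pp)// eq_sym.
    by rewrite (divn_eq p k1) (divn_eq p' k1) e1 e3.
  have -> : d = #|'I_d| by rewrite card_ord.
  have : (#|[predX (predT : pred 'I_d) & J]| = #|'I_d| * #|J|)%N.
    by rewrite cardX; congr (_ * _)%N; apply: eq_card.
  move=> <-; rewrite -(card_in_image (in2W Finj)).
  apply/subset_leq_card/fintype.subsetP => _ /fintype.imageP[p + ->].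
  rewrite inE => /andP[p0 /asboolP pZ].
  suff : J (Ordinal (pr p)) by move=> h; apply/andP; split.
  rewrite /= ; move: p0 pZ; rewrite resE muln_gt0 => /andP[-> _]/=.
  have rk : ((p * k2) %% k1 < k1)%N by rewrite ltn_pmod.
  case=> h; apply/orP; [left|right]; apply: truncn_ge; rewrite ler_pdivlMr//.
    by rewrite -natrM.
  apply: le_trans h; rewrite -natrM ler_nat mulnBl leq_sub2r//.
  by rewrite -kE.
apply: (@le_trans _ _ ((d * (2 * D))%:R)).
  by rewrite ler_nat (leq_trans cI)// leq_mul2l cJ orbT.
by rewrite !natrM mulrCA ler_pM2l// mulrC.
Qed.

Lemma small_residue (k r : nat) (c z : int) : (z = c * k%:Z + r%:Z)%R -> (r < k)%N ->
  (4 * `|z| <= k%:Z)%R -> z != 0 -> (0 < r)%N /\ (r%:Z = `|z| \/ (k%:Z - r%:Z = `|z|))%R.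
Proof.
move=> zc rk zk zN; have : c = 0 \/ c = -1 by nia.
by case=> cE; rewrite cE in zc; lia.
Qed.

(** If [y / M] is near both [p / k] and [p' / k'], then [p * k' - p' * k] is a nonzero integer of
    size at most [Z = 2 * k * eta'], which leaves [2 * Z] choices of [p]. Each has at most
    [3 * eta * M / k] points [y], the hypothesis [k <= eta * M] absorbing the rounding. *)
Lemma near_frac_overlap_le (M k k' : nat) (eta eta' : R) :
  (0 < k)%N -> (0 < k')%N -> k != k' -> (0 < M)%N -> 0 < eta <= 1 / 8 -> 0 < eta' <= 1 / 8 ->
  k%:R <= eta * M%:R -> eta * k'%:R <= eta' * k%:R ->
  #|[pred y : 'I_M | `[< near_frac M k eta y /\ near_frac M k' eta' y >]]|%:R
  <= 12 * (eta * eta') * M%:R.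
Proof.
move=> k0 k'0 kk M0 /andP[e0 e8] /andP[e0' e8'] kM ee.
have kR : 0 < k%:R :> R by rewrite ltr0n.
have MR : 0 < M%:R :> R by rewrite ltr0n.
pose Z := 2 * k%:R * eta'.
have Z0 : 0 <= Z by rewrite !mulr_ge0// ltW.
pose S := [pred p : 'I_k | (0 < (p * k') %% k)%N &&
     `[< ((p * k') %% k)%N%:R <= Z \/ (k - (p * k') %% k)%N%:R <= Z >]].
pose I (p : 'I_k) := [pred y : 'I_M | `|k%:R * (y : nat)%:R - (p : nat)%:R * M%:R| <= eta * M%:R].
have sub : (#|[pred y : 'I_M | `[< near_frac M k eta y /\ near_frac M k' eta' y >]]| <=
    \sum_(p | S p) #|I p|)%N.
  apply: (@leq_trans #|[pred y | [exists p, S p && I p y]]|).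
    apply/subset_leq_card/fintype.subsetP => y hy.
    have {hy}[[p [cp hp]] [p' [cp' hp']]] : near_frac M k eta y /\ near_frac M k' eta' y.
      by apply/asboolP; exact: hy.
    change (is_true [exists p, S p && I p y]).
    pose z : int := p * k'%:Z - p' * k%:Z.
    have zE : z%:~R * M%:R = k%:R * (k'%:R * (y : nat)%:R - p'%:~R * M%:R) -
        k'%:R * (k%:R * (y : nat)%:R - p%:~R * M%:R) :> R.
      by rewrite /z rmorphB/= !rmorphM/= -!pmulrn; ring.
    have zb : `|z%:~R : R| <= Z.
      rewrite -(ler_pM2r MR) -{1}(gtr0_norm MR) -normrM zE.
      apply: le_trans (ler_normB _ _) _; rewrite !normrM !normr_nat.
      have h1 : k%:R * `|k'%:R * (y : nat)%:R - p'%:~R * M%:R| <= k%:R * (eta' * M%:R) by rewrite ler_pM2l.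
      have h2 : k'%:R * `|k%:R * (y : nat)%:R - p%:~R * M%:R| <= k'%:R * (eta * M%:R) by rewrite ler_wpM2l.
      have h3 : eta * k'%:R * M%:R <= eta' * k%:R * M%:R by rewrite ler_pM2r.
      by rewrite /Z; lra.
    (* If the two reduced fractions agreed, [k] and [k'] would divide each other. *)
    have zN : z != 0.
      apply/eqP => z0; move/eqP: (z0); rewrite subr_eq0 => /eqP/(congr1 absz).
      rewrite !abszM !absz_nat => h; move/eqP: kk; apply.
      apply/eqP; rewrite eqn_dvd; apply/andP; split.
        by rewrite -(@Gauss_dvdr _ `|p|) 1?coprime_sym// h dvdn_mull.
      by rewrite -(@Gauss_dvdr _ `|p'|) 1?coprime_sym// -h dvdn_mull.
    have Zk : Z <= k%:R / 4 by rewrite /Z; nra.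
    have zk : (4 * `|z| <= k%:Z)%R.
      rewrite -(ler_int R) rmorphM/= intr_norm -pmulrn.
      by rewrite -[(4 : int)%:~R]/(4 : R); lra.
    have k2 : (2 <= k)%N by move: zk zN; clear; lia.
    have pb : (0 <= p <= k%:Z)%R.
      have y0 : 0 <= (y : nat)%:R :> R by [].
      have y1 : (y : nat)%:R + 1 <= M%:R :> R by rewrite natr1 ler_nat.
      move: hp; rewrite ler_norml => /andP[h1 h2].
      have b1 : -1 < p%:~R :> R by rewrite -(ltr_pM2r MR); nra.
      have b2 : p%:~R < k%:R + 1 :> R by rewrite -(ltr_pM2r MR); nra.
      have b1' : (-1 < p)%R by rewrite -(ltr_int R).
      have b2' : (p < k%:Z + 1)%R by rewrite -(ltr_int R) rmorphD.
      by move: b1' b2'; clear; lia.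
    have pk : (0 < p < k%:Z)%R.
      have : p != 0 by apply: contraTneq cp => ->; rewrite absz0 /coprime gcd0n; move: k2; clear; lia.
      have : p != k%:Z by apply: contraTneq cp => ->; rewrite absz_nat /coprime gcdnn; move: k2; clear; lia.
      by move: pb; clear; lia.
    have pn : (absz p < k)%N by move: pk; clear; lia.
    have pE : (absz p)%:Z = p by move: pk; clear; lia.
    apply/existsP; exists (Ordinal pn); apply/andP; split; last first.
      by rewrite /= -[(absz p)%:R]/((absz p)%:Z%:~R) pE.
    pose r := (absz p * k' %% k)%N.
    have rE : ((absz p * k')%N%:Z = (absz p * k' %/ k)%N%:Z * k%:Z + r%:Z)%R.
      by rewrite {1}(divn_eq (absz p * k') k) PoszD PoszM.
    have zr : exists c : int, (z = c * k%:Z + r%:Z)%R.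
      exists ((absz p * k' %/ k)%N%:Z - p')%R.
      by rewrite /z -pE -PoszM rE; ring.
    have rk : (r < k)%N by rewrite ltn_pmod.
    have [c zc] := zr.
    have : (0 < r)%N /\ (r%:Z = `|z| \/ (k%:Z - r%:Z = `|z|))%R.
      exact: small_residue zc rk zk zN.
    rewrite /= -/r => -[r0 rz]; rewrite r0/=; apply/asboolP.
    case: rz => rz; [left|right].
      by rewrite -[r%:R]/(r%:Z%:~R) rz intr_norm.
    by rewrite natrB ?(ltnW rk)// -[r%:R]/(r%:Z%:~R) -[k%:R]/(k%:Z%:~R) -rmorphB/= rz intr_norm.
  exact: card_union_le.
apply: (@le_trans _ _ (\sum_(p | S p) (3 * eta * M%:R / k%:R))).
  apply: (@le_trans _ _ (\sum_(p | S p) #|I p|)%:R); first by rewrite ler_nat.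
  rewrite natr_sum; apply: ler_sum => p _.
  apply: (@le_trans _ _ (2 * eta * M%:R / k%:R + 1)).
    apply: card_window_real; first by rewrite !divr_ge0 ?mulr_ge0 ?ltW.
    move=> a b; rewrite /= !ler_norml => /andP[a1 a2] /andP[b1 b2].
    rewrite ler_pdivlMr// mulrC; lra.
  have : 1 <= eta * M%:R / k%:R by rewrite ler_pdivlMr// mul1r.
  have -> : 2 * eta * M%:R / k%:R = 2 * (eta * M%:R / k%:R) by ring.
  have -> : 3 * eta * M%:R / k%:R = 3 * (eta * M%:R / k%:R) by ring.
  lra.
rewrite sumr_const -[leLHS]mulr_natl.
have cS : #|S|%:R <= 2 * Z by exact: card_residues.
have p0 : 0 <= 3 * eta * M%:R / k%:R by rewrite !mulr_ge0 ?invr_ge0// ltW.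
apply: le_trans (ler_wpM2r p0 cS) _.
by apply: ler_eq; rewrite /Z; field; rewrite gt_eqF.
Qed.

Lemma near_frac_overlap (M k k' : nat) (eta eta' : R) :
  (0 < k)%N -> (0 < k')%N -> k != k' -> (0 < M)%N -> 0 < eta <= 1 / 8 -> 0 < eta' <= 1 / 8 ->
  k%:R <= eta * M%:R -> k'%:R <= eta' * M%:R ->
  #|[pred y : 'I_M | `[< near_frac M k eta y /\ near_frac M k' eta' y >]]|%:R
  <= 12 * (eta * eta') * M%:R.
Proof.
move=> k0 k'0 kk M0 he he' kM kM'.
have [ee|ee] := leP (eta * k'%:R) (eta' * k%:R); first exact: near_frac_overlap_le.
have := near_frac_overlap_le k'0 k0 _ M0 he' he kM' (ltW ee); rewrite eq_sym kk => /(_ isT).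
rewrite (mulrC eta' eta); apply: le_trans.
rewrite ler_nat; apply/subset_leq_card/fintype.subsetP => y hy.
suff : near_frac M k' eta' y /\ near_frac M k eta y by move/asboolP.
have [] : near_frac M k eta y /\ near_frac M k' eta' y by apply/asboolP; exact: hy.
by split.
Qed.

Lemma near_frac_count (M k : nat) (eta : R) : (0 < k)%N -> (0 < M)%N ->
  0 < eta <= 1 / 8 -> k%:R <= eta * M%:R ->
  (totient k)%:R * (eta * M%:R / (2 * k%:R)) <=
  #|[pred y : 'I_M | `[< near_frac M k eta y >]]|%:R.
Proof.
move=> k0 M0 /andP[e0 e8] kM.
have kR : 0 < k%:R :> R by rewrite ltr0n.
have MR : 0 < M%:R :> R by rewrite ltr0n.
pose x := eta * M%:R / k%:R; have x1 : 1 <= x by rewrite ler_pdivlMr// mul1r.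
have x0 : 0 <= x by exact: le_trans x1.
pose W := Num.truncn x.
have Wx : x <= 2 * W%:R.
  have := truncn_gt x0; rewrite -natr1 -/W => h1.
  have : (1 <= W)%N by exact: truncn_ge.
  by rewrite -(ler_nat R); lra.
have Wle : W%:R * k%:R <= eta * M%:R by rewrite -ler_pdivlMr// truncn_le.
(* The quotient with [k.-1] is the ceiling of [p * M / k]. Only points to the right of the fraction
   are used, and [W * k <= M] keeps the windows of different [p] disjoint. *)
pose Y p o : nat := ((p * M + k.-1) %/ k + o)%N.
have Yb (p : 'I_k) (o : 'I_W) : (p * M <= k * Y p o /\ k * Y p o + 1 <= p * M + W * k)%N.
  rewrite /Y; have e := divn_eq (p * M + k.-1) k; have r := ltn_pmod (p * M + k.-1) k0.
  have := ltn_ord o; move: e r; move: ((p * M + k.-1) %/ k)%N ((p * M + k.-1) %% k)%N (p * M)%N (o : nat).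
  by clear -k0 => q r b c e rk cW; nia.
have YM (p : 'I_k) (o : 'I_W) : (Y p o < M)%N.
  have [_ h] := Yb p o; have := ltn_ord p => pk.
  have WkM : (W * k <= M)%N by rewrite -(ler_nat R) natrM (le_trans Wle)//; nra.
  have : (p * M + M <= k * M)%N by rewrite -mulSnr leq_mul2r pk orbT.
  by move: h WkM; clear -k0; nia.
pose F (po : 'I_k * 'I_W) : 'I_M := Ordinal (YM po.1 po.2).
have Finj : injective F.
  move=> [p o] [p' o'] /(congr1 val)/= e.
  have [h1 h2] := Yb p o; have [h1' h2'] := Yb p' o'.
  have WkM : (W * k <= M)%N by rewrite -(ler_nat R) natrM (le_trans Wle)//; nra.
  have pp : p = p'.
    apply: val_inj => /=; move: h1 h2 h1' h2' WkM; rewrite e.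
    by move: (k * Y p' o')%N (W * k)%N (p : nat) (p' : nat); clear; nia.
  by subst p'; move/addnI: e => /val_inj ->.
pose P := [pred p : 'I_k | coprime k p].
have cP : #|P| = totient k.
  by rewrite totient_count_coprime big_mkord -sum1_card big_mkcond/=; apply: eq_bigr => i _; rewrite inE; case: coprime.
have : (#|[predX P & predT : pred 'I_W]| <= #|[pred y : 'I_M | `[< near_frac M k eta y >]]|)%N.
  rewrite -(card_in_image (in2W Finj)); apply/subset_leq_card/fintype.subsetP => _ /fintype.imageP[[p o] + ->].
  move=> /andP[/= cp _]; apply/asboolP; exists (p : nat)%:Z.
  rewrite absz_nat coprime_sym; split => //=.
  have [h1 h2] := Yb p o.
  have h1' : (p : nat)%:R * M%:R <= k%:R * (Y p o)%:R :> R by rewrite -!natrM ler_nat.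
  have h2' : k%:R * (Y p o)%:R + 1 <= (p : nat)%:R * M%:R + W%:R * k%:R :> R.
    by rewrite -!natrM natr1 -natrD ler_nat -addn1.
  by rewrite ger0_norm ?subr_ge0// -[((p : nat)%:Z)%:~R]/((p : nat)%:R); lra.
rewrite cardX cP.
have -> : #|predT : pred 'I_W| = W by rewrite -[RHS](card_ord W); apply: eq_card.
rewrite -(ler_nat R) natrM; apply: le_trans; rewrite ler_wpM2l//.
have -> : eta * M%:R / (2 * k%:R) = x / 2 by rewrite /x; field; rewrite gt_eqF.
lra.
Qed.

End Counting.

(** * Second moments on a prime grid *)

Section PrimeGrid.
Context {R : realType} {m n : nat}.
Variable (M : nat).
Hypothesis Mp : prime M.

Let M0 : (0 < M)%N. Proof. exact: prime_gt0. Qed.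

Local Notation col := {ffun 'I_m -> 'I_M}.

Definition lin_form (w : 'I_m -> nat) (x : col) : nat := (\sum_i w i * x i)%N.

Lemma residue_proof (w : 'I_m -> nat) (x : col) : (lin_form w x %% M < M)%N.
Proof. by rewrite ltn_pmod. Qed.

Definition residue (w : 'I_m -> nat) (x : col) : 'I_M := Ordinal (residue_proof w x).

Lemma card_family_prod (aT rT : finType) (S : aT -> pred rT) :
  #|family (fun i => mem (S i)) : {pred {ffun aT -> rT}}| = (\prod_i #|S i|)%N.
Proof.
rewrite card_family foldrE big_map big_enum/=.
by apply: eq_bigr => i _; apply: eq_card.
Qed.

Lemma card_preim_inj (T : finType) (F : T -> T) (A : {pred T}) : injective F ->
  #|[pred x | F x \in A]| = #|A|.
Proof.
move=> Finj; rewrite -[LHS](fintype.card_image Finj); apply: eq_card => y.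
apply/fintype.imageP/idP => [[x xA ->]|yA]; first exact: xA.
by exists (invF Finj y); rewrite ?f_invF// inE/= f_invF.
Qed.

Lemma residue_dvd (w : 'I_m -> nat) (x x' : col) : residue w x = residue w x' ->
  (M%:Z %| \sum_i (w i)%:Z * ((x i : nat)%:Z - (x' i : nat)%:Z))%Z.
Proof.
move=> /(congr1 val)/= e.
have -> : \sum_i (w i)%:Z * ((x i : nat)%:Z - (x' i : nat)%:Z) =
    (lin_form w x)%:Z - (lin_form w x')%:Z.
  rewrite /lin_form -!natz !natr_sum -sumrB; apply: eq_bigr => i _.
  by rewrite !natrM mulrBr !natz.
by rewrite -eqz_mod_dvd; apply/eqP; rewrite !modz_nat e.
Qed.

Lemma ord_dvd_eq (a b : 'I_M) : (M%:Z %| (a : nat)%:Z - (b : nat)%:Z)%Z -> a = b.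
Proof.
rewrite -eqz_mod_dvd !modz_nat !modn_small// => /eqP[ab].
exact: val_inj.
Qed.

Lemma dvd_prime_small (a z : int) : a != 0 -> (absz a < M)%N ->
  (M%:Z %| a * z)%Z -> (M%:Z %| z)%Z.
Proof.
move=> a0 aM; rewrite !dvdzE abszM absz_nat Euclid_dvdM// => /orP[|//].
by move/dvdn_leq; rewrite absz_gt0 => /(_ a0); rewrite leqNgt aM.
Qed.

Lemma card_residue (w : 'I_m -> nat) (i1 : 'I_m) (P : pred 'I_M) : (0 < w i1 < M)%N ->
  #|[pred x : col | P (residue w x)]| = (#|P| * M ^ m.-1)%N.
Proof.
move=> /andP[w0 wM].
pose F (x : col) : col := [ffun i => if i == i1 then residue w x else x i].
have Finj : injective F.
  move=> x x' /ffunP e.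
  have eo i : i != i1 -> x i = x' i by move=> ii; have := e i; rewrite !ffunE (negPf ii).
  have := e i1; rewrite !ffunE eqxx => /residue_dvd.
  rewrite (bigD1 i1)//= big1 ?addr0 => [/dvd_prime_small h|i /eo ->]; last by rewrite subrr mulr0.
  apply/ffunP => i; have [->|/eo//] := eqVneq i i1.
  by apply: ord_dvd_eq; apply: h; rewrite ?absz_nat// -lt0n.
pose S i : pred 'I_M := if i == i1 then P else predT.
have <- : #|family (fun i => mem (S i)) : {pred col}| = (#|P| * M ^ m.-1)%N.
  rewrite card_family_prod (bigD1 i1)//= /S eqxx; congr (_ * _)%N.
  rewrite (eq_bigr (fun=> M)) => [|i /negPf ->]; last by rewrite -[RHS]card_ord; apply: eq_card.
  by rewrite prod_nat_const; congr (_ ^ _)%N; rewrite cardC1 card_ord.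
rewrite -[RHS](card_preim_inj _ Finj).
apply: eq_card => x; rewrite inE/= [RHS]inE/=; apply/idP/familyP => [Px i|/(_ i1)].
  by rewrite ffunE /S; case: eqP.
by rewrite ffunE /S eqxx.
Qed.

(** Replacing the entries [i1] and [i2] by the two residues is injective: the minor is nonzero and
    smaller than the prime [M], hence invertible modulo [M]. So the two residues are independent. *)
Lemma card_residue2 (w w' : 'I_m -> nat) (i1 i2 : 'I_m) (P P' : pred 'I_M) :
  (forall i j, w i * w' j < M)%N -> (w i1 * w' i2 != w i2 * w' i1)%N ->
  #|[pred x : col | P (residue w x) && P' (residue w' x)]| = (#|P| * #|P'| * M ^ m.-2)%N.
Proof.
move=> wM minor.
have i12 : i2 != i1 by apply: contraNneq minor => ->.
pose F (x : col) : col := [ffun i => if i == i1 then residue w x else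
  if i == i2 then residue w' x else x i].
pose D : int := (w i1 * w' i2)%N%:Z - (w i2 * w' i1)%N%:Z.
have D0 : D != 0 by rewrite subr_eq0; apply: contraNneq minor => -[->].
have DM : (absz D < M)%N.
  by rewrite /D; have := wM i1 i2; have := wM i2 i1; move: (w i1 * w' i2)%N (w i2 * w' i1)%N; clear; lia.
have Finj : injective F.
  move=> x x' /ffunP e.
  have eo i : i != i1 -> i != i2 -> x i = x' i.
    by move=> ii ij; have := e i; rewrite !ffunE (negPf ii) (negPf ij).
  pose d i : int := (x i : nat)%:Z - (x' i : nat)%:Z.
  have sumE (u : 'I_m -> nat) : \sum_i (u i)%:Z * d i = (u i1)%:Z * d i1 + (u i2)%:Z * d i2.
    rewrite (bigD1 i1)//= (bigD1 i2)//= big1 ?addr0// => i /andP[ii ij].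
    by rewrite /d eo// subrr mulr0.
  have := e i1; rewrite !ffunE eqxx => /residue_dvd; rewrite sumE => h1.
  have := e i2; rewrite !ffunE eqxx (negPf i12) => /residue_dvd; rewrite sumE => h2.
  have d1 : (M%:Z %| d i1)%Z.
    apply: (dvd_prime_small D0 DM).
    have -> : D * d i1 = (w' i2)%:Z * ((w i1)%:Z * d i1 + (w i2)%:Z * d i2) -
        (w i2)%:Z * ((w' i1)%:Z * d i1 + (w' i2)%:Z * d i2) by rewrite /D !PoszM; ring.
    by rewrite rpredB// dvdz_mull.
  have d2 : (M%:Z %| d i2)%Z.
    apply: (dvd_prime_small D0 DM).
    have -> : D * d i2 = (w i1)%:Z * ((w' i1)%:Z * d i1 + (w' i2)%:Z * d i2) -
        (w' i1)%:Z * ((w i1)%:Z * d i1 + (w i2)%:Z * d i2) by rewrite /D !PoszM; ring.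
    by rewrite rpredB// dvdz_mull.
  apply/ffunP => i; have [->|ii1] := eqVneq i i1; first exact: ord_dvd_eq.
  have [->|ii2] := eqVneq i i2; first exact: ord_dvd_eq.
  exact: eo.
pose S i : pred 'I_M := if i == i1 then P else if i == i2 then P' else predT.
have <- : #|family (fun i => mem (S i)) : {pred col}| = (#|P| * #|P'| * M ^ m.-2)%N.
  rewrite card_family_prod (bigD1 i1)//= (bigD1 i2)//= /S eqxx (negPf i12) eqxx mulnA; congr (_ * _)%N.
  rewrite (eq_bigr (fun=> M)) => [|i /andP[/negPf -> /negPf ->]]; last by rewrite -[RHS]card_ord; apply: eq_card.
  rewrite prod_nat_const; congr (_ ^ _)%N.
  have := cardD1 i2 (predC1 i1); rewrite cardC1 card_ord inE i12 add1n => -> /=.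
  by apply: eq_card => i; rewrite !inE andbC.
rewrite -[RHS](card_preim_inj _ Finj).
apply: eq_card => x; rewrite inE/= [RHS]inE/=; apply/andP/familyP => [[Px Px'] i|h].
  by rewrite ffunE /S; case: eqP => // _; case: eqP.
by have := h i1; have := h i2; rewrite !ffunE /S !eqxx (negPf i12).
Qed.

Definition gcdv (v : 'I_m -> nat) : nat := \big[gcdn/0%N]_i v i.

Lemma gcdv_dvd v i : (gcdv v %| v i)%N.
Proof. by rewrite /gcdv (bigD1 i)//= dvdn_gcdl. Qed.

Lemma gcdv_mul c v : (c * gcdv v = gcdv (fun i => c * v i))%N.
Proof. by rewrite /gcdv (big_morph (muln c) (@muln_gcdr c) (muln0 c)). Qed.

Definition near_col (v : 'I_m -> nat) (eta : R) (x : col) :=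
  exists p : int, coprime (absz p) (gcdv v) /\
    `|(lin_form v x)%:R - p%:~R * M%:R| <= eta * M%:R.

(** With [v = k w] and [k = gcdv v], reducing the form of [w] modulo [M] shifts [p] by a multiple of
    [k], which preserves coprimality. *)
Lemma near_colE (v : 'I_m -> nat) (eta : R) (x : col) :
  near_col v eta x <->
  near_frac M (gcdv v) eta (residue (fun i => v i %/ gcdv v)%N x).
Proof.
set k := gcdv v; set w := fun i => (v i %/ k)%N.
have -> : near_col v eta x <-> exists p : int, coprime (absz p) k /\
    `|(k * lin_form w x)%N%:R - p%:~R * M%:R| <= eta * M%:R.
  have -> : (k * lin_form w x = lin_form v x)%N; last by [].
  rewrite /lin_form big_distrr/=; apply: eq_bigr => i _.
  by rewrite mulnA [(k * _)%N]mulnC divnK// gcdv_dvd.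
have E := divn_eq (lin_form w x) M; set c := (lin_form w x %/ M)%N in E.
have copE (p q : int) : coprime (absz (p + q * k%:Z)) k = coprime (absz p) k.
  have cE z : coprime (absz z) k = coprimez k%:Z z by rewrite coprime_sym coprimezE.
  by rewrite !cE /coprimez addrC gcdzMDl.
split=> -[p [cp hp]]; [exists (p + (- c%:Z) * k%:Z)|exists (p + c%:Z * k%:Z)]; rewrite copE.
  split=> //; apply: le_trans hp; apply: ler_eq; congr `|_|.
  by rewrite E natrM natrD natrM /= rmorphD rmorphM rmorphN/= -!pmulrn; ring.
split=> //; apply: le_trans hp; apply: ler_eq; congr `|_|.
by rewrite E natrM natrD natrM /= rmorphD rmorphM/= -!pmulrn; ring.
Qed.

Lemma near_col_count (v : 'I_m -> nat) (i1 : 'I_m) (eta c0 : R) :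
  (forall i, 0 < v i < M)%N -> 0 < eta <= 1 / 8 -> (v i1)%:R <= eta * M%:R ->
  c0 * (gcdv v)%:R <= (totient (gcdv v))%:R ->
  c0 / 2 * eta * M%:R ^+ m <= #|[pred x : col | `[< near_col v eta x >]]|%:R.
Proof.
move=> vM he vb hc.
have /andP[v0 v1] := vM i1.
have k0 : (0 < gcdv v)%N by apply: dvdn_gt0 (gcdv_dvd v i1).
have kv : (gcdv v <= v i1)%N by apply: dvdn_leq (gcdv_dvd v i1).
have kR : 0 < (gcdv v)%:R :> R by rewrite ltr0n.
have -> : #|[pred x : col | `[< near_col v eta x >]]| =
    #|[pred x : col | [pred y : 'I_M | `[< near_frac M (gcdv v) eta y >]]
         (residue (fun i => v i %/ gcdv v)%N x)]|.
  by apply: eq_card => x; rewrite !inE/=; apply: asbool_equiv_eq; exact: near_colE.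
rewrite (@card_residue _ i1); last first.
  by rewrite divn_gt0// kv/= (leq_ltn_trans (leq_div _ _)).
have := @near_frac_count R M (gcdv v) eta k0 M0 he.
rewrite (le_trans _ vb) ?ler_nat// => /(_ isT) h.
rewrite natrM natrX -[m in leLHS](prednK (leq_ltn_trans (leq0n _) (ltn_ord i1))) exprSr mulrA.
rewrite mulrAC ler_wpM2r ?exprn_ge0//.
apply: le_trans h; case/andP: he => e0 _.
have -> : c0 / 2 * eta * M%:R = c0 * (gcdv v)%:R * (eta * M%:R / (2 * (gcdv v)%:R)).
  by field; rewrite gt_eqF.
by rewrite ler_wpM2r// divr_ge0 ?mulr_ge0 ?(ltW e0)// ltW.
Qed.

Lemma near_col_residue (v : 'I_m -> nat) (eta : R) (x : col) : near_col v eta x ->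
  (residue v x : nat)%:R <= eta * M%:R \/ M%:R - (residue v x : nat)%:R <= eta * M%:R.
Proof.
move=> [p [_ +]]; have E := divn_eq (lin_form v x) M.
set c := (_ %/ M)%N in E; rewrite E /=; set r := (_ %% M)%N => hp.
have rM : (r < M)%N by rewrite ltn_pmod.
have MR : 0 < M%:R :> R by rewrite ltr0n.
have rR : r%:R <= M%:R :> R by rewrite ler_nat ltnW.
have r0 : 0 <= r%:R :> R by [].
have : (c%:Z < p \/ p <= c%:Z)%R by have := leP p c%:Z; case: ltP; [left|right].
move: hp; rewrite natrD natrM ler_norml => /andP[h1 h2]; case=> pc; [right|left].
  have : (c%:Z + 1)%:~R <= p%:~R :> R by rewrite ler_int; move: pc; clear; lia.
  rewrite rmorphD/= -pmulrn => pc'.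
  have : (c%:R + 1) * M%:R <= p%:~R * M%:R :> R by rewrite ler_pM2r.
  lra.
have : p%:~R <= c%:R :> R by rewrite -[c%:R]/(c%:Z%:~R) ler_int.
move=> pc'; have : p%:~R * M%:R <= c%:R * M%:R :> R by rewrite ler_pM2r.
lra.
Qed.

Lemma card_near_zero (eta : R) : 2 <= eta * M%:R ->
  #|[pred r : 'I_M | `[< (r : nat)%:R <= eta * M%:R \/ M%:R - (r : nat)%:R <= eta * M%:R >]]|%:R
  <= 3 * (eta * M%:R).
Proof.
move=> e2; set E := eta * M%:R in e2 *.
have E0 : 0 <= E by apply: le_trans e2.
pose A := [pred r : 'I_M | (r : nat)%:R <= E]; pose B := [pred r : 'I_M | M%:R - (r : nat)%:R <= E].
apply: (@le_trans _ _ (#|A|%:R + #|B|%:R)).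
  rewrite -natrD ler_nat -cardUI; apply: leq_trans (leq_addr _ _).
  apply/subset_leq_card/fintype.subsetP => r /asboolP[h|h]; apply/orP; [left|right]; exact: h.
have : #|A|%:R <= E + 1.
  apply: card_window_real => // a b /= ha hb'.
  by have : 0 <= (b : nat)%:R :> R by []; lra.
have [E1 | E1] := leP 0 (E - 1); last by lra.
have : #|B|%:R <= E - 1 + 1.
  apply: card_window_real => // a b /= ha hb'.
  have : (a : nat)%:R + 1 <= M%:R :> R by rewrite natr1 ler_nat.
  lra.
lra.
Qed.

(** Vectors with a nonzero minor have independent residues, and coprimality may be forgotten.
    Proportional ones are [k w] and [k' w] for the same primitive [w], with [k != k'], which reduces
    to two families of reduced fractions in one variable. *)
Lemma near_col_overlap (v v' : 'I_m -> nat) (i1 : 'I_m) (eta eta' : R) :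
  (forall i, 0 < v i < M)%N -> (forall i, 0 < v' i < M)%N -> (forall i j, v i * v' j < M)%N ->
  0 < eta <= 1 / 8 -> 0 < eta' <= 1 / 8 ->
  2 * (v i1)%:R <= eta * M%:R -> 2 * (v' i1)%:R <= eta' * M%:R ->
  (exists i, v i != v' i) ->
  #|[pred x : col | `[< near_col v eta x /\ near_col v' eta' x >]]|%:R
   <= 12 * (eta * eta') * M%:R ^+ m.
Proof.
move=> vM vM' vv he he' vb vb' [i2 dv].
have MR : 0 < M%:R :> R by rewrite ltr0n.
have /andP[v0 v1] := vM i1; have /andP[v0' v1'] := vM' i1.
have v0R : 1 <= (v i1)%:R :> R by rewrite ler1n.
have v0R' : 1 <= (v' i1)%:R :> R by rewrite ler1n.
have [/existsP[i /existsP[j mij]]|] := boolP [exists i, exists j, v i * v' j != v j * v' i]%N.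
  have ij : i != j by apply: contraNneq mij => ->.
  have m2 : (1 < m)%N by move: ij (ltn_ord i) (ltn_ord j); rewrite -(inj_eq val_inj)/=; clear; lia.
  pose P (e : R) := [pred r : 'I_M | `[< (r : nat)%:R <= e * M%:R \/ M%:R - (r : nat)%:R <= e * M%:R >]] : pred 'I_M.
  apply: (@le_trans _ _ #|[pred x : col | P eta (residue v x) && P eta' (residue v' x)]|%:R).
    rewrite ler_nat; apply/subset_leq_card/fintype.subsetP => x /asboolP[h h'].
    by apply/andP; split; apply/asboolP; exact: near_col_residue.
  rewrite (card_residue2 _ _ vv mij) !natrM natrX.
  have c1 : #|P eta|%:R <= 3 * (eta * M%:R) by apply: card_near_zero; lra.
  have c2 : #|P eta'|%:R <= 3 * (eta' * M%:R) by apply: card_near_zero; lra.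
  apply: (@le_trans _ _ (3 * (eta * M%:R) * (3 * (eta' * M%:R)) * M%:R ^+ m.-2)).
    by rewrite ler_wpM2r ?exprn_ge0// ler_pM.
  have -> : M%:R ^+ m = M%:R ^+ m.-2 * M%:R ^+ 2 :> R by rewrite -exprD; congr (_ ^+ _); move: m2; clear; lia.
  have -> : 3 * (eta * M%:R) * (3 * (eta' * M%:R)) * M%:R ^+ m.-2 =
     9 * (eta * eta') * (M%:R ^+ m.-2 * M%:R ^+ 2) by ring.
  rewrite ler_wpM2r// ?mulr_ge0 ?exprn_ge0//.
  case/andP: he => e0 _; case/andP: he' => e0' _.
  have : 0 < eta * eta' by rewrite mulr_gt0.
  lra.
rewrite negb_exists => /forallP par.
have {}par i j : (v i * v' j = v j * v' i)%N.
  by have := par i; rewrite negb_exists => /forallP/(_ j); rewrite negbK => /eqP.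
set k := gcdv v; set k' := gcdv v'.
have kvv i : (k * v' i = k' * v i)%N.
  rewrite mulnC [in RHS]mulnC /k /k' !gcdv_mul /gcdv; apply: eq_bigr => j _.
  by rewrite mulnC par.
have k0 : (0 < k)%N by apply: dvdn_gt0 (gcdv_dvd v i1).
have k0' : (0 < k')%N by apply: dvdn_gt0 (gcdv_dvd v' i1).
have kk : k != k'.
  apply: contraNneq dv => e; have := kvv i2; rewrite -e => /eqP.
  by rewrite eqn_pmul2l// eq_sym.
have wE : (fun i => v' i %/ k')%N = (fun i => v i %/ k)%N.
  apply/funext => i; have kk0 : (0 < k * k')%N by rewrite muln_gt0 k0.
  apply/eqP; rewrite -(eqn_pmul2r kk0).
  by rewrite [X in (_ * X == _)%N]mulnC !mulnA !divnK ?gcdv_dvd// mulnC kvv mulnC.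
have -> : #|[pred x : col | `[< near_col v eta x /\ near_col v' eta' x >]]| =
    #|[pred x : col | [pred y : 'I_M | `[< near_frac M k eta y /\ near_frac M k' eta' y >]]
         (residue (fun i => v i %/ k)%N x)]|.
  apply: eq_card => x; rewrite !inE/=; apply: asbool_equiv_eq.
  by rewrite !near_colE -/k -/k' wE.
have kv : (k <= v i1)%N by apply: dvdn_leq (gcdv_dvd v i1).
have kv' : (k' <= v' i1)%N by apply: dvdn_leq (gcdv_dvd v' i1).
have kvR : k%:R <= (v i1)%:R :> R by rewrite ler_nat.
have kvR' : k'%:R <= (v' i1)%:R :> R by rewrite ler_nat.
rewrite (@card_residue _ i1); last first.
  by rewrite divn_gt0// kv/= (leq_ltn_trans (leq_div _ _)).
rewrite natrM natrX -[m in leRHS](prednK (leq_ltn_trans (leq0n _) (ltn_ord i1))) exprS mulrA.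
rewrite ler_wpM2r ?exprn_ge0//; apply: near_frac_overlap => //; lra.
Qed.

(** Summation of [2 * lam * c - lam ^+ 2 * c ^+ 2 <= 1] over the points with multiplicity [c > 0]: a
    second moment bound with a free parameter in place of a quotient. *)
Lemma union_lower (I T : finType) (E : I -> pred T) (lam : R) :
  2 * lam * (\sum_i #|E i|)%:R - lam ^+ 2 * (\sum_i \sum_j #|[pred x | E i x && E j x]|)%:R
  <= #|[pred x | [exists i, E i x]]|%:R.
Proof.
pose c x := (\sum_i E i x)%N.
have s1 : (\sum_i #|E i| = \sum_x c x)%N.
  rewrite exchange_big/=; apply: eq_bigr => i _; rewrite -sum1_card big_mkcond/=.
  by apply: eq_bigr => x _; rewrite -[x \in _]/(E i x); case: (E i x).
have s2 : (\sum_i \sum_j #|[pred x | E i x && E j x]| = \sum_x c x * c x)%N.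
  have -> : (\sum_x c x * c x = \sum_x \sum_i \sum_j (E i x && E j x))%N.
    apply: eq_bigr => x _; rewrite big_distrl/=; apply: eq_bigr => i _.
    by rewrite big_distrr/=; apply: eq_bigr => j _; rewrite mulnb.
  rewrite [RHS]exchange_big/=; apply: eq_bigr => i _; rewrite [RHS]exchange_big/=; apply: eq_bigr => j _.
  rewrite -sum1_card big_mkcond/=; apply: eq_bigr => x _.
  by rewrite inE/=; case: (_ && _).
have -> : #|[pred x | [exists i, E i x]]|%:R = \sum_x ([exists i, E i x] : nat)%:R :> R.
  rewrite -natr_sum -sum1_card big_mkcond/=; congr (_%:R); apply: eq_bigr => x _.
rewrite s1 s2 (natr_sum R _ _ c) (natr_sum R _ _ (fun x => c x * c x)%N) !mulr_sumr -sumrB.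
apply: ler_sum => x _; case: existsP => [_|h].
  by rewrite natrM -[leRHS]/(1 : R); have := sqr_ge0 (lam * (c x)%:R - 1); lra.
have {}h i : E i x = false by apply/negP => Ei; apply: h; exists i.
have -> : c x = 0%N by rewrite /c big1// => i _; rewrite h.
by rewrite mul0n !mulr0 subrr.
Qed.

Definition near_mx (v : 'I_m -> nat) (eta : 'I_n -> R) (X : {ffun 'I_n -> col}) :=
  forall l, near_col v (eta l) (X l).

Lemma union_count (I : finType) (i1 : 'I_m) (v : I -> 'I_m -> nat) (eta : I -> 'I_n -> R) (c0 : R) :
  (forall a i, 0 < v a i)%N -> (forall a b i j, v a i * v b j < M)%N ->
  (forall a b, a != b -> exists i, v a i != v b i) ->
  (forall a l, 0 < eta a l <= 1 / 8) ->
  (forall a l, 2 * (v a i1)%:R <= eta a l * M%:R) ->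
  0 < c0 <= 1 -> (forall a, c0 * (gcdv (v a))%:R <= (totient (gcdv (v a)))%:R) ->
  1 <= \sum_a \prod_l eta a l ->
  (c0 / 2) ^+ n ^+ 2 / (4 * 12 ^+ n) * M%:R ^+ (m * n) <=
  #|[pred X : {ffun 'I_n -> col} | [exists a, `[< near_mx (v a) (eta a) X >]]]|%:R.
Proof.
move=> v0 vv vinj he vb /andP[c00 c01] hc tau1.
have MR : 0 < M%:R :> R by rewrite ltr0n.
have vM a i : (0 < v a i < M)%N.
  by rewrite v0/=; apply: leq_ltn_trans (vv a a i i); rewrite leq_pmull.
have e0 a l : 0 < eta a l by case/andP: (he a l).
pose E a := [pred X : {ffun 'I_n -> col} | `[< near_mx (v a) (eta a) X >]] : pred _.
pose c : R := (c0 / 2) ^+ n; pose D := M%:R ^+ (m * n) : R.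
pose tau := \sum_a \prod_l eta a l.
have c0' : 0 < c by rewrite exprn_gt0// divr_gt0.
have c1' : c <= 1 by rewrite exprn_ile1//; [rewrite divr_ge0// ltW|lra].
have D0 : 0 < D by rewrite exprn_gt0.
have DE : D = \prod_(l < n) M%:R ^+ m by rewrite prodr_const card_ord -exprM.
have vbR a : 1 <= (v a i1)%:R :> R by rewrite ler1n.
have E1 a : c * \prod_l eta a l * D <= #|E a|%:R.
  have -> : #|E a| = (\prod_l #|[pred x : col | `[< near_col (v a) (eta a l) x >]]|)%N.
    rewrite -card_family_prod; apply: eq_card => X; apply/asboolP/familyP => h l.
      by apply/asboolP; exact: h.
    by have /asboolP := h l.
  rewrite DE /c -[n in (c0 / 2) ^+ n]card_ord -prodr_const -!big_split/= natr_prod.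
  apply: ler_prod => l _; rewrite !mulr_ge0 ?exprn_ge0 ?(ltW (e0 _ _)) ?(ltW c00)//=.
  by apply: near_col_count => //; have := vb a l; have := vbR a; lra.
have E2 a b : a != b -> #|[pred X | E a X && E b X]|%:R <=
    12 ^+ n * (\prod_l eta a l * \prod_l eta b l) * D.
  move=> ab.
  have -> : #|[pred X | E a X && E b X]| =
      (\prod_l #|[pred x : col | `[< near_col (v a) (eta a l) x /\ near_col (v b) (eta b l) x >]]|)%N.
    rewrite -card_family_prod; apply: eq_card => X; apply/andP/familyP => [[/asboolP ha /asboolP hb'] l|h].
      by apply/asboolP; split; [exact: ha|exact: hb'].
    by split; apply/asboolP => l; have /asboolP[] := h l.
  rewrite DE -[n in 12 ^+ n]card_ord -prodr_const -!big_split/= natr_prod.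
  by apply: ler_prod => l _; rewrite ler0n/=; apply: (@near_col_overlap _ _ i1) => //; exact: vinj.
pose S := (\sum_a #|E a|)%:R : R.
pose P := (\sum_a \sum_b #|[pred X | E a X && E b X]|)%:R : R.
have S1 : c * tau * D <= S.
  rewrite /S natr_sum /tau mulr_sumr mulr_suml; apply: ler_sum => a _; exact: E1.
have tau0 : 0 < tau by apply: lt_le_trans tau1.
have S0 : 0 < S by apply: lt_le_trans S1; rewrite !mulr_gt0.
have P1 : P <= S + 12 ^+ n * tau ^+ 2 * D.
  rewrite /P natr_sum; apply: (@le_trans _ _ (\sum_a (#|E a|%:R +
      \sum_b 12 ^+ n * (\prod_l eta a l * \prod_l eta b l) * D))); last first.
    rewrite big_split/= /S natr_sum lerD2l; apply: ler_eq.
    rewrite expr2 {1}/tau !(mulr_suml, mulr_sumr); apply: eq_bigr => a _.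
    by rewrite /tau !(mulr_suml, mulr_sumr); apply: eq_bigr => b _; rewrite mulrA.
  apply: ler_sum => a _; rewrite natr_sum (bigD1 a)//=; apply: lerD.
    rewrite ler_nat; apply/subset_leq_card/fintype.subsetP => X /andP[]; done.
  rewrite [leRHS](bigD1 a)//= -[leLHS]add0r; apply: lerD.
    by rewrite !mulr_ge0 ?exprn_ge0 ?prodr_ge0// => *; rewrite ltW.
  by apply: ler_sum => b; rewrite eq_sym => ab; exact: E2.
(* Chosen so that [12 ^+ n * (c1 / c) ^+ 2 = c1 / 2]. With [lam * S = c1 * D] the gain is
   [2 * c1 * D]; the diagonal takes at most [c1 * D] of it and the other pairs half as much, however
   large [tau] is. *)
pose c1 := c ^+ 2 / (2 * 12 ^+ n).
have t0 : 0 < 12 ^+ n :> R by rewrite exprn_gt0.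
have t1 : 1 <= 12 ^+ n :> R by rewrite exprn_ege1//; lra.
have c10 : 0 < c1 by rewrite divr_gt0 ?exprn_gt0// mulr_gt0.
have c1c : c1 <= c.
  by rewrite ler_pdivrMr ?mulr_gt0// expr2 ler_pM2l//; lra.
pose lam := c1 * D / S.
have lam0 : 0 < lam by rewrite !mulr_gt0 ?invr_gt0.
have lamS : lam * S = c1 * D by rewrite /lam mulfVK// gt_eqF.
have lam1 : lam <= 1.
  rewrite /lam ler_pdivrMr// mul1r; apply: le_trans S1.
  by rewrite ler_pM2r//; apply: le_trans c1c _; rewrite ler_peMr// ltW.
have lamt : lam * tau <= c1 / c.
  rewrite ler_pdivlMr// -(ler_pM2r D0).
  have -> : lam * tau * c * D = lam * (c * tau * D) by ring.
  by rewrite -lamS ler_pM2l.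
have lamt2 : 12 ^+ n * (lam * tau) ^+ 2 <= c1 / 2.
  apply: (@le_trans _ _ (12 ^+ n * (c1 / c) ^+ 2)).
    rewrite ler_pM2l// ler_sqr// nnegrE; [by rewrite mulr_ge0// ltW|by rewrite divr_ge0// ltW].
  by apply: ler_eq; rewrite /c1; field; rewrite !gt_eqF.
apply: le_trans (union_lower E lam).
rewrite -/S -/P -/D -/c.
have h1 : lam ^+ 2 * P <= lam ^+ 2 * S + 12 ^+ n * (lam * tau) ^+ 2 * D.
  have -> : lam ^+ 2 * S + 12 ^+ n * (lam * tau) ^+ 2 * D = lam ^+ 2 * (S + 12 ^+ n * tau ^+ 2 * D) by ring.
  by rewrite ler_pM2l// exprn_gt0.
have h2 : 12 ^+ n * (lam * tau) ^+ 2 * D <= c1 / 2 * D by rewrite ler_pM2r.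
have h3 : lam ^+ 2 * S <= c1 * D.
  by rewrite expr2 -mulrA lamS ler_piMl// ltW// mulr_gt0.
have -> : c ^+ 2 / (4 * 12 ^+ n) = c1 / 2 by rewrite /c1; field; rewrite gt_eqF.
have h4 : 2 * lam * S = 2 * (c1 * D) by rewrite -mulrA lamS.
rewrite h4; lra.
Qed.

End PrimeGrid.

(** * Patterns from finite families of planks *)

Section PatternOfFamily.
Context {R : realType} {m n : nat}.
Variables (g : nat) (f : R -> R).
Hypotheses (g2 : (1 < g)%N) (f_ge0 : forall x, 0 <= x -> 0 <= f x).
Local Notation d := (m * n)%N.
Local Notation G l := (g%:R ^- l : R).
Variables (I : finType) (v : I -> 'I_m -> nat) (i0 : I -> 'I_m) (eta : I -> 'I_n -> R)
  (s : I -> nat) (K c0 : R).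
Local Notation h a := (v a (i0 a)).
Local Notation eta4 a l := (1 / 4 * Num.max (eta a l) (G (s a) * (h a)%:R)).
Hypotheses (v_gt0 : forall a i, (0 < v a i)%N) (v_le : forall a i, (v a i <= h a)%N)
  (v_inj : forall a b, a != b -> exists i, v a i != v b i)
  (eta_gt0 : forall a l, 0 < eta a l) (eta_le : forall a l, eta a l <= 1 / 2)
  (s_le : forall a, G (s a) * (h a)%:R <= 1 / 2)
  (c0_bnd : 0 < c0 <= 1) (v_tot : forall a, c0 * (gcdv (v a))%:R <= (totient (gcdv (v a)))%:R)
  (K_gt0 : 0 < K)
  (content : forall a r, 0 < r ->
     K * \prod_(l < n) Num.max (eta a l / (h a)%:R) (G (s a)) <=
     Phi f (m.-1 * n) (fun l => eta a l / (h a)%:R) r)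
  (total : 1 <= \sum_a \prod_l eta4 a l).

Let g0 : (0 < g)%N. Proof. exact: ltnW. Qed.
Let G0 l : 0 < G l. Proof. by rewrite invr_gt0 exprn_gt0// ltr0n. Qed.

Let eta4_gt0 a l : 0 < eta4 a l.
Proof. by rewrite mulr_gt0// ?divr_gt0// lt_max eta_gt0. Qed.

(** The proportion from [union_count], divided by [2 ^+ d] for the passage from the prime grid to
    the [g]-adic one and by [(2 * m.+3).+1 ^+ d] for the offsets in [covered_count]. *)
Definition family_const : R :=
  (c0 / 2) ^+ n ^+ 2 / (4 * 12 ^+ n) / (2 * (2 * m.+3).+1%:R) ^+ d.

Let family_const_gt0 : 0 < family_const.
Proof.
case/andP: c0_bnd => c00 _.
by rewrite !(divr_gt0, mulr_gt0, exprn_gt0)// ltr0n.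
Qed.

Lemma ler_bigsum (J : finType) (F : J -> R) j : (forall j, 0 <= F j) -> F j <= \sum_j F j.
Proof. by move=> F0; rewrite (bigD1 j)//= lerDl sumr_ge0. Qed.

Lemma leq_bigsum (J : finType) (F : J -> nat) j : (F j <= \sum_j F j)%N.
Proof. by rewrite (bigD1 j)//= leq_addr. Qed.

Lemma card_fiber (N M : nat) (z : 'M['I_N]_(m, n)) : (0 < N <= M)%N ->
  #|[pred X : {ffun 'I_n -> {ffun 'I_m -> 'I_M}} | [forall l, [forall i,
       (N * X l i) %/ M == z i l]%N]]|%:R <= (2 * (M%:R / N%:R)) ^+ d :> R.
Proof.
move=> /andP[N0 NM]; have M0 : (0 < M)%N by apply: leq_trans NM.
have NR : 0 < N%:R :> R by rewrite ltr0n.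
have MR : 0 < M%:R :> R by rewrite ltr0n.
pose win i l := [pred x : 'I_M | (N * x) %/ M == z i l]%N : pred 'I_M.
have -> : #|[pred X : {ffun 'I_n -> {ffun 'I_m -> 'I_M}} | [forall l, [forall i,
       (N * X l i) %/ M == z i l]%N]]| = (\prod_(l < n) \prod_(i < m) #|win i l|)%N.
  rewrite (eq_bigr (fun l => #|family (fun i => mem (win i l)) : {pred {ffun 'I_m -> 'I_M}}|)); last first.
    by move=> l _; rewrite card_family_prod.
  rewrite -card_family_prod; apply: eq_card => X.
  apply/forallP/familyP => hX l.
    by apply/familyP => i; exact: (forallP (hX l) i).
  by apply/forallP => i; have /familyP/(_ i) := hX l.
have wle i l : #|win i l|%:R <= 2 * (M%:R / N%:R) :> R.
  apply: (@le_trans _ _ (M%:R / N%:R + 1)); last first.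
    have : 1 <= M%:R / N%:R :> R by rewrite ler_pdivlMr// mul1r ler_nat.
    lra.
  apply: card_window_real; first by rewrite divr_ge0.
  move=> x y /eqP hx /eqP hy; rewrite ler_pdivlMr// mulrBl -!natrM lerBlDr -natrD ler_nat.
  have := divn_eq (N * x) M; rewrite hx; have := divn_eq (N * y) M; rewrite hy.
  have := ltn_pmod (N * x) M0; rewrite ![(_ * N)%N]mulnC; move: ((z i l) * M)%N (N * x)%N (N * y)%N (N * x %% M)%N (N * y %% M)%N.
  clear; lia.
rewrite natr_prod exprM -[n in _ ^+ n]card_ord -prodr_const.
apply: ler_prod => l _; rewrite ler0n natr_prod/= -[m in _ ^+ m]card_ord -prodr_const.
by apply: ler_prod => i _; rewrite ler0n wle.
Qed.

(** The second moment needs a prime modulus and the kernels a power of [g]. Each point of a finer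
    prime grid is sent to the [g]-adic cell [zof X] containing it, and the fibres have at most
    [(2 * M / g ^ L) ^+ d] points. *)
Lemma pattern_of_family : exists (L : nat) (t : seq ('M[nat]_(m, n) * R)),
  [/\ weights g L t,
      forall l y, (l <= L)%N -> mass t (fun x => coarse g (L - l) x == y) <=
        family_const^-1 * (G l ^+ d + (8 * (2 * m.+3).+1%:R) ^+ n * (f (G l) / K)),
      forall a l, 4 * m.+1%:R * (h a)%:R <= g%:R ^+ L * eta a l
    & forall x, x \in cells t -> exists a (c : 'M['I_(g ^ L)]_(m, n)),
        in_plank (v a) (eta a) c /\ x = map_mx val c].
Proof.
have [a0 _] : exists a0 : I, true.
  apply: contrapT => /forallNP h0; move: total; rewrite big1 ?ler10// => a _.
  by exfalso; apply: (h0 a).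
pose i1 := i0 a0.
pose BL : R := \sum_a \sum_l 4 * m.+1%:R * (h a)%:R / eta a l.
have BLge a l : 4 * m.+1%:R * (h a)%:R / eta a l <= BL.
  have pos a' l' : 0 <= 4 * m.+1%:R * (h a')%:R / eta a' l'.
    by rewrite divr_ge0 ?mulr_ge0 ?(ltW (eta_gt0 _ _)).
  apply: le_trans (ler_bigsum (F := fun a => \sum_l _) a _); last by move=> ?; rewrite sumr_ge0.
  exact: (ler_bigsum (F := fun l => 4 * m.+1%:R * (h a)%:R / eta a l)).
have BL0 : 0 <= BL.
  by rewrite !sumr_ge0// => a _; rewrite sumr_ge0// => l _; rewrite divr_ge0 ?mulr_ge0 ?(ltW (eta_gt0 _ _)).
(* Fine enough for every level [s a] and, through [BL], for the thinnest plank. *)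
pose L := (Num.truncn BL + \sum_a s a).+1%N.
have Lg : (L < g ^ L)%N by rewrite ltn_expl.
have gLR : (g ^ L)%N%:R = g%:R ^+ L :> R by rewrite natrX.
have BLL : BL <= g%:R ^+ L.
  rewrite -gLR; apply: le_trans (ltW (truncn_gt BL0)) _; rewrite ler_nat.
  by apply: leq_trans (ltnW Lg); rewrite /L ltnS leq_addr.
have sL a : (s a <= L)%N.
  by rewrite /L (leq_trans (leq_bigsum s a))// (leq_trans (leq_addl (Num.truncn BL) _)).
have L_large a l : 4 * m.+1%:R * (h a)%:R <= g%:R ^+ L * eta a l.
  by rewrite -ler_pdivrMr//; apply: le_trans BLL; exact: BLge.
pose BM : R := \sum_a \sum_l 2 * (v a i1)%:R / eta4 a l.
have BM0 : 0 <= BM.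
  by rewrite !sumr_ge0// => a _; rewrite sumr_ge0// => l _; apply: divr_ge0; [rewrite mulr_ge0|exact: ltW (eta4_gt0 _ _)].
have BMge a l : 2 * (v a i1)%:R / eta4 a l <= BM.
  have pos a' l' : 0 <= 2 * (v a' i1)%:R / eta4 a' l'.
    by apply: divr_ge0; [rewrite mulr_ge0|exact: ltW (eta4_gt0 _ _)].
  apply: le_trans (ler_bigsum (F := fun a => \sum_l _) a _); last by move=> ?; rewrite sumr_ge0.
  exact: (ler_bigsum (F := fun l => 2 * (v a i1)%:R / eta4 a l)).
pose sv := (\sum_a \sum_i v a i)%N.
have svge a i : (v a i <= sv)%N.
  apply: leq_trans (leq_bigsum (fun a => \sum_i v a i)%N a).
  exact: (leq_bigsum (v a)).
(* The prime exceeds [g ^ L], all products of entries, hence the minors, and the bound [BM] that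
   makes the grid fine for every fattened plank. *)
have [M Mlarge Mp] := prime_above ((g ^ L + sv * sv) + (Num.truncn BM).+1)%N.
have NM : (g ^ L <= M)%N by move: Mlarge; clear; lia.
have svM a b i j : (v a i * v b j < M)%N.
  by apply: (@leq_ltn_trans (sv * sv)%N); [exact: leq_mul|move: Mlarge; clear; lia].
have MR : 0 < M%:R :> R by rewrite ltr0n prime_gt0.
have vb a l : 2 * (v a i1)%:R <= eta4 a l * M%:R.
  rewrite [leRHS]mulrC -(ler_pdivrMr _ _ (eta4_gt0 a l)); apply: le_trans (BMge a l) _.
  apply: le_trans (ltW (truncn_gt BM0)) _; rewrite ler_nat.
  by move: Mlarge; clear; lia.
have eta8 a l : 0 < eta4 a l <= 1 / 8.
  rewrite eta4_gt0/=; have : Num.max (eta a l) (G (s a) * (h a)%:R) <= 1 / 2 by rewrite ge_max eta_le s_le.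
  lra.
have := union_count Mp v_gt0 svM v_inj eta8 vb c0_bnd v_tot total.
set U := [pred X | _]; set k0 := (X in X * _ <= _) => Ub.
have N0 : (0 < g ^ L)%N by rewrite expn_gt0 g0.
have zM (X : {ffun 'I_n -> {ffun 'I_m -> 'I_M}}) l i : ((g ^ L * X l i) %/ M < g ^ L)%N.
  by rewrite ltn_divLR ?prime_gt0// ltn_pmul2l.
pose zof (X : {ffun 'I_n -> {ffun 'I_m -> 'I_M}}) : 'M['I_(g ^ L)]_(m, n) :=
  \matrix_(i, l) Ordinal (zM X l i).
pose Z : pred 'M['I_(g ^ L)]_(m, n) := [pred z | [exists X, U X && (zof X == z)]].
pose allowed (c : 'M['I_(g ^ L)]_(m, n)) := exists a, in_plank (v a) (eta a) c.
pose B l : R := (8 * (2 * m.+3).+1%:R) ^+ n * (f (G l) / K).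
pose V := @valid_kernel R m n g L allowed B.
have UZ : #|U|%:R <= #|Z|%:R * (2 * (M%:R / (g ^ L)%N%:R)) ^+ d :> R.
  apply: (@le_trans _ _ (\sum_(z | Z z) #|[pred X | zof X == z]|)%N%:R).
    rewrite ler_nat; apply: leq_trans (card_union_le _ _).
    apply/subset_leq_card/fintype.subsetP => X UX; apply/existsP; exists (zof X).
    by apply/andP; split; [apply/existsP; exists X; rewrite eqxx andbT|apply/eqP].
  rewrite natr_sum mulr_natl -sumr_const big_mkcond [leRHS]big_mkcond/=.
  apply: ler_sum => z _; rewrite -[z \in Z]/(Z z); case: (Z z) => //.
  apply: le_trans (card_fiber z _); last by rewrite N0.
  rewrite ler_nat; apply/subset_leq_card/fintype.subsetP => X /eqP zX.
  by apply/forallP => l; apply/forallP => i; rewrite -zX mxE.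
have cov : (#|Z| <= (2 * m.+3).+1 ^ d * #|[pred x | covered V x]|)%N.
  apply: (covered_count (V := V) g2) => [s' x y w [h1 h2 h3 h4 h5] xy|s' x w [] //|z].
    split=> // c wc; have [xc al] := h3 c wc; split=> //.
    by apply: same_cell_trans xc; rewrite same_cell_sym.
  move=> /existsP[X /andP[/existsP[a /asboolP nX] /eqP zX]].
  have pex l : exists p : int, `|\sum_i (v a i)%:R * ((X l i : nat)%:R / M%:R) - p%:~R| <= eta4 a l.
    have [p [_ hp]] := nX l; exists p.
    rewrite -(ler_pM2r MR); apply: le_trans hp; rewrite -[X in _ * X <= _](gtr0_norm MR) -normrM mulrBl.
    apply: ler_eq; congr `|_ - _|; rewrite /lin_form natr_sum mulr_suml; apply: eq_bigr => i _.
    by rewrite natrM -mulrA divfK// gt_eqF.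
  pose p l := sval (cid (pex l)).
  have y_near l : `|\sum_i (v a i)%:R * ((X l i : nat)%:R / M%:R) - (p l)%:~R| <= eta4 a l.
    exact: (svalP (cid (pex l))).
  have zy i l : (z i l : nat)%:R <= (g%:R ^+ L * ((X l i : nat)%:R / M%:R) : R) < (z i l : nat).+1%:R.
    rewrite -zX mxE/= -gLR mulrA ler_pdivlMr// ltr_pdivrMr// -!natrM ler_nat ltr_nat.
    by rewrite leq_divM ltn_ceil// prime_gt0.
  have [z1 [w [zz [k1 k2 k3 k4 k5]]]] := piece_exists g2 (v_le a) (v_gt0 a (i0 a)) (eta_gt0 a) (sL a) (L_large a)
    y_near zy K_gt0 f_ge0 (content a).
  exists (s a), z1; split; last exact: zz.
  apply/asboolP; exists w; split=> // c wc; have [c1 c2] := k3 c wc; split=> //.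
  by exists a.
have kap : family_const * g%:R ^+ (L * d) <= #|[pred x | covered V x]|%:R.
  have O0 : 0 < ((2 * m.+3).+1%:R : R) ^+ d by rewrite exprn_gt0// ltr0n.
  have gL0 : 0 < g%:R ^+ L :> R by rewrite exprn_gt0// ltr0n.
  have cov' : #|Z|%:R <= (2 * m.+3).+1%:R ^+ d * #|[pred x | covered V x]|%:R :> R.
    by rewrite -natrX -natrM ler_nat.
  have MN0 : 0 < 2 * (M%:R / g%:R ^+ L) :> R by rewrite mulr_gt0// divr_gt0.
  have e1 : k0 * M%:R ^+ d <= (2 * m.+3).+1%:R ^+ d * #|[pred x | covered V x]|%:R * (2 * (M%:R / g%:R ^+ L)) ^+ d.
    apply: le_trans Ub _; apply: le_trans UZ _; rewrite gLR ler_wpM2r// exprn_ge0// ltW//.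
  rewrite -(ler_pM2l O0) -(ler_pM2r (exprn_gt0 d MN0)); apply: le_trans e1.
  apply: ler_eq; rewrite /family_const -/k0 !exprMn exprVn -exprM.
  by field; rewrite !expf_neq0 ?gt_eqF// ltr0n// ?expn_gt0 ?g0.
have [] := @kernel_weights R m n g L g2 V allowed B _ _ _ _ _ _ _ family_const family_const_gt0 kap.
- by move=> l; rewrite mulr_ge0 ?exprn_ge0// divr_ge0 ?(ltW K_gt0)// f_ge0// ltW.
- move=> s' x y w [h1 h2 h3 h4 h5] xy; split=> // c wc; have [xc al] := h3 c wc; split=> //.
  by apply: same_cell_trans xc; rewrite same_cell_sym.
- by move=> s' x w [].
- by move=> s' x w c [].
- by move=> s' x w c [_ _ k _ _]; exact: k.
- by move=> s' x w [].
- by move=> s' x w l y [_ _ _ _ k]; exact: k.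
move=> t [t1 t2 t3]; exists L, t; split=> //.
by move=> x /t3[c [a ac] ->]; exists a, c.
Qed.

End PatternOfFamily.

(** * Vectors with large totient ratio *)

Section PrimeReciprocals.
Context {R : realType}.

(** This sum controls the totient ratio from below ([totient_lower]), has bounded mean on dyadic
    intervals, and increases along divisibility; one entry of [v] therefore controls [gcdv v]. *)
Definition prime_recip (x : nat) : R := \sum_(p <- primes x) (p%:R)^-1.

Lemma inv_sq_le (x : R) : 0 < x -> (x + 1) ^- 2 <= x^-1 - (x + 1)^-1.
Proof.
move=> x0; have x1 : 0 < x + 1 by rewrite addr_gt0.
have -> : x^-1 - (x + 1)^-1 = (x * (x + 1))^-1.
  by rewrite -[x^-1]mul1r -[(x + 1)^-1]mul1r -mulNr addf_div ?gt_eqF// !mul1r mulN1r [x + 1]addrC addrK mul1r.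
by rewrite lef_pV2 ?posrE ?exprn_gt0 ?mulr_gt0// expr2 ler_pM2r// lerDl.
Qed.

Lemma sum_inv_sq (N : nat) : \sum_(2 <= p < N) (p%:R ^- 2 : R) <= 1.
Proof.
suff h k : \sum_(2 <= p < k.+2) (p%:R ^- 2 : R) <= 1 - k.+1%:R^-1.
  case: N => [|[|N]]; [by rewrite big_geq// ler01|by rewrite big_geq// ler01|].
  by apply: le_trans (h N) _; rewrite gerBl invr_ge0.
elim: k => [|k IH]; first by rewrite big_geq// invr1 subrr.
rewrite big_nat_recr//=; apply: le_trans (lerD IH _) _.
  by rewrite -natr1; apply: inv_sq_le; rewrite ltr0n.
by rewrite natr1 addrA subrK.
Qed.

Lemma card_multiples (p X : nat) : (0 < p)%N ->
  (#|[pred x : 'I_X | p %| X + x]| <= (X %/ p).+1)%N.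
Proof.
move=> p0.
have b (x : 'I_X) : (x %/ p < (X %/ p).+1)%N by rewrite ltnS leq_div2r// ltnW.
pose F x : 'I_(X %/ p).+1 := Ordinal (b x).
rewrite -(card_in_image (f := F)).
  by rewrite (leq_trans (max_card _))// card_ord.
move=> x y hx hy /(congr1 val)/= e; apply: val_inj => /=.
have : (X + x == X + y %[mod p])%N.
  by rewrite (eqP (hx : (_ == 0)%N)) (eqP (hy : (_ == 0)%N)).
rewrite eqn_modDl => /eqP h.
by rewrite (divn_eq x p) (divn_eq y p) e h.
Qed.

Lemma prime_recipE (N x : nat) : (0 < x < N)%N ->
  prime_recip x = \sum_(p < N | (p : nat) \in primes x) ((p : nat)%:R)^-1.
Proof.
move=> /andP[x0 xN]; rewrite /prime_recip.
rewrite -(big_mkord (fun p => p \in primes x) (fun p => (p%:R : R)^-1)) -[RHS]big_filter.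
apply: perm_big; apply: uniq_perm; rewrite ?primes_uniq ?filter_uniq ?iota_uniq// => p.
rewrite mem_filter mem_index_iota/=; case: (boolP (p \in primes x)) => //= px.
move: px; rewrite mem_primes => /and3P[_ _ /dvdn_leq h].
by rewrite (leq_ltn_trans (h x0)).
Qed.

Lemma sum_prime_recip (X : nat) : (0 < X)%N ->
  \sum_(x < X) prime_recip (X + x) <= 3 * X%:R.
Proof.
move=> X0; pose N := (2 * X)%N.
have XR : 0 < X%:R :> R by rewrite ltr0n.
apply: (@le_trans _ _ (\sum_(x < X) \sum_(p < N | (1 < p)%N) if (p %| X + x)%N then ((p : nat)%:R : R)^-1 else 0)).
  apply: ler_sum => x _; rewrite (@prime_recipE N); last first.
    by have := ltn_ord x; rewrite /N; move: X0; clear; lia.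
  rewrite big_mkcond [leRHS]big_mkcond/=; apply: ler_sum => p _.
  case: ifPn => [|_].
    by rewrite mem_primes => /and3P[/prime_gt1 -> _ ->].
  by case: ifP => // _; case: ifP => // _; rewrite invr_ge0.
rewrite exchange_big/=.
apply: (@le_trans _ _ (\sum_(p < N | (1 < p)%N) 3 * X%:R * (p : nat)%:R ^- 2)).
  apply: ler_sum => p p1.
  have pR : 0 < (p : nat)%:R :> R by rewrite ltr0n ltnW.
  rewrite -big_mkcond/= sumr_const -[leLHS]mulr_natr.
  apply: (@le_trans _ _ (((p : nat)%:R)^-1 * (3 * X%:R / (p : nat)%:R))).
    rewrite ler_pM2l ?invr_gt0//.
    apply: (@le_trans _ _ ((X %/ p).+1%:R)).
      by rewrite ler_nat; apply: leq_trans (card_multiples X (ltnW p1)); apply: eq_leq; apply: eq_card.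
    rewrite ler_pdivlMr// -!natrM ler_nat.
    have pN : (p <= 2 * X)%N by exact: ltnW (ltn_ord p).
    by rewrite mulSn (mulSnr 2) leq_add// leq_divM.
  by rewrite mulrCA -invfM -expr2 mulrC.
rewrite -mulr_sumr ler_piMr ?mulr_ge0//.
by rewrite -(big_geq_mkord 2 N predT (fun p => p%:R ^- 2 : R)) sum_inv_sq.
Qed.

Lemma prime_recip_dvd (k x : nat) : (0 < x)%N -> (k %| x)%N -> prime_recip k <= prime_recip x.
Proof.
move=> x0 kx; have k0 := dvdn_gt0 x0 kx.
have kx' : (0 < k < x.+1)%N by rewrite k0 ltnS; exact: dvdn_leq.
have xx' : (0 < x < x.+1)%N by rewrite x0 ltnSn.
rewrite (prime_recipE kx') (prime_recipE xx').
rewrite big_mkcond [leRHS]big_mkcond/=; apply: ler_sum => p _.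
rewrite !mem_primes; case: ifPn => [/and3P[pp _ pk]|_].
  by rewrite pp x0 (dvdn_trans pk).
by case: ifP => // _; rewrite invr_ge0.
Qed.

Lemma expR_recip (p : R) : 2 <= p -> expR (- (2 * p^-1)) * p <= p - 1.
Proof.
move=> p2; have p0 : 0 < p by lra.
have E : p - 1 = (1 - p^-1) * p by rewrite mulrBl mul1r mulVf// gt_eqF.
rewrite E ler_pM2r// expRN -[leLHS]mul1r ler_pdivrMr ?expR_gt0//.
have i0 : 0 < p^-1 by rewrite invr_gt0.
have i2 : p^-1 <= 2^-1 by rewrite lef_pV2 ?posrE.
have := expR_ge1Dx (2 * p^-1); set y := expR _; move: i0 i2; set x := p^-1 => i0 i2 h.
have : (1 - x) * (1 + 2 * x) <= (1 - x) * y by rewrite ler_wpM2l//; lra.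
by nra.
Qed.

Lemma totient_lower (k : nat) : (0 < k)%N ->
  expR (- (2 * prime_recip k)) * k%:R <= (totient k)%:R.
Proof.
move=> k0; rewrite totientE// {2}(prod_prime_decomp k0) prime_decompE big_map/=.
rewrite /prime_recip mulr_sumr -sumrN (big_morph expR (@expRD R) (@expR0 R)) !natr_prod -big_split/=.
rewrite big_seq [leRHS]big_seq; apply: ler_prod => p pk.
rewrite mulr_ge0 ?expR_ge0//=.
have e0 : (0 < logn p k)%N by rewrite logn_gt0.
have pp : prime p by move: pk; rewrite mem_primes => /andP[].
rewrite -{1}(prednK e0) expnS !natrM mulrA ler_wpM2r//.
rewrite -subn1 natrB ?prime_gt0//; apply: expR_recip.
by rewrite ler_nat prime_gt1.
Qed.

(** Markov's inequality: the mean is at most 3, so [24 = 3 * 8] is exceeded by at most an eighth.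
    With [totient_lower] this is the origin of [expR (- 48)]. *)
Lemma card_recip_large (X : nat) : (0 < X)%N ->
  8 * #|[pred x : 'I_X | (24 < prime_recip (X + x))%R]|%:R <= X%:R :> R.
Proof.
move=> X0; have h := sum_prime_recip X0.
suff : 24 * #|[pred x : 'I_X | (24 < prime_recip (X + x))%R]|%:R <= 3 * X%:R :> R by lra.
apply: le_trans h; rewrite mulr_natr -sumr_const big_mkcond/=; apply: ler_sum => x _.
rewrite inE; case: ifPn => [/ltW//|_].
by rewrite /prime_recip sumr_ge0// => p _; rewrite invr_ge0.
Qed.

End PrimeReciprocals.

(** * Many admissible vectors in a box *)

Section GoodVectors.
Context {R : realType} {m : nat}.
Variables (c : 'I_m -> R) (i1 : 'I_m) (X : 'I_m -> nat) (B : nat).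
Hypotheses (X0 : forall i, (0 < X i)%N) (XB : forall i, (2 * X i <= B)%N) (X4 : (4 <= X i1)%N)
  (c_nonint : 0 < dist_int (c i1)).
Local Notation vecT := {ffun 'I_m -> 'I_B}.

Definition in_box : pred vecT := fun v => [forall i, (X i <= v i < 2 * X i)%N].

Definition good_vec : pred vecT := fun v => [&& in_box v,
  dist_int (c i1) / 2 <= dist_int (\sum_i c i * (v i : nat)%:R) &
  expR (- 48) * (gcdv (fun i => v i : nat))%:R <= (totient (gcdv (fun i => v i : nat)))%:R :> R].

Lemma card_box_slice (P : pred nat) :
  #|[pred v : vecT | in_box v && P (v i1)]| =
  (#|[pred x : 'I_(X i1) | P (X i1 + x)]| * \prod_(i | i != i1) X i)%N.
Proof.
have win i (Q : pred nat) : #|[pred x : 'I_B | (X i <= x < 2 * X i)%N && Q x]| =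
    #|[pred x : 'I_(X i) | Q (X i + x)%N]|.
  have b (x : 'I_(X i)) : (X i + x < B)%N by have := XB i; have := ltn_ord x; clear; lia.
  have inj : injective (fun x => Ordinal (b x)).
    by move=> x y /(congr1 val)/= /addnI/val_inj.
  rewrite -[RHS](fintype.card_image inj); apply: eq_card => y.
  apply/idP/fintype.imageP => [/andP[/andP[h1 h2] h3]|[x Qx ->]]; last first.
    apply/andP; split; last exact: Qx.
    by rewrite /= leq_addr/= mul2n -addnn ltn_add2l.
  have xb : (y - X i < X i)%N by move: h1 h2; clear; lia.
  exists (Ordinal xb); first by rewrite inE/= subnKC.
  by apply: val_inj; rewrite /= subnKC.
pose S i : pred 'I_B := [pred x : 'I_B | (X i <= x < 2 * X i)%N && ((i == i1) ==> P x)].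
transitivity #|family (fun i => mem (S i)) : {pred vecT}|.
  apply: eq_card => v; apply/andP/familyP => [[/forallP h1 h2] i|h].
    by apply/andP; split; [exact: h1|apply/implyP => /eqP ->].
  split; last by have /andP[_] := h i1; rewrite eqxx.
  by apply/forallP => i; have /andP[] := h i.
rewrite card_family_prod (bigD1 i1)//=; congr (_ * _)%N.
  by rewrite -win; apply: eq_card => x; rewrite !inE eqxx.
apply: eq_bigr => i ii; rewrite -[RHS](card_ord (X i)).
rewrite -[RHS](win i predT); apply: eq_card => x.
by rewrite !inE (negPf ii).
Qed.

Lemma card_box : #|in_box| = (\prod_i X i)%N.
Proof.
rewrite [RHS](bigD1 i1)//=; transitivity #|[pred v : vecT | in_box v && predT (v i1 : nat)]|.
  by apply: eq_card => v; exact: esym (andbT _).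
rewrite card_box_slice; congr (_ * _)%N.
by rewrite -[RHS]card_ord; apply: eq_card.
Qed.

(** Of [v] and its successor in the coordinate [i1], at least one has [c . v] at distance at least
    half that of [c i1] from the integers. Apart from the last slice [A3], at most a quarter of the
    box, the shift injects the bad vectors into the others, which leaves [3/8] of the box; the
    totient condition removes at most [1/8]. *)
Lemma good_count : (\prod_i X i)%N%:R <= 4 * #|good_vec|%:R :> R.
Proof.
set N := (\prod_i X i)%N; set Y := (\prod_(i | i != i1) X i)%N.
have NE : N = (X i1 * Y)%N by rewrite /N (bigD1 i1).
have YR : 0 <= Y%:R :> R by [].
pose A1 := [pred v : vecT | in_box v && (dist_int (\sum_i c i * (v i : nat)%:R) < dist_int (c i1) / 2)].
pose A2 := [pred v : vecT | in_box v && ((24 : R) < prime_recip (v i1))].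
pose A3 := [pred v : vecT | in_box v && ((v i1 : nat) == (2 * X i1).-1)].
have c2 : 8 * #|A2|%:R <= N%:R :> R.
  rewrite (card_box_slice (fun x => (24 : R) < prime_recip x)) NE !natrM mulrA ler_wpM2r//.
  exact: card_recip_large.
have c3 : (#|A3| <= Y)%N.
  rewrite (card_box_slice (fun x => x == (2 * X i1).-1)) -[leqRHS]mul1n leq_mul2r; apply/orP; right.
  by apply: card_window => a b /eqP ha /eqP hb; move: ha hb; clear; lia.
have c4 : 4 * #|A3|%:R <= N%:R :> R.
  by rewrite -natrM ler_nat NE leq_mul.
pose D1 := [pred v : vecT | in_box v && (dist_int (c i1) / 2 <= dist_int (\sum_i c i * (v i : nat)%:R))].
have cN : (#|A1| + #|D1| = N)%N.
  rewrite /N -card_box -cardUI; rewrite [X in (_ + X)%N]eq_card0 ?addn0.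
    apply: eq_card => v; rewrite -[RHS]/(in_box v) !inE; case: (in_box v) => //=.
    by case: ltP.
  by move=> v; rewrite !inE/=; case: (in_box v) => //=; case: ltP.
have c1 : (#|A1| <= #|D1| + #|A3|)%N.
  have -> : #|A1| = (#|[predI A1 & A3]| + #|[predD A1 & A3]|)%N by rewrite cardID.
  rewrite addnC; apply: leq_add; last first.
    by apply/subset_leq_card/fintype.subsetP => v /andP[].
  (* The reduction modulo [B] only makes the shift total; off [A3] nothing wraps around. *)
  have sb (v : vecT) : ((v i1).+1 %% B < B)%N by rewrite ltn_pmod// (leq_trans _ (XB i1))// muln_gt0 X0.
  pose F (v : vecT) : vecT := [ffun i => if i == i1 then Ordinal (sb v) else v i].
  have vB v : v \in [predD A1 & A3] -> ((v i1).+1 %% B = (v i1).+1)%N /\ ((v i1).+1 < 2 * X i1)%N.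
    move=> /andP[nv /andP[bv _]]; have /forallP/(_ i1)/andP[h1 h2] := bv.
    have h3 : (v i1 : nat) != (2 * X i1).-1.
      by apply: contraNneq nv => e; apply/andP; split => //; apply/eqP.
    have h4 : ((v i1).+1 < 2 * X i1)%N by move: h1 h2 h3; clear; lia.
    by split=> //; rewrite modn_small// (leq_trans h4).
  have Finj : {in [predD A1 & A3] &, injective F}.
    move=> v w hv hw /ffunP e; apply/ffunP => i; apply: val_inj => /=.
    have := e i; rewrite !ffunE; case: eqP => [->|_ ->//] /(congr1 val)/=.
    by rewrite (vB v hv).1 (vB w hw).1 => -[].
  rewrite -(card_in_image Finj); apply/subset_leq_card/fintype.subsetP => _ /fintype.imageP[v hv ->].
  have [v1 v2] := vB v hv.
  move: (hv) => /andP[_ /andP[bv dv]].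
  have SE : \sum_i c i * (F v i : nat)%:R = \sum_i c i * (v i : nat)%:R + c i1.
    rewrite (bigD1 i1)//= [in RHS](bigD1 i1)//= ffunE eqxx/= v1 -natr1 mulrDr mulr1.
    rewrite -!addrA; congr (_ + _); rewrite addrC; congr (_ + _).
    by apply: eq_bigr => i /negPf ii; rewrite ffunE ii.
  apply/andP; split.
    apply/forallP => i; rewrite ffunE; case: eqP => [->|_]; last exact: (forallP bv i).
    by rewrite /= v1 v2 andbT; have /andP[h _] := forallP bv i1; exact: leqW.
  rewrite SE leNgt; apply/negP => /dist_int_ltP[k hk].
  have [k' hk'] := dist_int_ltP dv.
  have := dist_int_le (c i1) (k - k'); rewrite leNgt => /negP; apply.
  have -> : c i1 - (k - k')%:~R = (\sum_i c i * (v i : nat)%:R + c i1 - k%:~R) - (\sum_i c i * (v i : nat)%:R - k'%:~R).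
    by rewrite rmorphB/=; ring.
  apply: le_lt_trans (ler_normB _ _) _; lra.
have cD : (#|D1| <= #|good_vec| + #|A2|)%N.
  rewrite -cardUI; apply: leq_trans (leq_addr _ _).
  apply/subset_leq_card/fintype.subsetP => v /andP[bv dv].
  apply/orP; have [rv|rv] := ltP (24 : R) (prime_recip (v i1)).
    by right; apply/andP; split.
  left; apply/and3P; split=> //.
  have /forallP/(_ i1)/andP[h1 _] := bv.
  have v0 : (0 < v i1)%N by apply: leq_trans h1.
  have gv : (gcdv (fun i => v i : nat) %| v i1)%N by exact: (gcdv_dvd (fun i => v i : nat)).
  apply: le_trans (totient_lower (dvdn_gt0 v0 gv)).
  rewrite ler_wpM2r// ler_expR lerN2.
  have := prime_recip_dvd (R := R) v0 gv; lra.
have c1' : #|A1|%:R <= #|D1|%:R + #|A3|%:R :> R by rewrite -natrD ler_nat.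
have cN' : #|A1|%:R + #|D1|%:R = N%:R :> R by rewrite -natrD cN.
have cD' : #|D1|%:R <= #|good_vec|%:R + #|A2|%:R :> R by rewrite -natrD ler_nat.
lra.
Qed.

End GoodVectors.

(** * Blocks of integer vectors *)

Section IntegerBoxes.
Context {R : realType} {m : nat}.
Variable (T : 'I_m -> nat).
Local Notation N := (\sum_i (2 * T i).+1)%N.
Local Notation code := {ffun 'I_m -> 'I_N.+1}.

Definition box_decode (x : code) : 'cV[int]_m := \col_i ((x i : nat)%:Z - (T i)%:Z).

Lemma sum_box_le (s : seq 'cV[int]_m) (w : 'cV[int]_m -> R) : uniq s ->
  (forall u, 0 <= w u) -> (forall u, u \in s -> forall i, (absz (u i 0%R) <= T i)%N) ->
  \sum_(u <- s) w u <=
  \sum_(x : code | [forall i, (x i < (2 * T i).+1)%N]) w (box_decode x).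
Proof.
move=> us w0 sT.
pose E (u : 'cV[int]_m) : code := [ffun i => inord (absz (u i 0%R + (T i)%:Z)%R)].
have TN i : ((2 * T i).+1 <= N)%N by exact: leq_bigsum.
have bnd u i : u \in s -> (absz (u i 0 + (T i)%:Z)%R < (2 * T i).+1)%N.
  by move=> /sT/(_ i); clear; lia.
have EK u : u \in s -> box_decode (E u) = u.
  move=> su; apply/matrixP => i j; rewrite ord1 !mxE ffunE inordK; last first.
    by rewrite ltnS ltnW// (leq_trans (bnd u i su)).
  have : (absz (u i 0%R) <= T i)%N by exact: sT.
  by move: (u i 0%R); clear; lia.
have Einj : {in s &, injective E} by move=> u v su sv e; rewrite -(EK u)// -(EK v)// e.
rewrite big_seq (eq_bigr (fun u => w (box_decode (E u)))) => [|u su]; last by rewrite EK.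
rewrite -big_seq -(big_map E predT (fun x => w (box_decode x))).
have uE : uniq (map E s) by rewrite map_inj_in_uniq.
rewrite /= big_uniq//=.
rewrite big_mkcond [leRHS]big_mkcond/=; apply: ler_sum => x _.
case: ifPn => [/mapP[u su ->]|_]; last by case: ifP.
case: ifPn => // /negP[]; apply/forallP => i; rewrite ffunE inordK; first exact: bnd.
by rewrite ltnS ltnW// (leq_trans (bnd u i su)).
Qed.

Lemma size_box_le (s : seq 'cV[int]_m) : uniq s ->
  (forall u, u \in s -> forall i, (absz (u i 0%R) <= T i)%N) ->
  (size s <= \prod_i (2 * T i).+1)%N.
Proof.
move=> us sT; have := @sum_box_le s (fun=> 1) us (fun=> ler01) sT.
rewrite big_const_seq count_predT iter_addr_0 sumr_const -(ler_nat R) => h.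
apply: le_trans h _; rewrite ler_nat -(@card_bounded_ffunE _ N.+1); last first.
  by move=> i; rewrite ltnW// ltnS leq_bigsum.
by apply: eq_leq; apply: eq_card.
Qed.

End IntegerBoxes.

Section Blocks.
Context {R : realType} {m n : nat}.
Variables (alpha : 'I_m -> R) (beta : 'I_n -> R) (psi f : R -> R) (lambda : R)
  (j0 : 'I_n) (ia : 'I_m).
Hypotheses (hm : (0 < m)%N)
  (halpha : forall i, 0 < alpha i) (hbeta : forall j, 0 < beta j)
  (salpha : \sum_(i < m) alpha i = 1) (sbeta : \sum_(j < n) beta j = 1)
  (alpha_max : forall i, alpha i <= alpha ia)
  (beta_decr : forall j l : 'I_n, (j <= l)%N -> beta l <= beta j)
  (psi_pos : forall t, 0 < t -> 0 < psi t)
  (psi_decr : forall s t, 0 < s -> s <= t -> psi t <= psi s)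
  (psi_lim : psi t @[t --> +oo] --> 0)
  (hlambda : 1 < lambda)
  (psi_ratio : forall t, 1 <= t -> lambda <= psi t / psi (2 * t))
  (f_ge0 : forall x, 0 <= x -> 0 <= f x)
  (f_ge : dim_lower (m.-1 * n + (n - j0.+1)) f)
  (f_le : dim_upper f (m.-1 * n + (n - j0))).

(* With ratio 4 ^ m, consecutive scales differ by a factor at least 4 in the
   coordinate of largest weight, which keeps the boxes of distinct blocks
   disjoint. *)
Definition scale (k : nat) : R := (4 ^+ m) ^+ k.

Definition height (k : nat) : R := scale k `^ alpha ia.

(** A lower bound for [t(u)] on block [k]. *)
Definition tau (k : nat) : R := inf [set t : R | 0 < t /\ psi t < (scale k)^-1].

Definition block_gamma (k : nat) : R :=
  Phi f (m.-1 * n) (plank_width beta (tau k) (height k)) (plank_width beta (tau k) (height k) j0).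

Lemma scale_ge1 k : 1 <= scale k.
Proof. by rewrite !exprn_ege1// ler1n. Qed.

Lemma scale_gt0 k : 0 < scale k.
Proof. exact: lt_le_trans (scale_ge1 k). Qed.

Lemma scaleS k : scale k.+1 = 4 ^+ m * scale k.
Proof. by rewrite /scale exprS. Qed.

Lemma scale_le k l : (k <= l)%N -> scale k <= scale l.
Proof. by move=> kl; apply: ler_weXn2l => //; rewrite exprn_ege1// ler1n. Qed.

Lemma alpha_le1 i : alpha i <= 1.
Proof. by rewrite -salpha (bigD1 i)//= lerDl sumr_ge0// => j _; exact: ltW. Qed.

Lemma alpha_max_ge : m%:R^-1 <= alpha ia.
Proof.
have mR : 0 < m%:R :> R by rewrite ltr0n.
rewrite -[leLHS]mul1r ler_pdivrMr// mulr_natr -[leLHS]salpha.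
apply: (@le_trans _ _ (\sum_(i < m) alpha ia)); first by apply: ler_sum => i _; exact: alpha_max.
by rewrite sumr_const card_ord.
Qed.

Lemma scale_step : 4 <= (4 ^+ m) `^ alpha ia :> R.
Proof.
have m4 : 1 <= 4 ^+ m :> R by rewrite exprn_ege1// ler1n.
apply: le_trans (ler_powR m4 alpha_max_ge).
rewrite -powR_mulrn// -powRrM mulfV ?powRr1//.
by rewrite pnatr_eq0 -lt0n.
Qed.

Lemma powR_scaleS k i : scale k.+1 `^ alpha i = (4 ^+ m) `^ alpha i * scale k `^ alpha i.
Proof. by rewrite scaleS powRM// ?(ltW (scale_gt0 _))// exprn_ge0. Qed.

Lemma powR_scale_ge1 k i : 1 <= scale k `^ alpha i.
Proof. by rewrite -[leLHS](powRr0 (scale k)) ler_powR ?scale_ge1// ltW. Qed.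

Lemma scale_prod k : scale k = \prod_(i < m) scale k `^ alpha i.
Proof.
rewrite -[LHS]powRr1 ?(ltW (scale_gt0 _))// -[X in _ `^ X = _]salpha.
elim/big_rec2: _ => [|i x y _ <-]; first by rewrite powRr0.
by rewrite powRD//; apply/implyP => _; rewrite gt_eqF ?scale_gt0.
Qed.

Lemma powR_scale_height k i : scale k `^ alpha i <= height k.
Proof. by rewrite ler_powR ?scale_ge1. Qed.

Lemma height_gt0 k : 0 < height k.
Proof. exact: powR_gt0 (scale_gt0 k). Qed.

Lemma nat_le_pow4 (k : nat) : k%:R <= 4 ^+ k :> R.
Proof. by rewrite -natrX ler_nat ltnW// ltn_expl. Qed.

Lemma scale_large (B : R) : exists k0, forall k, (k0 <= k)%N -> B <= scale k.
Proof.
exists (Num.truncn (Num.max B 0)).+1 => k kk.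
have B0 : 0 <= Num.max B 0 by rewrite le_max lexx orbT.
apply: (@le_trans _ _ (Num.max B 0)); first by rewrite le_max lexx.
apply: le_trans (ltW (truncn_gt B0)) _.
apply: (@le_trans _ _ k%:R); first by rewrite ler_nat.
apply: le_trans (nat_le_pow4 k) _; rewrite /scale -exprM; apply: ler_weXn2l; first by rewrite ler1n.
by rewrite leq_pmull.
Qed.

Lemma tau_set k : [set t : R | 0 < t /\ psi t < (scale k)^-1] !=set0.
Proof.
have e0 : 0 < (scale k)^-1 by rewrite invr_gt0 scale_gt0.
have [T T1 hT] := psi_small psi_pos psi_lim e0.
by exists T; split; [exact: lt_le_trans T1|exact: hT].
Qed.

Lemma tau_ge k t : 0 < t -> psi t < (scale k)^-1 -> tau k <= t.
Proof. by move=> t0 ht; apply: ge_inf; [exists 0 => x [/ltW]|split]. Qed.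

Lemma tau_large (T : R) : exists k0, forall k, (k0 <= k)%N -> T <= tau k.
Proof.
pose T1 := Num.max T 1; have T10 : 0 < T1 by rewrite lt_max ltr01 orbT.
have [k0 hk] := scale_large (psi T1)^-1; exists k0 => k /hk sk.
apply: (@le_trans _ _ T1); first by rewrite le_max lexx.
apply: lb_le_inf; first exact: tau_set.
move=> t [t0 ht]; rewrite leNgt; apply/negP => tT.
have := psi_decr t0 (ltW tT); rewrite leNgt => /negP; apply.
apply: lt_le_trans ht _; rewrite -[leRHS]invrK lef_pV2 ?posrE ?invr_gt0 ?psi_pos//.
exact: scale_gt0.
Qed.

(** The infimum itself need not satisfy the inequality; a time strictly beyond it does, hence the
    doubling. *)
Lemma psi_tau k : 0 < tau k -> psi (2 * tau k) < (scale k)^-1.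
Proof.
move=> t0; have h : tau k < 2 * tau k by lra.
have [t [t1 t2] t3] := inf_lt (tau_set k) h.
by apply: le_lt_trans t2; apply: psi_decr => //; exact: ltW.
Qed.

Definition below (u : 'cV[int]_m) (k : nat) := forall i, `|(u i 0)%:~R| < scale k `^ alpha i.

Definition weight (u : 'cV[int]_m) : R :=
  fine (gamma alpha beta psi f u) * `|real_vec u : 'cV[R]_m| ^+ n.

Lemma gamma_ge0 u : (0 <= gamma alpha beta psi f u)%E.
Proof.
apply: le_bigmin => [|k _]; first exact: leey.
rewrite lee_fin; apply: mulr_ge0; last by apply: prodr_ge0 => l _; exact: powR_ge0.
by rewrite mulr_ge0 ?powR_ge0// f_ge0// divr_ge0// powR_ge0.
Qed.

Lemma gamma_fin_num u : gamma alpha beta psi f u \is a fin_num.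
Proof.
rewrite ge0_fin_numE ?gamma_ge0//.
by rewrite /gamma (bigD1 j0)//= gt_min ltry.
Qed.

Lemma weight_ge0 u : 0 <= weight u.
Proof. by rewrite mulr_ge0 ?exprn_ge0// fine_ge0 ?gamma_ge0. Qed.

(** The widths of [u] may exceed those of the block because [|u|] may be smaller than [height k].
    Shrinking them by [c = |u| / H] costs [c ^+ n] by [Phi_scale], and this is exactly what
    [|u| ^+ n = H ^+ n * c ^+ n] repays. *)
Lemma weight_block k u : 1 <= tau k -> u != 0 -> ~ below u k -> below u k.+1 ->
  weight u <= (4 ^+ m) ^+ n * (height k ^+ n * block_gamma k).
Proof.
move=> tk u0 nbu bu.
have tu : tau k <= t_of alpha psi u.
  apply: lb_le_inf; first exact: (t_set_nonempty halpha psi_pos psi_lim).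
  move=> t [t0 ht]; apply: tau_ge => //.
  have [i hi] : exists i, scale k `^ alpha i <= `|(u i 0)%:~R|.
    apply: contrapT => /forallNP h; apply: nbu => i; rewrite ltNge; apply/negP; exact: h.
  have := le_lt_trans hi (ht i); apply: contraTT; rewrite -!leNgt => le.
  have x0 : 0 < (scale k)^-1 by rewrite invr_gt0 scale_gt0.
  apply: le_trans (powRN_le x0 le (ltW (halpha i))) _.
  by rewrite -powR_inv1 ?(ltW (scale_gt0 _))// -powRrM mulN1r opprK.
have t1 := le_trans tk tu.
have hu : 0 < `|real_vec u : 'cV[R]_m| by exact: real_vec_eq0.
set h := `|real_vec u : 'cV[R]_m| in hu *; set t := t_of alpha psi u in tu t1.
pose H := 4 ^+ m * height k; have m4 : 1 <= 4 ^+ m :> R by rewrite exprn_ege1// ler1n.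
have H0 : 0 < H by rewrite mulr_gt0 ?height_gt0// (lt_le_trans _ m4).
have t0 : 0 < t by exact: lt_le_trans t1.
have tk0 : 0 < tau k by exact: lt_le_trans tk.
have hH : h <= H.
  apply: mxnorm_le; first exact: ltW.
  move=> i j; rewrite ord1 mxE; apply: le_trans (ltW (bu i)) _; rewrite powR_scaleS; apply: ler_pM; rewrite ?powR_ge0//; last exact: powR_scale_height.
  by rewrite -[leRHS]powRr1 ?exprn_ge0// ler_powR// alpha_le1.
rewrite /weight (gamma_PhiE beta_decr hm f_ge0 f_ge f_le u0 t1)/= -/h -/t.
set r := plank_width beta (tau k) (height k) j0.
have r0 : 0 < r by apply: plank_width_gt0 => //; exact: height_gt0.
apply: (@le_trans _ _ (Phi f (m.-1 * n) (plank_width beta t h) r * h ^+ n)).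
  rewrite ler_pM2r ?exprn_gt0//; apply: Phi_min => //.
  - by move=> l; exact: plank_width_gt0.
  - by move=> l l'; exact: plank_width_mono.
pose c := h / H; have c01 : 0 < c <= 1 by rewrite divr_gt0//= ler_pdivrMr// mul1r.
have fr : 0 <= f r by apply: f_ge0; exact: ltW.
have := Phi_scale (m.-1 * n) (plank_width beta t h) fr r0 c01 => h1.
have h2 : Phi f (m.-1 * n) (fun l => c * plank_width beta t h l) r <= block_gamma k.
  apply: Phi_mono => // l; rewrite /plank_width /c mulf_div [h * _]mulrC -mulf_div divff ?gt_eqF// mulr1.
  rewrite ler_pM ?invr_ge0 ?powR_ge0 ?(ltW H0)//.
    by apply: powRN_le => //; exact: ltW.
  by rewrite lef_pV2 ?posrE ?height_gt0// ler_peMl// ltW ?height_gt0.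
have -> : (4 ^+ m) ^+ n * (height k ^+ n * block_gamma k) = H ^+ n * block_gamma k.
  by rewrite mulrA -exprMn.
apply: (@le_trans _ _ (H ^+ n * (c ^+ n * Phi f (m.-1 * n) (plank_width beta t h) r))); last first.
  by rewrite ler_pM2l ?exprn_gt0//; exact: le_trans h1 h2.
by apply: ler_eq; rewrite mulrA -exprMn (mulrC H) /c divfK ?gt_eqF// mulrC.
Qed.

Lemma below_trunc u k : below u k ->
  forall i, (absz (u i 0%R) <= Num.truncn (scale k `^ alpha i))%N.
Proof.
move=> bu i; apply: truncn_ge; apply: le_trans (ltW (bu i)).
by rewrite -intr_norm -[(absz _)%:R]/((absz (u i 0))%:Z%:~R) abszE.
Qed.

Lemma block_size k (s : seq 'cV[int]_m) : uniq s -> (forall u, u \in s -> below u k) ->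
  (size s)%:R <= 3 ^+ m * scale k.
Proof.
move=> us sb.
have := @size_box_le R m (fun i => Num.truncn (scale k `^ alpha i)) s us
  (fun u su => below_trunc (sb u su)).
rewrite -(ler_nat R) natr_prod => h; apply: le_trans h _.
have -> : 3 ^+ m * scale k = \prod_(i < m) (3 * scale k `^ alpha i).
  by rewrite big_split/= prodr_const card_ord -scale_prod.
apply: ler_prod => i _; rewrite ler0n/= -natr1 natrM.
have := truncn_le (powR_ge0 (scale k) (alpha i)); have := powR_scale_ge1 k i.
by lra.
Qed.

(** Bounded block sums would bound all finite partial sums of the series: block [k] has [O(scale k)]
    vectors, each of weight at most a constant times [height k ^+ n * block_gamma k]. *)
Lemma block_divergence : gamma_series alpha beta psi f = +oo%E ->
  forall (B : R) (k0 : nat), exists k1, 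
    B <= \sum_(k0 <= k < k1) scale k * (height k ^+ n * block_gamma k).
Proof.
move=> div B k00; have [k01 hk01] := tau_large 1.
apply: contrapT => /forallNP nB.
pose om k := scale k * (height k ^+ n * block_gamma k).
(* From [k01] on [tau k >= 1]. The successor keeps [k0] positive, so that [KN] applies to every
   later block. *)
pose k0 := (maxn k00 k01).+1.
have om0 k : 1 <= tau k -> 0 <= om k.
  move=> tk; have tk0 : 0 < tau k by exact: lt_le_trans tk.
  apply: mulr_ge0; first exact: ltW (scale_gt0 _).
  apply: mulr_ge0; first by rewrite exprn_ge0// ltW// height_gt0.
  have p0 : 0 < plank_width beta (tau k) (height k) j0 by apply: plank_width_gt0 => //; exact: height_gt0.
  by apply: Phi_ge0 => //; apply: f_ge0; exact: ltW.
pose low := \sum_(k00 <= k < k0) `|om k|.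
have part k1 : \sum_(k0 <= k < k1) om k <= B + low.
  have [k10|k10] := leqP k1 k0.
    rewrite big_geq//; apply: addr_ge0; last by apply: sumr_ge0.
    by have /negP := nB k00; rewrite big_geq// -ltNge => /ltW.
  have /negP := nB k1; rewrite -ltNge => /ltW.
  have k000 : (k00 <= k0)%N by rewrite /k0; apply: leqW; exact: leq_maxl.
  rewrite (big_cat_nat k000 (ltnW k10))/= -/(om _) => h.
  have : - low <= \sum_(k00 <= k < k0) om k.
    by rewrite /low -sumrN; apply: ler_sum => i _; rewrite lerNl -normrN ler_norm.
  move: h; rewrite -/om; lra.
pose T0 i := Num.truncn (scale k0 `^ alpha i).
pose S0 := \sum_(x : {ffun 'I_m -> 'I_(\sum_i (2 * T0 i).+1).+1} | [forall i, (x i < (2 * T0 i).+1)%N])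
   weight (box_decode x).
pose C1 : R := 3 ^+ m * 4 ^+ m * (4 ^+ m) ^+ n.
have C10 : 0 <= C1 by rewrite !mulr_ge0 ?exprn_ge0.
suff : (gamma_series alpha beta psi f <= (S0 + C1 * (B + low))%:E)%E by rewrite div leNgt ltry.
apply: ub_ereal_sup => _ [X [fX X0] <-].
have wE u : (gamma alpha beta psi f u * (`|real_vec u : 'cV[R]_m| ^+ n)%:E)%E = (weight u)%:E.
  by rewrite EFinM fineK ?gamma_fin_num.
have /finite_seqP[q qX] := fX; pose s := undup q.
have us : uniq s by exact: undup_uniq.
have XE : X = [set` s] by rewrite qX; apply/seteqP; split => u /=; rewrite mem_undup.
have sX u : u \in s -> u != 0 by move=> su; apply: X0; rewrite XE.
rewrite XE -fsbig_seq//= (eq_bigr (fun u => (weight u)%:E)) => [|u _]; last exact: wE.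
rewrite sumEFin lee_fin.
have ex u : exists k, `[< below u k.+1 >].
  have h i : \forall k \near \oo, `|(u i 0)%:~R| < scale k.+1 `^ alpha i :> R.
    have [k' hk'] := scale_large ((`|(u i 0)%:~R| + 1) `^ (alpha i)^-1).
    exists k' => // l /= kl; have := hk' l.+1 (leqW kl).
    move=> /(powR_le (powR_ge0 _ _))/(_ (ltW (halpha i))).
    rewrite -powRrM mulVf ?gt_eqF// powRr1 ?addr_ge0// => h1.
    by apply: lt_le_trans h1; rewrite ltrDl.
  have [l _ hl] : \forall k \near \oo, forall i, `|(u i 0)%:~R| < scale k.+1 `^ alpha i :> R.
    by apply: filter_forall => i; exact: h.
  by exists l; apply/asboolP => i; apply: hl; rewrite /= leqnn.
pose K u := ex_minn (ex u).
have KP u : below u (K u).+1 by rewrite /K; case: ex_minnP => k /asboolP.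
have KN u : (0 < K u)%N -> ~ below u (K u).
  rewrite /K; case: ex_minnP => k _ kmin k_gt0 bu.
  by have := kmin k.-1; rewrite prednK// => /(_ (asboolT bu)); rewrite leqNgt ltn_predL k_gt0.
have below_le u k l : (k <= l)%N -> below u k -> below u l.
  move=> kl bu i; apply: lt_le_trans (bu i) _; apply: powR_le.
  - exact: ltW (scale_gt0 _).
  - exact: scale_le.
  - exact: ltW.
have [k1 hk1] : exists k1, forall u, u \in s -> (K u < k1)%N.
  exists (\sum_(u <- s) K u).+1%N => u su.
  by rewrite ltnS (big_rem u)//= leq_addr.
rewrite (bigID (fun u => (K u < k0)%N))/=; apply: lerD.
  rewrite -big_filter; apply: sum_box_le; first exact: filter_uniq.
    by move=> u; exact: weight_ge0.
  move=> u; rewrite mem_filter => /andP[Ku _]; apply: below_trunc.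
  exact: below_le (KP u).
apply: (@le_trans _ _ (\sum_(u <- s) \sum_(k0 <= k < k1) if K u == k then weight u else 0)).
  rewrite big_mkcond/= big_seq [leRHS]big_seq; apply: ler_sum => u su.
  case: ifPn => [|_]; last by apply: sumr_ge0 => k _; case: ifP => // _; exact: weight_ge0.
  rewrite -leqNgt => ku; rewrite (bigD1_seq (K u)) ?iota_uniq//= ?eqxx; last first.
    by rewrite mem_index_iota ku hk1.
  by rewrite lerDl; apply: sumr_ge0 => k _; case: ifP => // _; exact: weight_ge0.
rewrite exchange_big/=.
apply: (@le_trans _ _ (\sum_(k0 <= k < k1) C1 * om k)); last first.
  by rewrite -mulr_sumr ler_wpM2l.
apply: ler_sum_nat => k /andP[k0k _].
have kk : (k01 <= k)%N by apply: leq_trans k0k; rewrite /k0; apply: leqW; exact: leq_maxr.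
have tk := hk01 k kk.
rewrite -big_mkcond/= -big_filter.
apply: (@le_trans _ _ (\sum_(u <- [seq u <- s | K u == k]) (4 ^+ m) ^+ n * (height k ^+ n * block_gamma k))).
  rewrite big_seq [leRHS]big_seq; apply: ler_sum => u; rewrite mem_filter => /andP[/eqP Ku su].
  apply: weight_block => //; [exact: sX| |by rewrite -Ku].
  by rewrite -Ku; apply: KN; rewrite Ku; exact: leq_ltn_trans k0k.
rewrite big_const_seq count_predT iter_addr_0 -[leLHS]mulr_natl.
have sz : (size [seq u <- s | K u == k])%:R <= 3 ^+ m * scale k.+1.
  apply: block_size; first exact: filter_uniq.
  by move=> u; rewrite mem_filter => /andP[/eqP <- _].
have p0 : 0 <= (4 ^+ m) ^+ n * (height k ^+ n * block_gamma k).
  have := om0 k tk; rewrite /om pmulr_rge0 ?scale_gt0// => h.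
  by rewrite mulr_ge0 ?exprn_ge0.
apply: le_trans (ler_wpM2r p0 sz) _.
by apply: ler_eq; rewrite /om /C1 scaleS; ring.
Qed.

End Blocks.

(** * Parameters of a block *)

Lemma sum_sig (R : realType) (T : finType) (P : pred T) (F : T -> R) :
  \sum_(a : {x : T | P x}) F (val a) = \sum_(x | P x) F x.
Proof.
rewrite [RHS](reindex_omap val (insub : T -> option {x : T | P x})) => [|x Px]; last by rewrite insubT.
by apply: eq_bigl => a; rewrite valK eqxx andbT (valP a).
Qed.

Section Supply.
Context {R : realType} {m n : nat}.
Variables (alpha : 'I_m -> R) (beta : 'I_n -> R) (psi f : R -> R) (lambda : R)
  (b : 'cV[R]_m) (j0 : 'I_n) (ia : 'I_m) (g : nat).
Hypotheses (hm : (0 < m)%N)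
  (halpha : forall i, 0 < alpha i) (hbeta : forall j, 0 < beta j)
  (salpha : \sum_(i < m) alpha i = 1) (sbeta : \sum_(j < n) beta j = 1)
  (alpha_max : forall i, alpha i <= alpha ia)
  (beta_decr : forall j l : 'I_n, (j <= l)%N -> beta l <= beta j)
  (psi_pos : forall t, 0 < t -> 0 < psi t)
  (psi_decr : forall s t, 0 < s -> s <= t -> psi t <= psi s)
  (psi_lim : psi t @[t --> +oo] --> 0)
  (hlambda : 1 < lambda)
  (psi_ratio : forall t, 1 <= t -> lambda <= psi t / psi (2 * t))
  (f_ge0 : forall x, 0 <= x -> 0 <= f x)
  (f_ge : dim_lower (m.-1 * n + (n - j0.+1)) f)
  (f_le : dim_upper f (m.-1 * n + (n - j0)))
  (f_lim : f r / r ^+ (m * n) @[r --> 0^'+] --> +oo)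
  (g2 : (1 < g)%N).
Local Notation G l := (g%:R ^- l : R).
Local Notation scale := (@scale R m).
Local Notation height := (height alpha ia).
Local Notation tau := (@tau R m psi).
Local Notation block_gamma := (block_gamma alpha beta psi f j0 ia).
Local Notation width k := (plank_width beta (tau k) (height k)).

Let g0 : (0 < g)%N. Proof. exact: ltnW. Qed.
Let gR0 : 0 < g%:R :> R. Proof. by rewrite ltr0n. Qed.
Let G0 l : 0 < G l. Proof. by rewrite invr_gt0 exprn_gt0. Qed.
Let h0 k : 0 < height k. Proof. exact: height_gt0. Qed.

(** Pairing a solution with [u] writes [b . u], up to the integer [P], as [u . (A q + b - k)] minus
    the sum of the errors of [A^T u] times [q]; the hypothesis says that both parts are too small
    together. *)
Lemma unsolvable_time (u : 'I_m -> nat) (p : 'I_n -> int) (A : 'M[R]_(m, n)) (t : R) : 0 < t ->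
  \sum_i (u i)%:R * psi t `^ alpha i + \sum_l `|\sum_i (u i)%:R * A i l - (p l)%:~R| * t `^ beta l
    < dist_int (\sum_i b i 0 * (u i)%:R) ->
  ~ solvable_at alpha beta psi b A t.
Proof.
move=> t0 lt [q [_ h1 h2]].
have k1 := (weighted_dist_intP halpha _ (psi_pos t0)).1 h1.
have q1 := (weighted_normP hbeta _ t0).1 h2.
pose k i := sval (cid (k1 i)).
have k2 i : `|(A *m real_vec q + b) i 0 - (k i)%:~R| < psi t `^ alpha i by exact: (svalP (cid (k1 i))).
pose P : int := \sum_i (u i)%:Z * k i - \sum_l q l 0 * p l.
move: lt; rewrite ltNge => /negP; apply; apply: le_trans (dist_int_le _ P) _.
have -> : \sum_i b i 0 * (u i)%:R - P%:~R =
    \sum_i (u i)%:R * ((A *m real_vec q + b) i 0 - (k i)%:~R) -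
    \sum_l (\sum_i (u i)%:R * A i l - (p l)%:~R) * (q l 0)%:~R.
  have e1 : \sum_i (u i)%:R * ((A *m real_vec q + b) i 0 - (k i)%:~R) =
      \sum_i \sum_l (u i)%:R * A i l * (q l 0)%:~R + \sum_i b i 0 * (u i)%:R - \sum_i (u i)%:R * (k i)%:~R.
    rewrite -big_split/= -sumrB; apply: eq_bigr => i _; rewrite !mxE mulrBr mulrDr; congr (_ + _ - _); last by rewrite mulrC.
    by rewrite mulr_sumr; apply: eq_bigr => l _; rewrite mxE mulrA.
  have e2 : \sum_l (\sum_i (u i)%:R * A i l - (p l)%:~R) * (q l 0)%:~R =
      \sum_i \sum_l (u i)%:R * A i l * (q l 0)%:~R - \sum_l (q l 0)%:~R * (p l)%:~R.
    rewrite exchange_big/= -sumrB; apply: eq_bigr => l _; rewrite mulrBl mulr_suml; congr (_ - _).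
    by rewrite mulrC.
  have e3 : P%:~R = \sum_i (u i)%:R * (k i)%:~R - \sum_l (q l 0)%:~R * (p l)%:~R :> R.
    rewrite /P rmorphB/= !rmorph_sum/=; congr (_ - _); apply: eq_bigr => i _; rewrite rmorphM//=.
  rewrite e1 e2 e3; ring.
apply: le_trans (ler_normB _ _) _; apply: lerD.
  apply: le_trans (ler_norm_sum _ _ _) _; apply: ler_sum => i _.
  by rewrite normrM normr_nat ler_wpM2l// ltW// k2.
apply: le_trans (ler_norm_sum _ _ _) _; apply: ler_sum => l _.
by rewrite normrM ler_wpM2l//; have := q1 l; rewrite mxE => /ltW.
Qed.

Lemma f_small (c : R) : exists2 e : R, 0 < e & forall r, 0 < r <= e -> c * r ^+ (m * n) <= f r.
Proof.
move/cvgryPge: f_lim => /(_ c); rewrite near_withinE => /nbhs_ballP[e /= e0 h].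
exists (e / 2); first by rewrite divr_gt0.
move=> r /andP[r0 re]; have := h r; rewrite /ball/= sub0r normrN gtr0_norm// => /(_ _ r0).
by rewrite ler_pdivlMr ?exprn_gt0//; apply; apply: le_lt_trans re _; lra.
Qed.

Lemma powR_scale_large i (B : R) : exists k0, forall k, (k0 <= k)%N -> B <= scale k `^ alpha i.
Proof.
have [k0 hk] := @scale_large R m hm ((`|B|) `^ (alpha i)^-1); exists k0 => k /hk.
move=> /(powR_le (powR_ge0 _ _))/(_ (ltW (halpha i))).
by rewrite -powRrM mulVf ?gt_eqF// powRr1//; apply: le_trans; exact: ler_norm.
Qed.

Lemma Phi_rescale (N : R) (e : nat) (rho : 'I_n -> R) r : 0 < N -> 0 < r ->
  Phi (fun x => f (x / N)) e rho r = N ^- e * Phi f e (fun l => rho l / N) (r / N).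
Proof.
move=> N0 r0; rewrite /Phi.
have -> : \prod_(l < n) Num.max 1 (rho l / N / (r / N)) = \prod_(l < n) Num.max 1 (rho l / r).
  by apply: eq_bigr => l _; rewrite invfM invrK mulrACA mulVf ?gt_eqF// mulr1.
rewrite expr_div_n invfM invrK; set F := f _; set P := \prod_(l < n) _.
rewrite !mulrA [N ^- e * F]mulrC; congr (_ * _); rewrite -!mulrA; congr (_ * _).
by rewrite mulrCA mulVf ?mulr1// expf_neq0// gt_eqF.
Qed.

(** The level [s] is the coarsest at which planks fattened to the cell size still satisfy the
    content bound and [8 * G s * height k <= 1]. Failure at [s - 1] is what bounds the fattened
    volume from below. *)
Lemma block_data (lv : nat) (K cd : R) : 0 < K -> 0 < cd <= 1 / 4 ->
  exists2 c5 : R, 0 < c5 & exists k2, forall k, (k2 <= k)%N -> 1 <= tau k /\ exists s : nat,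
  let eta l := cd * (2 * tau k) `^ (- beta l) in
  [/\ 8 * (G s * height k) <= 1,
      forall h, height k <= h -> h <= 4 * height k -> forall r, 0 < r ->
        K * \prod_(l < n) Num.max (eta l / h) (G s) <=
        Phi (fun x => f (x / g%:R ^+ lv)) (m.-1 * n) (fun l => eta l / h) r
    & forall h, height k <= h ->
        Num.min ((32 * g%:R) ^- n) (c5 * (height k ^+ n * block_gamma k)) <=
        \prod_(l < n) (1 / 4 * Num.max (eta l) (G s * h))].
Proof.
move=> K0 /andP[cd0 cd4].
pose N : R := g%:R ^+ lv; pose e := (m.-1 * n)%N.
have N0 : 0 < N by rewrite exprn_gt0.
have N1 : 1 <= N by rewrite exprn_ege1// ler1n.
(* The 8 consists of 2 for the time [2 * tau k], as [beta l <= 1], and 4 for [h <= 4 * height k];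
   [N] is the magnification of a cube of level [lv]. *)
pose c := cd / (8 * N).
have c0 : 0 < c by rewrite divr_gt0// mulr_gt0.
have c1 : c <= 1 by rewrite ler_pdivrMr ?mulr_gt0// mul1r; lra.
pose c4 := N ^- e * c ^+ n.
have c40 : 0 < c4 by rewrite mulr_gt0 ?invr_gt0 ?exprn_gt0.
have g4 : 0 < (4 * g%:R) ^- n :> R by rewrite invr_gt0 exprn_gt0// mulr_gt0.
exists ((4 * g%:R) ^- n * (c4 / K)); first by rewrite (mulr_gt0 g4)// divr_gt0.
have [ep ep0 hep] := f_small (K / c4).
have [ka hka] := tau_large hm psi_pos psi_decr psi_lim 1.
have [kb hkb] := powR_scale_large ia ep^-1.
exists (maxn ka kb) => k; rewrite geq_max => /andP[/hka tk /hkb hk]; split=> //.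
have tk0 : 0 < tau k by exact: lt_le_trans tk.
pose eta l := cd * (2 * tau k) `^ (- beta l).
have t2 : 0 < 2 * tau k by rewrite mulr_gt0.
have eta0 l : 0 < eta l by rewrite mulr_gt0// powR_gt0.
have w0 l : 0 < width k l by exact: plank_width_gt0.
have etaw l : eta l / height k <= width k l.
  rewrite ler_pM2r ?invr_gt0//; apply: le_trans (_ : tau k `^ (- beta l) <= _); last by [].
  have : (2 * tau k) `^ (- beta l) <= tau k `^ (- beta l).
    by apply: powRN_le => //; [lra|exact: ltW].
  have := powR_ge0 (2 * tau k) (- beta l); have := powR_ge0 (tau k) (- beta l).
  rewrite /eta; nra.
set r := width k j0; have r0 : 0 < r by exact: w0.
have re : r <= ep.
  rewrite /r /plank_width ler_pdivrMr//.
  apply: (@le_trans _ _ 1).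
    rewrite -[leRHS](powRr0 (tau k)) ler_powR// oppr_le0; exact: ltW.
  by rewrite -ler_pdivrMl// mulr1.
have fr : K / c4 * r ^+ (m * n) <= f r by apply: hep; rewrite r0.
have GE : block_gamma k = Phi f e (width k) r by [].
have mnE : (m * n = e + n)%N by rewrite /e -[in LHS](prednK hm) mulSn addnC.
have prodE : r ^+ n * \prod_(l < n) Num.max 1 (width k l / r) = \prod_(l < n) Num.max (width k l) r.
  rewrite -[n in r ^+ n]card_ord -prodr_const -big_split/=; apply: eq_bigr => l _.
  by rewrite maxr_pMr ?(ltW r0)// mulr1 mulrCA divff ?gt_eqF// mulr1 maxC.
have small : K * \prod_(l < n) Num.max (width k l) r <= c4 * block_gamma k.
  rewrite -prodE GE /Phi.
  have p0 : 0 <= \prod_(l < n) Num.max 1 (width k l / r).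
    by apply: prodr_ge0 => l _; rewrite le_max ler01.
  rewrite !mulrA ler_wpM2r//.
  have -> : r ^+ n = r ^- e * r ^+ (m * n) by rewrite mnE exprD mulKf// expf_neq0// gt_eqF.
  have re0 : 0 < r ^- e by rewrite invr_gt0 exprn_gt0.
  have -> : K * (r ^- e * r ^+ (m * n)) = c4 * (K / c4 * r ^+ (m * n)) * r ^- e.
    have -> : c4 * (K / c4 * r ^+ (m * n)) = K * r ^+ (m * n) by field; rewrite gt_eqF.
    ring.
  by rewrite ler_pM2r// ler_pM2l.
pose Q s := (K * \prod_(l < n) Num.max (eta l / height k) (G s) <= c4 * block_gamma k) &&
            (8 * (G s * height k) <= 1).
have exQ : exists s, Q s.
  have m0 : 0 < Num.min r (8 * height k)^-1 by rewrite lt_min r0 invr_gt0 mulr_gt0.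
  have [s hs] := G_small g2 m0.
  move: hs; rewrite le_min => /andP[sr sh]; exists s; apply/andP; split.
    apply: le_trans small; rewrite ler_pM2l//; apply: ler_prod => l _.
    rewrite le_max ltW ?divr_gt0//= ge_max !le_max etaw/=.
    by rewrite sr orbT.
  move: sh; rewrite -[leRHS]mul1r ler_pdivlMr ?mulr_gt0//.
  by rewrite mulrCA.
case: (ex_minnP exQ) => s /andP[Q1 Q2] smin; exists s; split=> //.
- move=> h hh h4 r' r'0; have hh0 : 0 < h by exact: lt_le_trans hh.
  apply: (@le_trans _ _ (K * \prod_(l < n) Num.max (eta l / height k) (G s))).
    rewrite ler_pM2l//; apply: ler_prod => l _; rewrite le_max (ltW (divr_gt0 (eta0 l) hh0))/=.
    rewrite ge_max !le_max lexx orbT andbT; apply/orP; left.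
    by rewrite (ler_pM2l (eta0 l)) lef_pV2 ?posrE.
  apply: le_trans Q1 _; rewrite Phi_rescale// -mulrA ler_pM2l ?invr_gt0 ?exprn_gt0//.
  have rN : 0 < r' / N by rewrite divr_gt0.
  have frN : 0 <= f (r' / N) by apply: f_ge0; exact: ltW.
  have c01 : 0 < c <= 1 by rewrite c0.
  apply: (@le_trans _ _ (c ^+ n * Phi f e (width k) (r' / N))).
    rewrite ler_pM2l ?exprn_gt0// GE; apply: Phi_min => // l l'.
    by apply: plank_width_mono.
  apply: le_trans (Phi_scale e (width k) frN rN c01) _; apply: Phi_mono => // l.
  have -> : eta l / h / N = cd / N * ((2 * tau k) `^ (- beta l) / h) by rewrite /eta; field; rewrite !gt_eqF.
  have -> : c * width k l = cd / N * (tau k `^ (- beta l) / 8 / height k).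
    by rewrite /c /plank_width; field; rewrite !gt_eqF.
  rewrite ler_pM2l ?divr_gt0//.
  apply: (@le_trans _ _ (tau k `^ (- beta l) / 2 / h)).
    rewrite -!mulrA ler_pM2l ?powR_gt0// -!invfM lef_pV2 ?posrE ?mulr_gt0//.
    by lra.
  rewrite ler_pM2r ?invr_gt0// powRM ?(ltW tk0)// mulrC ler_pM2r ?powR_gt0//.
  rewrite -[leLHS](@powR_inv1 R 2)// ler_powR ?ler1n// lerN2.
  by apply: (beta_le1 hbeta sbeta).
- move=> h hh; have hh0 : 0 < h by exact: lt_le_trans hh.
  have s0 : (0 < s)%N.
    rewrite lt0n; apply/negP => /eqP s0; move: Q2; rewrite s0 expr0 invr1 mul1r leNgt => /negP; apply.
    have : 1 <= height k by exact: powR_scale_ge1.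
    lra.
  have nQ : ~~ Q s.-1 by apply/negP => /smin; rewrite leqNgt ltn_predL s0.
  have GS : G s.-1 = g%:R * G s by rewrite -[s in RHS](prednK s0) exprS invfM mulrA mulfV ?mul1r// gt_eqF.
  pose P := \prod_(l < n) Num.max (eta l) (G s.-1 * height k).
  have hP : (4 * g%:R) ^- n * P <= \prod_(l < n) (1 / 4 * Num.max (eta l) (G s * h)).
    rewrite /P -exprVn -[n in _ ^+ n]card_ord -prodr_const -big_split/=; apply: ler_prod => l _.
    have m0 : 0 <= Num.max (eta l) (G s.-1 * height k) by rewrite le_max ltW.
    rewrite mulr_ge0 ?invr_ge0 ?mulr_ge0//=.
    suff : Num.max (eta l) (G s.-1 * height k) <= g%:R * Num.max (eta l) (G s * h).
      by move=> MM; rewrite [leLHS]mulrC ler_pdivrMr ?mulr_gt0//; lra.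
    rewrite ge_max; apply/andP; split.
      apply: (@le_trans _ _ (g%:R * eta l)); first by rewrite ler_peMl ?(ltW (eta0 _))// ler1n.
      by rewrite ler_pM2l// le_max lexx.
    rewrite GS -mulrA ler_pM2l// le_max; apply/orP; right.
    by rewrite ler_pM2l.
  have PE : P = height k ^+ n * \prod_(l < n) Num.max (eta l / height k) (G s.-1).
    rewrite -[n in _ ^+ n]card_ord -prodr_const -big_split/=; apply: eq_bigr => l _.
    by rewrite maxr_pMr ?(ltW (h0 _))// mulrCA divff ?gt_eqF// mulr1 (mulrC (height k)).
  apply: le_trans hP; rewrite ge_min; apply/orP.
  (* If the content bound fails at [s - 1], the volume is at least a multiple of the block term. If
     the size condition fails, each factor of [P] is at least [1/8], whence [(32 g) ^- n]. *)
  move: nQ; rewrite negb_and -!ltNge => /orP[h1|h1]; [right|left].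
    rewrite -mulrA ler_pM2l ?invr_gt0 ?exprn_gt0 ?mulr_gt0// PE mulrCA ler_pM2l ?exprn_gt0//.
    by rewrite mulrAC ler_pdivrMr// [leRHS]mulrC; exact: ltW.
  have -> : (32 * g%:R) ^- n = (4 * g%:R) ^- n * (1 / 8) ^+ n :> R.
    rewrite -!exprVn -exprMn; congr (_ ^+ _); field; rewrite gt_eqF//.
  rewrite ler_pM2l ?invr_gt0 ?exprn_gt0 ?mulr_gt0// /P -[n in _ ^+ n]card_ord -prodr_const.
  apply: ler_prod => l _; rewrite le_max; apply/andP; split; first by lra.
  apply/orP; right; lra.
Qed.

End Supply.

(** * Supply of patterns *)

Lemma le_half_of_eighth (R : realType) (x : R) : 8 * x <= 1 -> 4 * x <= 1 / 2.
Proof. lra. Qed.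

Lemma quarter_sum_lt (R : realType) (x : R) : 0 < x -> x / 4 + x / 4 < x.
Proof. lra. Qed.

Lemma quarter_mul_ge1 (R : realType) (x y : R) : 4 <= x * y -> 1 <= x / 4 * y.
Proof. lra. Qed.

Section PatternSupply.
Context {R : realType} {m n : nat}.
Variables (alpha : 'I_m -> R) (beta : 'I_n -> R) (psi f : R -> R) (lambda : R)
  (b : 'cV[R]_m) (j0 : 'I_n) (ia : 'I_m) (g : nat).
Hypotheses (hm : (0 < m)%N)
  (halpha : forall i, 0 < alpha i) (hbeta : forall j, 0 < beta j)
  (salpha : \sum_(i < m) alpha i = 1) (sbeta : \sum_(j < n) beta j = 1)
  (alpha_max : forall i, alpha i <= alpha ia)
  (beta_decr : forall j l : 'I_n, (j <= l)%N -> beta l <= beta j)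
  (psi_pos : forall t, 0 < t -> 0 < psi t)
  (psi_decr : forall s t, 0 < s -> s <= t -> psi t <= psi s)
  (psi_lim : psi t @[t --> +oo] --> 0)
  (hlambda : 1 < lambda)
  (psi_ratio : forall t, 1 <= t -> lambda <= psi t / psi (2 * t))
  (f_ge0 : forall x, 0 <= x -> 0 <= f x)
  (f_ge : dim_lower (m.-1 * n + (n - j0.+1)) f)
  (f_le : dim_upper f (m.-1 * n + (n - j0)))
  (f_lim : f r / r ^+ (m * n) @[r --> 0^'+] --> +oo)
  (g2 : (1 < g)%N)
  (b_nonint : forall lv : nat, exists i, forall k : int, b i 0 * (g ^ lv)%N%:R <> k%:~R)
  (div : gamma_series alpha beta psi f = +oo%E).
Local Notation G l := (g%:R ^- l : R).
Local Notation scale := (@scale R m).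
Local Notation height := (height alpha ia).
Local Notation tau := (@tau R m psi).
Local Notation block_gamma := (block_gamma alpha beta psi f j0 ia).

Let g0 : (0 < g)%N. Proof. exact: ltnW. Qed.
Let gR0 : 0 < g%:R :> R. Proof. by rewrite ltr0n. Qed.

Definition frequently_bad (T : R) : set 'M[R]_(m, n) :=
  [set A | exists2 t, T <= t & ~ solvable_at alpha beta psi b A t].

(** Vectors are taken with entries in [[side, 2 * side)]. These intervals are disjoint for different
    [k] in the coordinate [ia] ([side_disjoint]), so no vector is used twice. *)
Definition side (k : nat) (i : 'I_m) : nat := (Num.truncn (scale k `^ alpha i)).+1.

Lemma side_ge k i : scale k `^ alpha i <= (side k i)%:R.
Proof. exact: ltW (truncn_gt (powR_ge0 _ _)). Qed.

Lemma side_le k i : (side k i)%:R <= 2 * scale k `^ alpha i.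
Proof.
have := truncn_le (powR_ge0 (scale k) (alpha i)); have := powR_scale_ge1 halpha k i.
by rewrite /side -natr1; lra.
Qed.

Lemma side_disjoint k l : (k < l)%N -> (2 * side k ia <= side l ia)%N.
Proof.
move=> kl; rewrite -(ler_nat R) natrM.
have h1 : scale k.+1 `^ alpha ia <= scale l `^ alpha ia.
  apply: powR_le; [exact: ltW (scale_gt0 _)|exact: scale_le|exact: ltW].
have h2 := powR_scaleS alpha k ia; have h3 := scale_step hm salpha alpha_max.
have h4 := side_le k ia; have h5 := side_ge l ia; have h6 := powR_scale_ge1 halpha k ia.
rewrite h2 in h1; nra.
Qed.

Lemma side_prod k : scale k <= (\prod_i side k i)%N%:R.
Proof.
rewrite (scale_prod salpha).
by rewrite natr_prod; apply: ler_prod => i _; rewrite powR_ge0 side_ge.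
Qed.

(** Multiplication by [g ^ lv] turns the corner of the ambient cube into an integral contribution.
    Inside a cell the form varies by at most [m * h] grid steps, which the half width held back in
    [in_plank] allows. *)
Lemma cell_in_plank (lv L : nat) (v : 'I_m -> nat) (h : nat) (eta : 'I_n -> R)
    (c : 'M['I_(g ^ L)]_(m, n)) (x : 'M[nat]_(m, n)) (A : 'M[R]_(m, n)) :
  (forall i, (v i <= h)%N) -> (forall l, 4 * m.+1%:R * h%:R <= g%:R ^+ L * eta l) ->
  in_plank v eta c -> cell g (lv + L) (refine g L x (map_mx val c)) A ->
  exists p : 'I_n -> int, forall l,
    `|\sum_i (g ^ lv * v i)%N%:R * A i l - (p l)%:~R| <= eta l.
Proof.
move=> vh Lh [p hp] cA.
have gL0 : 0 < g%:R ^+ L :> R by rewrite exprn_gt0.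
have gl0 : 0 < g%:R ^+ lv :> R by rewrite exprn_gt0.
exists (fun l => p l + \sum_i (v i)%:Z * (x i l)%:Z) => l.
pose th i : R := g%:R ^+ (lv + L) * A i l - (x i l * g ^ L + c i l)%N%:R.
have thb i : 0 <= th i <= 1.
  have /andP[a1 a2] := cA i l; move: a1 a2; rewrite !mxE => a1 a2.
  have gg : 0 < g%:R ^+ (lv + L) :> R by rewrite exprn_gt0.
  move: a1 a2; rewrite ler_pdivrMr// ler_pdivlMr// -natr1 => a1 a2.
  by rewrite /th; apply/andP; split; lra.
have AE i : g%:R ^+ lv * A i l = (x i l)%:R + (c i l : nat)%:R / g%:R ^+ L + th i / g%:R ^+ L.
  rewrite /th natrD natrM natrX exprD; field; rewrite gt_eqF//.
rewrite rmorphD/= rmorph_sum/=.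
have -> : \sum_i (g ^ lv * v i)%N%:R * A i l - ((p l)%:~R + \sum_i ((v i)%:Z * (x i l)%:Z)%:~R) =
   (\sum_i (v i)%:R * (c i l : nat)%:R - (p l)%:~R * g%:R ^+ L) / g%:R ^+ L +
   (\sum_i (v i)%:R * th i) / g%:R ^+ L.
  have e1 : \sum_i (g ^ lv * v i)%N%:R * A i l = \sum_i (v i)%:R * (x i l)%:R +
      (\sum_i (v i)%:R * (c i l : nat)%:R) / g%:R ^+ L + (\sum_i (v i)%:R * th i) / g%:R ^+ L.
    rewrite !mulr_suml -!big_split/=; apply: eq_bigr => i _.
    rewrite natrM natrX.
    have -> : g%:R ^+ lv * (v i)%:R * A i l = (v i)%:R * (g%:R ^+ lv * A i l) by ring.
    by rewrite AE; ring.
  have e2 : \sum_i ((v i)%:Z * (x i l)%:Z)%:~R = \sum_i (v i)%:R * (x i l)%:R :> R.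
    by apply: eq_bigr => i _; rewrite rmorphM.
  by rewrite e1 e2; field; rewrite gt_eqF.
apply: le_trans (ler_normD _ _) _; rewrite !normrM.
have ng : `|(g%:R ^+ L : R)^-1| = (g%:R ^+ L)^-1 by rewrite ger0_norm// invr_ge0 ltW.
rewrite ng -mulrDl ler_pdivrMr//.
have s1 : `|\sum_i (v i)%:R * th i| <= m%:R * h%:R.
  apply: le_trans (ler_norm_sum _ _ _) _.
  apply: (@le_trans _ _ (\sum_(i < m) h%:R)).
    apply: ler_sum => i _; have /andP[t0 t1] := thb i.
    rewrite ger0_norm ?mulr_ge0//; apply: (@le_trans _ _ ((v i)%:R * 1)); first by rewrite ler_wpM2l.
    by rewrite mulr1 ler_nat.
  by rewrite sumr_const card_ord mulr_natl.
have := hp l; have := Lh l; rewrite -natr1.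
have : 0 <= h%:R :> R by []; have : 0 <= m%:R * h%:R :> R by rewrite mulr_ge0.
move: s1; nra.
Qed.

(** The order of choices matters: [de] depends on [b] and [lv], then [p] and [cd] on [de], and the
    blocks come last because [c5] depends on [cd]. Only the size of the finite family depends on
    these, not the constant of the bound. *)
Lemma supply_step (lv : nat) (K T : R) : 0 < K ->
  exists (L : nat) (t : seq ('M[nat]_(m, n) * R)), [/\ weights g L t,
    forall l y, (l <= L)%N ->
      mass t (fun x => coarse g (L - l) x == y) <=
      (@family_const R m n (expR (- 48)))^-1 *
       (G l ^+ (m * n) + (8 * (2 * m.+3).+1%:R) ^+ n * (f (G (lv + l)) / K))
  & forall c x, c \in cells t -> cell g (lv + L) (refine g L x c) `<=` frequently_bad T].
Proof.
move=> K0; have [i1 hi1] := b_nonint lv.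
pose N := (g ^ lv)%N; have N0 : (0 < N)%N by rewrite expn_gt0 g0.
have NR : 0 < N%:R :> R by rewrite ltr0n.
have mR : 0 < m%:R :> R by rewrite ltr0n.
have n0 : (0 < n)%N by apply: leq_ltn_trans (ltn_ord j0).
have nR : 0 < n%:R :> R by rewrite ltr0n.
pose cc i : R := b i 0 * N%:R.
have cc0 : 0 < dist_int (cc i1) by exact: dist_int_gt0.
pose de := dist_int (cc i1) / 2; have de0 : 0 < de by rewrite divr_gt0.
(* Entries are at most [4 * N * scale k ^ alpha i], so the [m] terms with [psi] in [unsolvable_time]
   add up to at most [de / 4]. *)
pose e := de / (16 * m%:R * N%:R).
have e0 : 0 < e by rewrite divr_gt0// !mulr_gt0.
have [p hp] := psi_pow_small halpha psi_pos hlambda psi_ratio e0.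
have p2 : 1 <= 2 ^+ p :> R by rewrite exprn_ege1// ler1n.
have p20 : 0 < 2 ^+ p :> R by exact: lt_le_trans p2.
(* The [n] terms with [q] lose [2 ^+ p] by the later time and still add up to at most [de / 4]. *)
pose cd := Num.min (1 / 4) (de / (4 * n%:R * 2 ^+ p)).
have cdb : 0 < cd <= 1 / 4.
  by rewrite lt_min ge_min lexx divr_gt0//= divr_gt0// !mulr_gt0.
have cdp : n%:R * (cd * 2 ^+ p) <= de / 4.
  have : cd <= de / (4 * n%:R * 2 ^+ p) by rewrite ge_min lexx orbT.
  rewrite ler_pdivlMr ?mulr_gt0//; lra.
have [cd0 cd4] := andP cdb.
have [c5 c50 [k2 hk2]] := block_data ia hm halpha hbeta sbeta beta_decr psi_pos psi_decr psi_lim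
  f_ge0 f_ge f_le f_lim g2 lv K0 cdb.
pose cap : R := (32 * g%:R) ^- n; have cap0 : 0 < cap by rewrite invr_gt0 exprn_gt0// mulr_gt0.
have [ka hka] := tau_large hm psi_pos psi_decr psi_lim T.
have [kb hkb] := powR_scale_large hm halpha i1 4.
have [kc hkc] := @scale_large R m hm (4 / cap).
pose k3 := maxn (maxn k2 ka) (maxn kb kc).
have k3P k : (k3 <= k)%N -> [/\ (k2 <= k)%N, (ka <= k)%N, (kb <= k)%N & (kc <= k)%N].
  by rewrite !geq_max => /andP[/andP[-> ->] /andP[-> ->]].
have [k1 hk1] := block_divergence hm halpha hbeta salpha alpha_max beta_decr psi_pos psi_decr psi_lim
  f_ge0 f_ge f_le div (4 / c5) k3.
have /choice[sk hsk] : forall k, exists s : nat, (k3 <= k)%N ->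
    let eta l := cd * (2 * tau k) `^ (- beta l) in
    [/\ 8 * (G s * height k) <= 1,
      forall h, height k <= h -> h <= 4 * height k -> forall r, 0 < r ->
        K * \prod_(l < n) Num.max (eta l / h) (G s) <=
        Phi (fun x => f (x / g%:R ^+ lv)) (m.-1 * n) (fun l => eta l / h) r
    & forall h, height k <= h ->
        Num.min ((32 * g%:R) ^- n) (c5 * (height k ^+ n * block_gamma k)) <=
        \prod_(l < n) (1 / 4 * Num.max (eta l) (G s * h))].
  move=> k; have [kk|kk] := leqP k3 k; last by exists 0%N.
  by have [_ [s hs]] := hk2 k (let: And4 h _ _ _ := k3P k kk in h); exists s.
pose B := (\sum_(k < k1) \sum_i 2 * side k i)%N.
have sB (k : 'I_k1) i : (2 * side k i <= B)%N.
  apply: leq_trans (leq_bigsum (fun k : 'I_k1 => \sum_i 2 * side k i)%N k).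
  exact: (leq_bigsum (fun i => 2 * side k i)%N).
pose Pr : pred ('I_k1 * {ffun 'I_m -> 'I_B}) := fun x =>
  (k3 <= x.1)%N && good_vec cc i1 (side x.1) x.2.
pose I := {x : 'I_k1 * {ffun 'I_m -> 'I_B} | Pr x}.
pose v (a : I) (i : 'I_m) : nat := (val a).2 i.
pose kk (a : I) : nat := (val a).1.
have aP a : [/\ (k3 <= kk a)%N, forall i, (side (kk a) i <= v a i < 2 * side (kk a) i)%N,
    de <= dist_int (\sum_i cc i * (v a i)%:R) &
    expR (- 48) * (gcdv (v a))%:R <= (totient (gcdv (v a)))%:R :> R].
  have /andP[h1 /and3P[/forallP h2 h3 h4]] := valP a.
  by split.
have vmax a : exists i, forall i', (v a i' <= v a i)%N.
  by have [i _ hi] := @arg_maxnP _ ia predT (v a) isT; exists i => i'; exact: hi.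
have [i0 hi0] := choice vmax.
have tau1 a : 1 <= tau (kk a).
  by have [/k3P[h _ _ _] _ _ _] := aP a; have [] := hk2 _ h.
have ht a : 0 < tau (kk a) by exact: lt_le_trans (tau1 a).
pose eta (a : I) l := cd * (2 * tau (kk a)) `^ (- beta l).
have vR a i : (v a i)%:R <= 4 * scale (kk a) `^ alpha i.
  have [_ /(_ i)/andP[_ vi] _ _] := aP a.
  apply: (@le_trans _ _ (2 * side (kk a) i)%N%:R); first by rewrite ler_nat ltnW.
  by rewrite natrM; have := side_le (kk a) i; lra.
have hlo a : height (kk a) <= (v a (i0 a))%:R.
  have [_ /(_ ia)/andP[vi _] _ _] := aP a.
  apply: le_trans (side_ge _ _) _; rewrite ler_nat; exact: leq_trans vi (hi0 a ia).
have hhi a : (v a (i0 a))%:R <= 4 * height (kk a).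
  apply: le_trans (vR a _) _; rewrite ler_pM2l//.
  exact: (powR_scale_height alpha_max).
have eta_gt0 a l : 0 < eta a l by rewrite mulr_gt0// powR_gt0// mulr_gt0.
have eta_le a l : eta a l <= 1 / 2.
  have : (2 * tau (kk a)) `^ (- beta l) <= 1.
    rewrite -[leRHS](powRr0 (2 * tau (kk a))) ler_powR ?oppr_le0 ?(ltW (hbeta _))//.
    by have := tau1 a; lra.
  move=> h; apply: (@le_trans _ _ (cd * 1)); [by rewrite ler_pM2l|lra].
pose s (a : I) := sk (kk a).
have skP a := hsk (kk a) (let: And4 h _ _ _ := aP a in h).
have s_le a : G (s a) * (v a (i0 a))%:R <= 1 / 2.
  have [h1 _ _] := skP a; have Gs : 0 < G (s a) by rewrite invr_gt0 exprn_gt0.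
  have : G (s a) * (v a (i0 a))%:R <= G (s a) * (4 * height (kk a)) by rewrite ler_pM2l.
  move/le_trans; apply; rewrite mulrCA; exact: le_half_of_eighth.
have v_gt0 a i : (0 < v a i)%N.
  by have [_ /(_ i)/andP[vi _] _ _] := aP a; apply: leq_trans vi.
have v_inj a a' : a != a' -> exists i, v a i != v a' i.
  move=> aa; apply: contrapT => /forallNP h; move/eqP: aa; apply.
  have vv i : v a i = v a' i by apply/eqP/negPn/negP; exact: h.
  have [_ /(_ ia)/andP[u1 u2] _ _] := aP a; have [_ /(_ ia)/andP[u3 u4] _ _] := aP a'.
  have ka_eq : kk a = kk a'.
    have [lt|lt|//] := ltngtP (kk a) (kk a').
      by have := side_disjoint lt; move: u1 u2 u3 u4; rewrite vv; clear; lia.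
    by have := side_disjoint lt; move: u1 u2 u3 u4; rewrite vv; clear; lia.
  apply: val_inj; move: ka_eq vv; rewrite /kk /v; case: (val a) (val a') => [x w] [x' w'] /= e1 e2.
  by congr (_, _); [exact: val_inj|apply/ffunP => i; apply: val_inj; exact: e2].
have total : 1 <= \sum_a \prod_l (1 / 4 * Num.max (eta a l) (G (s a) * (v a (i0 a))%:R)).
  pose om k := height k ^+ n * block_gamma k.
  pose mn k := Num.min cap (c5 * om k).
  have om0 k : (k3 <= k)%N -> 0 <= om k.
    move=> /k3P[h _ _ _]; have [t1 _] := hk2 _ h.
    have t0 : 0 < tau k by exact: lt_le_trans t1.
    have w0 : 0 < plank_width beta (tau k) (height k) j0.
      by apply: plank_width_gt0 => //; exact: height_gt0.
    rewrite mulr_ge0 ?exprn_ge0 ?(ltW (height_gt0 _ _ _))//.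
    by apply: Phi_ge0 => //; apply: f_ge0; exact: ltW.
  have mn0 k : (k3 <= k)%N -> 0 <= mn k.
    by move=> h; rewrite le_min (ltW cap0)/= mulr_ge0 ?(ltW c50)// om0.
  apply: (@le_trans _ _ (\sum_a mn (kk a))); last first.
    by apply: ler_sum => a _; have [_ _ h] := skP a; apply: h.
  rewrite (sum_sig Pr (fun x => mn (x.1 : nat))).
  rewrite -(pair_big_dep (fun k : 'I_k1 => (k3 <= k)%N)
    (fun (k : 'I_k1) w => good_vec cc i1 (side k) w) (fun (k : 'I_k1) w => mn k))/=.
  apply: (@le_trans _ _ (\sum_(k < k1 | (k3 <= k)%N) scale k / 4 * mn k)); last first.
    apply: ler_sum => k kk3; rewrite sumr_const -[leRHS]mulr_natl ler_wpM2r ?mn0//.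
    have [_ _ h3 _] := k3P _ kk3.
    have X4 : (4 <= side k i1)%N.
      by rewrite -(ler_nat R); apply: le_trans (side_ge k i1); exact: hkb.
    have gc := @good_count R m cc i1 (side k) B (fun i => ltn0Sn _) (sB k) X4.
    by rewrite ler_pdivrMr// [leRHS]mulrC; exact: le_trans (side_prod k) gc.
  rewrite -(big_geq_mkord k3 k1 predT (fun k => scale k / 4 * mn k)).
  (* A block whose volume reaches [cap] suffices alone, since [scale k >= 4 / cap]. If there is
     none, every minimum is the block term and the divergence gives the sum. *)
  have [[k [/andP[k3k kk1] big]]|nobig] := pselect (exists k, (k3 <= k < k1)%N /\ cap <= c5 * om k).
    rewrite (bigD1_seq k) ?iota_uniq ?mem_index_iota ?k3k//=.
    have t1 : 1 <= scale k / 4 * mn k.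
      rewrite /mn min_l//; have [_ _ _ h] := k3P _ k3k.
      by apply: quarter_mul_ge1; have := hkc k h; rewrite ler_pdivrMr.
    apply: le_trans t1 _; rewrite lerDl big_seq_cond; apply: sumr_ge0 => k' /andP[+ _].
    rewrite mem_index_iota => /andP[h _]; rewrite mulr_ge0 ?mn0// divr_ge0//.
    exact: ltW (scale_gt0 _).
  apply: (@le_trans _ _ (c5 / 4 * \sum_(k3 <= k < k1) scale k * om k)).
    by apply: quarter_mul_ge1; have := hk1; rewrite ler_pdivrMr// [_ * c5]mulrC.
  rewrite mulr_sumr; apply: ler_sum_nat => k hk.
  have -> : mn k = c5 * om k.
    by apply: min_r; apply: ltW; rewrite ltNge; apply/negP => h; apply: nobig; exists k.
  by apply: ler_eq; ring.
have c0b : 0 < (expR (- 48) : R) <= 1 by rewrite expR_gt0/= -[leRHS]expR0 ler_expR oppr_le0.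
(* The pattern lives in the unit cube but is placed in a cube of level [lv], so [f] is read at the
   reduced scale. *)
pose fl (x : R) := f (x / g%:R ^+ lv).
have fl_ge0 x : 0 <= x -> 0 <= fl x by move=> x0; apply: f_ge0; rewrite divr_ge0// exprn_ge0.
have [L [t [t1 t2 t3 t4]]] := @pattern_of_family R m n g fl g2 fl_ge0 I v i0 eta s K (expR (- 48))
  v_gt0 hi0 v_inj eta_gt0 eta_le s_le c0b (fun a => let: And4 _ _ _ h := aP a in h) K0
  (fun a => let: And3 _ h _ := skP a in h _ (hlo a) (hhi a)) total.
exists L, t; split=> //.
  move=> l y lL; apply: le_trans (t2 l y lL) _; apply: ler_eq; congr (_ * (_ + _ * (f _ / _))).
  by rewrite exprD invfM mulrC.
move=> c x /t4[a [c' [pl ->]]] A cA.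
have [q hq] := cell_in_plank (hi0 a) (t3 a) pl cA.
pose tt := 2 * tau (kk a); have tt1 : 1 <= tt by apply: le_trans (tau1 a) _; rewrite ler_peMl ?(ltW (ht a))// ler1n.
have tt0 : 0 < tt by exact: lt_le_trans tt1.
exists (2 ^+ p * tt).
  have [/k3P[_ h _ _] _ _ _] := aP a; apply: le_trans (hka _ h) _.
  by rewrite /tt mulrA ler_peMl ?(ltW (ht a))// mulr_ege1// ler1n.
apply: (@unsolvable_time R m n alpha beta psi b halpha hbeta psi_pos (fun i => g ^ lv * v a i)%N q A).
  by rewrite mulr_gt0.
have [_ _ hd _] := aP a.
have dE : \sum_i b i 0 * (g ^ lv * v a i)%N%:R = \sum_i cc i * (v a i)%:R.
  by apply: eq_bigr => i _; rewrite /cc natrM mulrA.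
rewrite dE; apply: lt_le_trans hd.
have b1 : \sum_i (g ^ lv * v a i)%N%:R * psi (2 ^+ p * tt) `^ alpha i <= de / 4.
  apply: (@le_trans _ _ (\sum_(i < m) 4 * N%:R * e)); last first.
    by rewrite sumr_const card_ord -[leLHS]mulr_natl; apply: ler_eq; rewrite /e; field; rewrite !gt_eqF.
  apply: ler_sum => i _.
  have psi1 : scale (kk a) `^ alpha i * psi tt `^ alpha i <= 1.
    have ps0 : 0 <= psi tt by apply: ltW; exact: psi_pos.
    have -> : 1 = 1 `^ alpha i :> R by rewrite powR1.
    rewrite -powRM ?(ltW (scale_gt0 _))//; apply: powR_le.
    - by rewrite mulr_ge0// ltW// scale_gt0.
    - rewrite -ler_pdivlMl ?scale_gt0// mulr1; apply: ltW; exact: (psi_tau psi_pos psi_decr psi_lim (ht a)).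
    - exact: ltW.
  have hpi := hp i tt tt1; have vi := vR a i; have q0 := powR_ge0 (psi tt) (alpha i).
  rewrite natrM -/N.
  apply: (@le_trans _ _ (N%:R * (4 * scale (kk a) `^ alpha i) * (e * psi tt `^ alpha i))).
    by apply: ler_pM => //; rewrite ?mulr_ge0 ?powR_ge0// ler_pM2l.
  have -> : N%:R * (4 * scale (kk a) `^ alpha i) * (e * psi tt `^ alpha i) =
    4 * N%:R * e * (scale (kk a) `^ alpha i * psi tt `^ alpha i) by ring.
  by rewrite ler_piMr// !mulr_ge0// ltW.
have b2 : \sum_l `|\sum_i (g ^ lv * v a i)%N%:R * A i l - (q l)%:~R| * (2 ^+ p * tt) `^ beta l <= de / 4.
  apply: le_trans cdp; rewrite mulr_natl -[n in leRHS]card_ord -sumr_const.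
  apply: ler_sum => l _.
  apply: (@le_trans _ _ (eta a l * (2 ^+ p * tt) `^ beta l)); first by rewrite ler_wpM2r ?powR_ge0.
  rewrite /eta -/tt powRM ?(ltW tt0) ?(ltW p20)// powRN.
  have tb : 0 < tt `^ beta l by rewrite powR_gt0.
  have -> : cd * (tt `^ beta l)^-1 * ((2 ^+ p) `^ beta l * tt `^ beta l) = cd * (2 ^+ p) `^ beta l.
    by field; rewrite gt_eqF.
  rewrite ler_pM2l// -[leRHS]powRr1 ?(ltW p20)// ler_powR//.
  by apply: (beta_le1 hbeta sbeta).
exact: le_lt_trans (lerD b1 b2) (quarter_sum_lt de0).
Qed.

End PatternSupply.

(** * The divergence case *)

(** If [2 ^ l2 * b] and [3 ^ l3 * b] were both integral, a Bezout relation would make [b]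
    integral. *)
Lemma exists_base (R : realType) (m : nat) (b : 'cV[R]_m) :
  (~ exists z : 'cV[int]_m, b = real_vec z) ->
  exists2 g : nat, (1 < g)%N &
    forall lv : nat, exists i, forall k : int, b i 0 * (g ^ lv)%N%:R <> k%:~R.
Proof.
move=> hb; apply: contrapT => h.
have fail g : (1 < g)%N -> exists lv : nat, forall i, exists k : int, b i 0 * (g ^ lv)%N%:R = k%:~R.
  move=> g1; apply: contrapT => /forallNP h'; apply: h; exists g => // lv.
  have /existsNP[i /forallNP hi] := h' lv; exists i; exact: hi.
have [l2 h2] := fail 2 isT; have [l3 h3] := fail 3 isT; apply: hb.
have cop : coprimez (2 ^ l2)%N%:Z (3 ^ l3)%N%:Z.
  by rewrite coprimezE !absz_nat coprimeXl// coprimeXr.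
have /coprimezP[[x y] /= xy] := cop.
have hz i : {z : int | b i 0 = z%:~R}.
  apply: cid; have [k hk] := h2 i; have [k' hk'] := h3 i; exists (x * k + y * k').
  rewrite rmorphD !rmorphM/= -hk -hk'.
  have := congr1 (fun z : int => z%:~R : R) xy; rewrite rmorphD !rmorphM/= => e.
  by rewrite -[LHS]mulr1 -[X in _ * X]e -!pmulrn; ring.
by exists (\col_i sval (hz i)); apply/matrixP => i j; rewrite ord1 !mxE; exact: (svalP (hz i)).
Qed.

Section Divergence.
Context {R : realType} {m n : nat}.
Variables (alpha : 'I_m -> R) (beta : 'I_n -> R) (psi f : R -> R) (lambda : R)
  (b : 'cV[R]_m) (a : nat).
Hypotheses (hm : (1 <= m)%N)
  (halpha : forall i, 0 < alpha i) (hbeta : forall j, 0 < beta j)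
  (salpha : \sum_(i < m) alpha i = 1) (sbeta : \sum_(j < n) beta j = 1)
  (beta_decr : forall j l : 'I_n, (j <= l)%N -> beta l <= beta j)
  (psi_pos : forall t, 0 < t -> 0 < psi t)
  (psi_decr : forall s t, 0 < s -> s <= t -> psi t <= psi s)
  (psi_lim : psi t @[t --> +oo] --> 0)
  (hlambda : 1 < lambda)
  (psi_ratio : forall t, 1 <= t -> lambda <= psi t / psi (2 * t))
  (hb : ~ exists z : 'cV[int]_m, b = real_vec z)
  (hf : dimension_function f) (ha : (1 <= a <= n - 1)%N)
  (f_ge : dim_lower (m.-1 * n + (n - a)) f)
  (f_le : dim_upper f (m.-1 * n + (n - a.-1)))
  (fu : dim_upper f (m * n))
  (f_lim : f r / r ^+ (m * n) @[r --> 0^'+] --> +oo).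

(** Stated for supersets so that it applies to the unit cube as well as to the complement. *)
Lemma divergence_case (E : set 'M[R]_(m, n)) :
  Dirichlet_set_compl alpha beta psi b `<=` E ->
  gamma_series alpha beta psi f = +oo%E -> hausdorff_measure f E = +oo%E.
Proof.
move=> DE div; apply: hausdorff_measure_infty => M.
have [g g2 bg] := exists_base hb.
have [a1 an] := andP ha.
have jn : (a.-1 < n)%N by move: a1 an; clear; lia.
have f_ge' : dim_lower (m.-1 * n + (n - (Ordinal jn).+1)) f by rewrite /= prednK.
have f0 x : 0 <= x -> 0 <= f x by have [_ _ + _] := hf; apply.
have [ia alpha_max] : exists ia, forall i, alpha i <= alpha ia.
  by have [i _ hi] := @arg_maxP _ _ _ (Ordinal hm) predT alpha isT; exists i => i'; exact: hi.
pose D : R := (8 * (2 * m.+3).+1%:R) ^+ n.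
have D1 : 1 <= D.
  by rewrite exprn_ege1// -natrM ler1n.
pose Fc := @family_const R m n (expR (- 48)).
have Fc0 : 0 < Fc.
  by rewrite !(divr_gt0, mulr_gt0, exprn_gt0)// ?ltr0n// divr_gt0// expR_gt0.
pose C := Num.max 1 (Fc^-1 * D).
have ps : pattern_supply g f (frequently_bad alpha beta psi b) C.
  move=> lv K T K0.
  have [L [t [t1 t2 t3]]] := supply_step hm halpha hbeta salpha sbeta alpha_max beta_decr psi_pos psi_decr
    psi_lim hlambda psi_ratio f0 f_ge' f_le f_lim g2 bg div lv T K0.
  exists L, t; split=> // l y lL; apply: le_trans (t2 l y lL) _.
  have G0 k : 0 <= g%:R ^- k :> R by rewrite invr_ge0 exprn_ge0.
  have p1 : 0 <= g%:R ^- l ^+ (m * n) :> R by rewrite exprn_ge0.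
  have p2 : 0 <= f (g%:R ^- (lv + l)) / K by rewrite divr_ge0 ?(ltW K0)// f0.
  apply: (@le_trans _ _ (Fc^-1 * D * (g%:R ^- l ^+ (m * n) + f (g%:R ^- (lv + l)) / K))).
    rewrite -[leRHS]mulrA; apply: ler_wpM2l; first by rewrite invr_ge0 ltW.
    by rewrite [leRHS]mulrDr; apply: lerD => //; rewrite ler_peMl.
  by rewrite ler_wpM2r ?addr_ge0// le_max lexx orbT.
(* Compensates the loss in [cantor_content], so that the content is at least [M]. *)
pose M' := Num.max 1 M * (2 ^+ (m * n) * g%:R ^+ (m * n)).
have gR : 0 < g%:R :> R by rewrite ltr0n ltnW.
have q0 : 0 < 2 ^+ (m * n) * g%:R ^+ (m * n) :> R by rewrite mulr_gt0 ?exprn_gt0.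
have M'0 : 0 < M' by rewrite mulr_gt0// lt_max ltr01.
have C1 : 1 <= C by rewrite le_max lexx.
have [l0 [lv [s [st lvS nest bad]]]] := stage_sequence g2 hf fu f_lim M'0 C1 ps.
exists (g%:R ^- l0); first by rewrite invr_gt0 exprn_gt0.
move=> eta /andP[_ etal].
apply: (@le_trans _ _ (hausdorff_content f (cantor_set g lv s) eta)); last first.
  apply: content_mono => A cA; apply: DE; split.
    have [x xs /= xA] := cA 0%N; have [_ [_ wb _] _] := st 0%N => i j.
    have /mapP[y ys xy] := xs; have xb := wb y ys; rewrite -xy in xb.
    have gl : 0 < g%:R ^+ lv 0%N :> R by rewrite exprn_gt0.
    have /andP[h1 h2] := xA i j; apply/andP; split.
      by apply: le_trans h1; rewrite divr_ge0// ltW.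
    apply: le_trans h2 _; rewrite ler_pdivrMr// mul1r -natrX ler_nat; exact: xb.
  (* Being Dirichlet would make all times beyond [Mr] solvable; stage [k.+1] of the Cantor set
     provides an unsolvable time at least [k > Mr]. *)
  move=> [_ [Mr [_ hMr]]].
  have [k hk] : exists k : nat, Mr < k%:R.
    exists (Num.truncn `|Mr|).+1; apply: le_lt_trans (ler_norm _) _; exact: truncn_gt.
  have [x xs xA] := cA k.+1.
  have [t kt] := bad k x xs A xA; apply; exact: hMr (lt_le_trans hk kt).
have := @cantor_content R m n g f M' l0 lv s g2 hf fu M'0 st lvS nest eta etal.
apply: le_trans; rewrite lee_fin /M' mulfK ?gt_eqF//.
by rewrite le_max lexx orbT.
Qed.

End Divergence.

Theorem theorem1p7 (R : realType) (m n : nat) (hm : (1 <= m)%N) (hn : (1 <= n)%N)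
  (alpha : 'I_m -> R) (beta : 'I_n -> R)
  (halpha : forall i, 0 < alpha i) (hbeta : forall j, 0 < beta j)
  (salpha : \sum_(i < m) alpha i = 1) (sbeta : \sum_(j < n) beta j = 1)
  (beta_decr : forall j l : 'I_n, (j <= l)%N -> beta l <= beta j)
  (psi : R -> R)
  (psi_pos : forall t, 0 < t -> 0 < psi t)
  (psi_decr : forall s t, 0 < s -> s <= t -> psi t <= psi s)
  (psi_cont : forall t, 0 < t -> {for t, continuous psi})
  (psi_lim : psi t @[t --> +oo] --> 0)
  (lambda : R) (hlambda : 1 < lambda)
  (psi_ratio : forall t, 1 <= t -> lambda <= psi t / psi (2 * t))
  (f : R -> R) (hf : dimension_function f)
  (f_lt : dimfun_lt f (m * n)%:R)
  (a : nat) (ha : (1 <= a <= n - 1)%N)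
  (f_ge : dimfun_ge ((m * n)%:R - a%:R) f)
  (f_le : dimfun_le f ((m * n)%:R - a%:R + 1))
  (b : 'cV[R]_m) (hb : ~ exists z : 'cV[int]_m, b = real_vec z) :
  ((gamma_series alpha beta psi f < +oo)%E ->
     hausdorff_measure f (Dirichlet_set_compl alpha beta psi b) = 0%E) /\
  (gamma_series alpha beta psi f = +oo%E ->
     hausdorff_measure f (Dirichlet_set_compl alpha beta psi b)
     = hausdorff_measure f (@unit_cube R m n)).
Proof.
have [a1 an] := andP ha; have [fl fl'] := f_lt.
have mE : (m * n = m.-1 * n + n)%N by rewrite -[in LHS](prednK hm) mulSn addnC.
have e1 : (m * n)%:R - a%:R = (m.-1 * n + (n - a))%N%:R :> R.
  have an' : (a <= n)%N by apply: leq_trans an (leq_subr _ _).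
  by rewrite mE natrD -addrA -natrB// -natrD.
have e2 : (m * n)%:R - a%:R + 1 = (m.-1 * n + (n - a.-1))%N%:R :> R.
  by rewrite e1 natr1; congr (_%:R); move: a1 an; clear; lia.
have f_ge' : dim_lower (m.-1 * n + (n - a)) f by apply: dimfun_ge_lower; rewrite -e1.
have f_le' : dim_upper f (m.-1 * n + (n - a.-1)) by apply: dimfun_le_upper; rewrite -e2.
split=> [fin|div].
  exact: (convergence_case hm halpha hbeta sbeta beta_decr psi_pos psi_decr psi_lim hlambda psi_ratio hb hf ha).
have fu : dim_upper f (m * n) by exact: dimfun_le_upper.
have f_lim : f r / r ^+ (m * n) @[r --> 0^'+] --> +oo.
  apply: cvg_trans fl'; apply: near_eq_cvg; near=> r.
  by rewrite powR_mulrn//; apply: ltW; near: r; exact: nbhs_right_gt.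
have inf := divergence_case hm halpha hbeta salpha sbeta beta_decr psi_pos psi_decr psi_lim hlambda
  psi_ratio hb hf ha f_ge' f_le' fu f_lim.
(* Both measures are infinite. *)
by rewrite (inf _ (@subset_refl _ _) div) (inf (@unit_cube R m n) _ div)// => A [].
Unshelve. all: by end_near.
Qed.
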